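(* Let $k$ be a field with $\mathrm{char}(k)\neq2$ and let $n\geq1$. Let $\alpha\in k$ be nonzero and let $L$ be an invertible symmetric $n\times n$ matrix with entries in $k$. Then, in the Brauer group $BM(k,E(n),R_0)$, $$[C(\alpha,L)]=[C(-1)\#C(\alpha)\#A(1,L)]\,[A^\omega],$$ where $\omega$ is the special $2$-cocycle for $E(n)$ (with $\omega(c\otimes c)=1$, $\omega(c\otimes x_i)=\omega(x_i\otimes c)=0$) such that $\omega(x_i\otimes x_j)=((4L)^{-1})_{ij}$.
   Context: $E(n)$ is the Hopf algebra over $k$ generated by $c,x_1,\dots,x_n$ with relations $c^2=1$, $cx_i+x_ic=0$, $x_ix_j+x_jx_i=0$, $x_i^2=0$, coproduct $\Delta(c)=c\otimes c$, $\Delta(x_i)=1\otimes x_i+x_i\otimes c$, counit $\varepsilon(c)=1$, $\varepsilon(x_i)=0$, and antipode $S(c)=c$, $S(x_i)=cx_i$. It is quasitriangular with $R$-matrix $R_0=\frac12(1\otimes1+1\otimes c+c\otimes1-c\otimes c)$. Brauer group: let $H$ be a finite-dimensional quasitriangular Hopf algebra with $R$-matrix $R=\sum R^{(1)}\otimes R^{(2)}$, and let $A$ be a finite-dimensional left $H$-module algebra. Its opposite $\overline A$ is $A$ as an $H$-module, with product $a\circ b=\sum(R^{(2)}.b)(R^{(1)}.a)$. For two $H$-module algebras $A,B$, $A\#B$ is the $H$-module $A\otimes B$ with product $(a\#b)(c\#d)=\sum a(R^{(2)}.c)\#(R^{(1)}.b)d$ (for $R_0$ this is the $\mathbb{Z}_2$-graded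 tensor product, graded by the eigenspaces of $c$). $A$ is $(H,R)$-Azumaya if the maps $F'\colon A\#\overline A\to End(A)$, $F'(a\#\bar b)(c)=\sum a(R^{(2)}.c)(R^{(1)}.b)$, and $G'\colon\overline A\#A\to End(A)^{op}$, $G'(\bar a\#b)(c)=\sum(R^{(2)}.a)(R^{(1)}.c)b$, are isomorphisms. For a finite-dimensional $H$-module $P$, $End(P)$ is an $H$-module algebra via $(h\cdot f)(m)=\sum h_{(1)}\cdot f(S(h_{(2)})\cdot m)$. $BM(k,H,R)$ is the set of classes $[A]$ of $(H,R)$-Azumaya algebras under the relation $A\sim B$ iff $A\#End(P)\cong B\#End(Q)$ as $H$-module algebras for some finite-dimensional (nonzero) $H$-modules $P,Q$; it is a group with product $[A][B]=[A\#B]$ and inverse $[A]^{-1}=[\overline A]$. Module algebras (the action is determined by that of $c$ and $x_j$ on generators). For nonzero $\alpha\in k$ and a symmetric matrix $L=(l_{ij})$, $C(\alpha,L)$ is generated by $u,z_1,\dots,z_n$ with relations $u^2=\alpha$, $uz_i+z_iu=0$, $z_iz_j+z_jz_i=2l_{ij}$, $z_i^2=l_{ii}$, and action $c\rightharpoonup u=-u$, $c\rightharpoonup z_i=-z_i$, $x_j\rightharpoonup u=0$, $x_j\rightharpoonup z_i=\delta_{ij}$. $A(1,L)$ is the same algebra as $C(1,L)$ with the same action of $c$ but with trivial (zero) action of every $x_j$ on the generators. For nonzero $t\in k$, $C(t)$ is generated by a single element $x$ with $x^2=t$, $c\cdot x=-x$ and trivial (zero) action of every $x_j$. The algebra $A^\omega$.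 A $2$-cocycle for a Hopf algebra $H$ is a convolution invertible $\omega\in(H\otimes H)^*$ with $\omega(h\otimes1)=\omega(1\otimes h)=\varepsilon(h)$ and $\sum\omega(l_{(1)}\otimes m_{(1)})\omega(h\otimes l_{(2)}m_{(2)})=\sum\omega(h_{(1)}\otimes l_{(1)})\omega(h_{(2)}l_{(2)}\otimes m)$. To every symmetric matrix $M=(m_{ij})$ one may associate a special $2$-cocycle $\omega$ for $E(n)$ with $\omega(c\otimes c)=1$, $\omega(c\otimes x_i)=\omega(x_i\otimes c)=0$, $\omega(x_i\otimes x_j)=-m_{ij}$; these special cocycles are lazy, i.e. $\sum\omega(h_{(1)}\otimes l_{(1)})h_{(2)}l_{(2)}=\sum h_{(1)}l_{(1)}\omega(h_{(2)}\otimes l_{(2)})$ for all $h,l\in E(n)$. Let ${}_\omega E(n)$ be $E(n)$ with product $h\cdot l=\sum\omega(h_{(1)}\otimes l_{(1)})h_{(2)}l_{(2)}$ and let $f_h\in End({}_\omega E(n))$ be left multiplication by $h$ in ${}_\omega E(n)$; $h\mapsto f^{-1}_h$ denotes the convolution inverse of $h\mapsto f_h$. Then $A^\omega=End({}_\omega E(n))$ with $E(n)$-action $h\cdot f=\sum f_{h_{(1)}}\circ f\circ f^{-1}_{h_{(2)}}$; it is $(E(n),R_0)$-Azumaya.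
   Formalization: The cocycle is taken with ω(x_i⊗x_j) = −((4L)^{-1})_{ij}; with the plus sign as stated the equality fails under the given conventions (e.g. k=ℚ, n=1, L=(1), α=1). *)

(* Defs.v *)
From HB Require Import structures.
From mathcomp Require Import all_boot all_algebra all_field.
From mathcomp Require Import boolp classical_sets.

Set Implicit Arguments.
Unset Strict Implicit.
Unset Printing Implicit Defensive.
Import GRing.Theory.
Local Open Scope ring_scope.

(* The tensor product of finite-dimensional vector spaces, as the space of    *)
(* coordinate matrices with respect to the canonical bases: the pure tensor   *)
(* u (x) v is the rank one matrix with entries u_i v_j.                       *)
Definition tens (k : fieldType) (U V : vectType k) : vectType k :=
  'M[k]_(\dim {:U}, \dim {:V}).

Definition tpure (k : fieldType) (U V : vectType k) (u : U) (v : V) :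
    tens U V :=
  \matrix_(i, j) (coord (vbasis {:U}) i u * coord (vbasis {:V}) j v).

Notation "u ⊗ v" := (tpure u v) (at level 40, left associativity) : ring_scope.

(* For a bilinear F, [tsum F] is the linear map on the tensor product with    *)
(* u (x) v |-> F u v. It renders Sweedler-type sums: the sum over (h) of      *)
(* F(h_(1), h_(2)) is \tsum_(h1, h2 <- comul h) F h1 h2.                 *)
Definition tsum (k : fieldType) (U V W : vectType k) (F : U -> V -> W)
    (t : tens U V) : W :=
  \sum_i \sum_j (t : 'M[k]_(\dim {:U}, \dim {:V})) i j
    *: F (vbasis {:U})`_i (vbasis {:V})`_j.

Notation "\tsum_ ( a , b <- t ) E" := (tsum (fun a b => E) t)
  (at level 41, a binder, b binder, t, E at level 41,
   format "\tsum_ ( a ,  b  <-  t )  E") : ring_scope.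

Record hopfAlg (k : fieldType) := HopfAlg {
  hopf_alg :> falgType k;
  comul : {linear hopf_alg -> tens hopf_alg hopf_alg};
  counit : {linear hopf_alg -> k^o};
  antipode : {linear hopf_alg -> hopf_alg};
  comulA : forall h,
    \tsum_(a, b <- comul h) \tsum_(a1, a2 <- comul a) a1 ⊗ (a2 ⊗ b)
    = \tsum_(a, b <- comul h) \tsum_(b1, b2 <- comul b) a ⊗ (b1 ⊗ b2);
  counitl : forall h, \tsum_(a, b <- comul h) (counit a : k) *: b = h;
  counitr : forall h, \tsum_(a, b <- comul h) (counit b : k) *: a = h;
  comul1 : comul 1 = 1 ⊗ 1;
  comulM : forall g h, comul (g * h) =
    \tsum_(g1, g2 <- comul g) \tsum_(h1, h2 <- comul h)
      (g1 * h1) ⊗ (g2 * h2);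
  counit1 : counit 1 = 1;
  counitM : forall g h, counit (g * h) = (counit g : k) * (counit h : k);
  antipodel : forall h,
    \tsum_(a, b <- comul h) antipode a * b = (counit h : k) *: 1;
  antipoder : forall h,
    \tsum_(a, b <- comul h) a * antipode b = (counit h : k) *: 1 }.

Arguments counit {k} h : rename.
Arguments comul {k} h : rename.
Arguments antipode {k} h : rename.

(* Underlying data of algebras and H-module algebras; the axioms are the      *)
(* predicates [is_alg] and [is_modAlg] below. The library's falgType is not   *)
(* used here because End(P) and tensor products of algebras with a twisted    *)
(* product must be objects of the same kind.                                  *)
Record algData (k : fieldType) := AlgData {
  alg_car :> vectType k;
  alg_one : alg_car;
  alg_mul : alg_car -> alg_car -> alg_car }.

Record modAlg (k : fieldType) (H : hopfAlg k) := ModAlg {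
  modAlg_alg :> algData k;
  act : H -> modAlg_alg -> modAlg_alg }.

Arguments alg_one {k} A : rename.
Arguments alg_mul {k A} a b : rename.
Arguments act {k H A} h a : rename.

Declare Scope modalg_scope.
Delimit Scope modalg_scope with MA.
Notation "a ∙ b" := (alg_mul a b) (at level 40, left associativity)
  : modalg_scope.
Notation "h ⇀ a" := (act h a) (at level 38, right associativity)
  : modalg_scope.
Local Open Scope modalg_scope.

Definition is_bilinear (k : fieldType) (U V W : vectType k)
    (F : U -> V -> W) : Prop :=
  (forall u, linear (F u)) /\ (forall v, linear (F^~ v)).

Record is_alg (k : fieldType) (A : algData k) : Prop := IsAlg {
  is_alg_bilin : is_bilinear (@alg_mul k A);
  is_algA : forall a b c : A, a ∙ (b ∙ c) = (a ∙ b) ∙ c;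
  is_alg1l : forall a : A, alg_one A ∙ a = a;
  is_alg1r : forall a : A, a ∙ alg_one A = a;
  is_alg_neq0 : alg_one A != 0 }.

Record is_modAlg (k : fieldType) (H : hopfAlg k) (A : modAlg H) : Prop :=
  IsModAlg {
  is_modAlg_alg : is_alg A;
  is_modAlg_bilin : is_bilinear (@act k H A);
  is_modAlg_1act : forall a : A, 1 ⇀ a = a;
  is_modAlg_actA : forall (g h : H) (a : A), (g * h) ⇀ a = g ⇀ h ⇀ a;
  is_modAlg_act1 : forall h : H, h ⇀ alg_one A = (counit H h : k) *: alg_one A;
  is_modAlg_actM : forall (h : H) (a b : A),
    h ⇀ (a ∙ b) = \tsum_(h1, h2 <- comul H h) (h1 ⇀ a) ∙ (h2 ⇀ b) }.

Record alg_iso (k : fieldType) (A B : algData k) (f : A -> B) : Prop :=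
  AlgIso {
  alg_iso_linear : linear f;
  alg_iso_bij : bijective f;
  alg_iso1 : f (alg_one A) = alg_one B;
  alg_isoM : forall a b, f (a ∙ b) = f a ∙ f b }.

Definition modAlg_isog (k : fieldType) (H : hopfAlg k) (A B : modAlg H) : Prop :=
  exists f : A -> B, alg_iso f /\ forall (h : H) a, f (h ⇀ a) = h ⇀ f a.

Definition modAlg_of (k : fieldType) (H : hopfAlg k) (A : falgType k)
    (actA : H -> A -> A) : modAlg H :=
  @ModAlg k H (@AlgData k A 1 *%R) actA.

Record hmodule (k : fieldType) (H : hopfAlg k) := HModule {
  hmod_car :> vectType k;
  hact : H -> hmod_car -> hmod_car;
  hact_bilin : is_bilinear hact;
  hact1 : forall m, hact 1 m = m;
  hactA : forall g h m, hact (g * h) m = hact g (hact h m) }.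

Definition End_alg (k : fieldType) (V : vectType k) : algData k :=
  @AlgData k 'End(V) \1%VF (fun f g => (f \o g)%VF).

Definition op_alg (k : fieldType) (A : algData k) : algData k :=
  @AlgData k A (alg_one A) (fun a b => b ∙ a).

Definition End_modAlg (k : fieldType) (H : hopfAlg k) (P : hmodule H) :
    modAlg H :=
  @ModAlg k H (End_alg P) (fun h f =>
    \tsum_(h1, h2 <- comul H h)
      (linfun (hact h1) \o f \o linfun (hact (antipode H h2)))%VF).

Section Brauer.
Variables (k : fieldType) (H : hopfAlg k) (R : tens H H).

Definition modAlg_opp (A : modAlg H) : modAlg H :=
  @ModAlg k H (@AlgData k A (alg_one A) (fun a b =>
    \tsum_(r1, r2 <- R) (r2 ⇀ b) ∙ (r1 ⇀ a))) (fun h a => h ⇀ a).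

Definition smash (A B : modAlg H) : modAlg H :=
  @ModAlg k H (@AlgData k (tens A B) (alg_one A ⊗ alg_one B) (fun s t =>
    \tsum_(a, b <- s) \tsum_(c, d <- t) \tsum_(r1, r2 <- R)
      (a ∙ (r2 ⇀ c)) ⊗ ((r1 ⇀ b) ∙ d)))
  (fun h s => \tsum_(a, b <- s) \tsum_(h1, h2 <- comul H h)
      (h1 ⇀ a) ⊗ (h2 ⇀ b)).

Definition azumayaF (A : modAlg H) (s : smash A (modAlg_opp A)) : End_alg A :=
  linfun (fun c : A =>
    \tsum_(a, b <- s) \tsum_(r1, r2 <- R) a ∙ (r2 ⇀ c) ∙ (r1 ⇀ b)).

Definition azumayaG (A : modAlg H) (s : smash (modAlg_opp A) A) :
    op_alg (End_alg A) :=
  linfun (fun c : A =>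
    \tsum_(a, b <- s) \tsum_(r1, r2 <- R) (r2 ⇀ a) ∙ (r1 ⇀ c) ∙ b).

Definition azumaya (A : modAlg H) : Prop :=
  [/\ is_modAlg A, alg_iso (@azumayaF A) & alg_iso (@azumayaG A)].

Definition brauer_equiv (A B : modAlg H) : Prop :=
  exists P Q : hmodule H, [/\ (0 < \dim {:P})%N, (0 < \dim {:Q})%N &
    modAlg_isog (smash A (End_modAlg P)) (smash B (End_modAlg Q))].

(* [A] = [B] in BM(k, H, R), including that both classes make sense. *)
Definition BM_eq (A B : modAlg H) : Prop :=
  [/\ azumaya A, azumaya B & brauer_equiv A B].

End Brauer.

Section Cocycles.
Variables (k : fieldType) (H : hopfAlg k).
Implicit Type w : 'Hom(tens H H, k^o).

Definition conv_invertible w : Prop :=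
  exists w' : 'Hom(tens H H, k^o), forall h l : H,
    \tsum_(h1, h2 <- comul H h) \tsum_(l1, l2 <- comul H l)
      (w (h1 ⊗ l1) : k^o) * w' (h2 ⊗ l2) = counit H h * counit H l
    /\ \tsum_(h1, h2 <- comul H h) \tsum_(l1, l2 <- comul H l)
      (w' (h1 ⊗ l1) : k^o) * w (h2 ⊗ l2) = counit H h * counit H l.

Definition is_cocycle w : Prop :=
  [/\ conv_invertible w,
      forall h : H, w (h ⊗ 1) = counit H h /\ w (1 ⊗ h) = counit H h
    & forall h l m : H,
      \tsum_(l1, l2 <- comul H l) \tsum_(m1, m2 <- comul H m)
        (w (l1 ⊗ m1) : k^o) * w (h ⊗ (l2 * m2))
      = \tsum_(h1, h2 <- comul H h) \tsum_(l1, l2 <- comul H l)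
        (w (h1 ⊗ l1) : k^o) * w ((h2 * l2) ⊗ m)].

Definition twist_mul w (h l : H) : H :=
  \tsum_(h1, h2 <- comul H h) \tsum_(l1, l2 <- comul H l)
    (w (h1 ⊗ l1) : k) *: (h2 * l2).

Definition is_lazy w : Prop := forall h l : H,
  twist_mul w h l = \tsum_(h1, h2 <- comul H h) \tsum_(l1, l2 <- comul H l)
    (w (h2 ⊗ l2) : k) *: (h1 * l1).

Definition twist_lmul w (h : H) : 'End(H) := linfun (twist_mul w h).

Definition is_conv_inv (f : H -> 'End(H)) (g : 'Hom(H, 'End(H))) : Prop :=
  forall h : H,
    \tsum_(h1, h2 <- comul H h) (f h1 \o g h2)%VF
      = (counit H h : k) *: (\1%VF : 'End(H))
    /\ \tsum_(h1, h2 <- comul H h) (g h1 \o f h2)%VF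
      = (counit H h : k) *: (\1%VF : 'End(H)).

(* The convolution inverse is unique when it exists, so that this is it. *)
Definition conv_inv (f : H -> 'End(H)) : 'Hom(H, 'End(H)) :=
  xget 0 [set g | is_conv_inv f g].

Definition A_omega w : modAlg H :=
  @ModAlg k H (End_alg H) (fun h f =>
    \tsum_(h1, h2 <- comul H h)
      (twist_lmul w h1 \o f \o conv_inv (twist_lmul w) h2)%VF).

End Cocycles.

(* The algebra A is generated by the family g subject to the relations rels.  *)
Definition presented (k : fieldType) (I : Type)
    (rels : forall B : algType k, (I -> B) -> Prop)
    (A : algType k) (g : I -> A) : Prop :=
  rels A g /\ forall (B : algType k) (b : I -> B), rels B b ->
    exists f : {lrmorphism A -> B}, (forall i, f (g i) = b i) /\
      forall f' : {lrmorphism A -> B}, (forall i, f' (g i) = b i) -> f' =1 f.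

(* Generating families c, x_1 .. x_n and u, z_1 .. z_n are indexed by         *)
(* option 'I_n, with None for c or u.                                         *)
Definition E_rels (k : fieldType) n (B : algType k) (b : option 'I_n -> B) :=
  let c := b None in let x i := b (Some i) in
  [/\ c ^+ 2 = 1, forall i, c * x i + x i * c = 0,
      forall i j, x i * x j + x j * x i = 0 & forall i, x i ^+ 2 = 0].

Definition C_rels (k : fieldType) n (alpha : k) (L : 'M[k]_n)
    (B : algType k) (b : option 'I_n -> B) :=
  let u := b None in let z i := b (Some i) in
  [/\ u ^+ 2 = alpha%:A, forall i, u * z i + z i * u = 0,
      forall i j, z i * z j + z j * z i = (2 * L i j)%:A
    & forall i, z i ^+ 2 = (L i i)%:A].

Record is_En (k : fieldType) n (E : hopfAlg k) (c : E) (x : 'I_n -> E) :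
    Prop := IsEn {
  En_presented : presented (@E_rels k n) (oapp x c);
  En_comulc : comul E c = c ⊗ c;
  En_comulx : forall i, comul E (x i) = 1 ⊗ x i + x i ⊗ c;
  En_counitc : counit E c = 1;
  En_counitx : forall i, counit E (x i) = 0;
  En_antipodec : antipode E c = c;
  En_antipodex : forall i, antipode E (x i) = c * x i }.

Definition R0 (k : fieldType) (E : hopfAlg k) (c : E) : tens E E :=
  2^-1 *: (1 ⊗ 1 + 1 ⊗ c + c ⊗ 1 - c ⊗ c).

Section Models.
Variables (k : fieldType) (n : nat) (E : hopfAlg k) (c : E) (x : 'I_n -> E).

Definition is_C (alpha : k) (L : 'M[k]_n) (A : falgType k)
    (actA : E -> A -> A) : Prop :=
  is_modAlg (modAlg_of actA) /\ exists (u : A) (z : 'I_n -> A),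
  [/\ presented (@C_rels k n alpha L) (oapp z u),
      actA c u = - u, forall i, actA c (z i) = - z i,
      forall j, actA (x j) u = 0
    & forall i j, actA (x j) (z i) = (i == j)%:R].

Definition is_A1 (L : 'M[k]_n) (A : falgType k) (actA : E -> A -> A) : Prop :=
  is_modAlg (modAlg_of actA) /\ exists (u : A) (z : 'I_n -> A),
  [/\ presented (@C_rels k n 1 L) (oapp z u),
      actA c u = - u, forall i, actA c (z i) = - z i,
      forall j, actA (x j) u = 0
    & forall i j, actA (x j) (z i) = 0].

Definition is_Ct (t : k) (A : falgType k) (actA : E -> A -> A) : Prop :=
  is_modAlg (modAlg_of actA) /\ exists y : A,
  [/\ presented (fun (B : algType k) (b : unit -> B) => b tt ^+ 2 = t%:A)
        (fun=> y),
      actA c y = - y & forall j, actA (x j) y = 0].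

(* The special 2-cocycle attached to the symmetric matrix M; mind the sign of *)
(* the last condition.                                                        *)
Definition is_special_cocycle (M : 'M[k]_n) (w : 'Hom(tens E E, k^o)) : Prop :=
  [/\ is_cocycle w, is_lazy w, w (c ⊗ c) = 1,
      forall i, w (c ⊗ x i) = 0 /\ w (x i ⊗ c) = 0
    & forall i j, w (x i ⊗ x j) = - M i j].

End Models.

(* Main.v *)
From HB Require Import structures.
Require Import Defs.
From mathcomp Require Import all_boot all_algebra all_field.
From mathcomp Require Import boolp ring.
From mathcomp Require classical_sets.
Set Implicit Arguments.
Unset Strict Implicit.
Unset Printing Implicit Defensive.
Import GRing.Theory.
Local Open Scope ring_scope.

(** The action of c is an involution, so that, 2 being invertible, it grades
    every module algebra by Z/2. On homogeneous elements R0 is the sign of the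
    super flip (R0_homog). Hence A # B is the graded tensor product and the
    opposite of A is its super opposite.

    In all the algebras at hand the x_i act by inner skew derivations: there are
    odd elements y_i with x_i.a = y_i (c.a) - a y_i (inner_by). A module algebra
    of this kind is therefore a superalgebra together with the family y, and the
    families of two factors add up in a smash product (smash_inner_by).
    - For C(alpha, L) one has y = -(1/2) L^-1 z (C_inner_by).
    - For C(-1), C(alpha) and A(1, L) one has y = 0.
    - For A^omega = End(E), let U and X_i be the left multiplications by c and
      x_i in the twisted algebra. Then c acts as conjugation by U, and
      y_i = X_i U (A_omega_inner). The prescribed values of omega, with
      M = (4L)^-1, give y_i y_j + y_j y_i = 2 M_ij (clif_yyD). Equivalently, the
      elements Z = -2 L y satisfy the relations of the generators z of
      C(alpha, L), and y = -(1/2) L^-1 Z (A_omega_zz, A_omega_z_inv).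
    So y is the same expression in z for C(alpha, L) and in Z for A^omega.

    Put X = C(-1) # C(alpha) # A(1, L) # A^omega. As a superalgebra X is
    C(alpha, L) # End(E + E), where c acts on the module E + E by (U, -U) and
    each x_i by 0. The generator of C(alpha) and the z_i of A(1, L) go to u and
    the z_i of C(alpha, L). The generator of C(-1) and the element u of A(1, L) go
    to odd anticommuting 2 x 2 matrices of square -1 and 1 that supercommute with
    the diagonal copies of End(E). An operator f of A^omega goes to its diagonal
    copy. This map carries Z to 1 # (Z, Z), whereas the x_i act on the target
    through z # 1. But z # 1 and 1 # (Z, Z) are supercommuting families with the
    same Clifford relations, and a rotation by a quarter turn in the plane that
    they span moves the one to the other. This rotation is the conjugation by an
    even unit (quarter_turn), and composing with it gives an isomorphism of module
    algebras (X_isog_Y). Since X is also isomorphic to X # End(k), the classes of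
    C(alpha, L) and X agree.

    The Azumaya property and the injectivity of maps out of X have one source.
    Call A super full if left multiplications and signed right multiplications
    generate End(A). Super full algebras are Azumaya (superfull_azumaya) and have
    no proper super ideals (superfull_inj). The class is closed under smash
    products (smash_superfull). It contains End(V) (End_superfull) and the
    Clifford algebras of nondegenerate forms (clifford_superfull). For the latter
    the algebra is the Fock space of a representation of the canonical
    anticommutation relations. *)

(** * Bilinear maps and sums over tensors *)

Section Tensors.
Variable k : fieldType.
Implicit Types U V W : vectType k.

Definition lin_of U V (f : U -> V) (lf : linear f) : {linear U -> V} :=
  HB.pack f (GRing.isLinear.Build k U V *:%R f lf).

Lemma linfun_lin U V (f : U -> V) (lf : linear f) v : linfun f v = f v.
Proof. exact: (lfunE (lin_of lf) v). Qed.

Section Bilinear.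
Variables (U V W : vectType k) (F : U -> V -> W) (Fb : is_bilinear F).

Lemma bilinDl u u' v : F (u + u') v = F u v + F u' v.
Proof. exact: (linearD (lin_of (Fb.2 v))). Qed.
Lemma bilinDr u v v' : F u (v + v') = F u v + F u v'.
Proof. exact: (linearD (lin_of (Fb.1 u))). Qed.
Lemma bilinZl a u v : F (a *: u) v = a *: F u v.
Proof. exact: (linearZ_LR (lin_of (Fb.2 v))). Qed.
Lemma bilinZr a u v : F u (a *: v) = a *: F u v.
Proof. exact: (linearZ_LR (lin_of (Fb.1 u))). Qed.
Lemma bilin_suml I r (P : pred I) (u : I -> U) v :
  F (\sum_(i <- r | P i) u i) v = \sum_(i <- r | P i) F (u i) v.
Proof. exact: (linear_sum (lin_of (Fb.2 v))). Qed.
Lemma bilin_sumr I r (P : pred I) u (v : I -> V) :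
  F u (\sum_(i <- r | P i) v i) = \sum_(i <- r | P i) F u (v i).
Proof. exact: (linear_sum (lin_of (Fb.1 u))). Qed.
Lemma bilinBl u u' v : F (u - u') v = F u v - F u' v.
Proof. exact: (linearB (lin_of (Fb.2 v))). Qed.
Lemma bilinBr u v v' : F u (v - v') = F u v - F u v'.
Proof. exact: (linearB (lin_of (Fb.1 u))). Qed.
Lemma bilin0l v : F 0 v = 0.
Proof. exact: (linear0 (lin_of (Fb.2 v))). Qed.
Lemma bilin0r u : F u 0 = 0.
Proof. exact: (linear0 (lin_of (Fb.1 u))). Qed.
Lemma bilinNl u v : F (- u) v = - F u v.
Proof. exact: (linearN (lin_of (Fb.2 v))). Qed.
End Bilinear.

Lemma tpure_bilin U V : is_bilinear (@tpure k U V).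
Proof.
by split=> [u a v w|v a u w]; apply/matrixP=> i j;
   rewrite !mxE linearP /= ?mulrDr ?mulrDl mulrA // mulrCA mulrA.
Qed.

Section Tsum.
Variables (U V : vectType k).
Implicit Types (t s : tens U V).

Lemma eq_tsum W (F G : U -> V -> W) t :
  (forall a b, F a b = G a b) -> tsum F t = tsum G t.
Proof.
by move=> FG; apply: eq_bigr => i _; apply: eq_bigr => j _; rewrite FG.
Qed.

Lemma tsum_linear W (F : U -> V -> W) : linear (tsum F).
Proof.
move=> a s t; rewrite /tsum scaler_sumr -big_split; apply: eq_bigr => i _ /=.
rewrite scaler_sumr -big_split; apply: eq_bigr => j _ /=.
by rewrite !mxE scalerDl scalerA.
Qed.

Lemma tsum_pure W (F : U -> V -> W) u v : is_bilinear F ->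
  tsum F (u ⊗ v) = F u v.
Proof.
move=> Fb; rewrite [in RHS](coord_vbasis (memvf u)) (bilin_suml Fb).
rewrite [in RHS](coord_vbasis (memvf v)).
apply: eq_bigr => i _; rewrite (bilin_sumr Fb); apply: eq_bigr => j _.
by rewrite mxE (bilinZl Fb) (bilinZr Fb) scalerA.
Qed.

Lemma linear_tsum W W' (f : W -> W') (F : U -> V -> W) t : linear f ->
  f (tsum F t) = tsum (fun a b => f (F a b)) t.
Proof.
move=> lf; rewrite -[f]/(lin_of lf : W -> W') /tsum linear_sum.
apply: eq_bigr => i _.
by rewrite linear_sum; apply: eq_bigr => j _; rewrite linearZ.
Qed.

Lemma tsumD W (F G : U -> V -> W) t :
  tsum (fun a b => F a b + G a b) t = tsum F t + tsum G t.
Proof.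
rewrite -big_split; apply: eq_bigr => i _; rewrite -big_split.
by apply: eq_bigr => j _; rewrite scalerDr.
Qed.

Lemma tsumZ W (F : U -> V -> W) a t :
  tsum (fun a' b => a *: F a' b) t = a *: tsum F t.
Proof.
rewrite (linear_tsum _ _ (f := *:%R a)) // => b u v.
by rewrite scalerDr !scalerA mulrC.
Qed.

Lemma tens_basis t :
  t = \sum_i \sum_j t i j *: ((vbasis {:U})`_i ⊗ (vbasis {:V})`_j).
Proof.
apply/matrixP=> a b; rewrite summxE (bigD1 a) //= summxE (bigD1 b) //= !mxE.
rewrite !coord_free ?(basis_free (vbasisP _)) // !eqxx !mulr1.
rewrite !big1 ?addr0 // => [i|j] neq; last first.
  by rewrite !mxE !coord_free ?(basis_free (vbasisP _)) // (negPf neq) !mulr0.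
rewrite summxE big1 // => j _.
by rewrite !mxE !coord_free ?(basis_free (vbasisP _)) // (negPf neq) mul0r mulr0.
Qed.

Lemma tens_ind (P : tens U V -> Prop) : P 0 ->
  (forall a s t, P s -> P t -> P (a *: s + t)) ->
  (forall u v, P (u ⊗ v)) -> forall t, P t.
Proof.
move=> P0 Plin Pp t; have PD u v : P u -> P v -> P (u + v).
  by move=> Pu Pv; rewrite -[u]scale1r; apply: Plin.
rewrite [t]tens_basis; elim/big_ind: _ => // i _; elim/big_ind: _ => // j _.
by rewrite -[X in P X]addr0; apply: Plin.
Qed.

Lemma tens_linear_eq W (f g : tens U V -> W) : linear f -> linear g ->
  (forall u v, f (u ⊗ v) = g (u ⊗ v)) -> f =1 g.
Proof.
move=> lf lg fg; apply: tens_ind => //.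
  exact: etrans (linear0 (lin_of lf)) (esym (linear0 (lin_of lg))).
by move=> a s t es et; rewrite lf lg es et.
Qed.

Lemma tsum_exchange (U' V' W : vectType k) (F : U -> V -> U' -> V' -> W) t
    (s : tens U' V') :
  tsum (fun a b => tsum (fun c d => F a b c d) s) t =
  tsum (fun c d => tsum (fun a b => F a b c d) t) s.
Proof.
transitivity (\sum_i \sum_j \sum_a \sum_b
    (t i j * s a b) *: F (vbasis {:U})`_i (vbasis {:V})`_j
                         (vbasis {:U'})`_a (vbasis {:V'})`_b).
  apply: eq_bigr => i _; apply: eq_bigr => j _; rewrite scaler_sumr.
  apply: eq_bigr => a _; rewrite scaler_sumr.
  by apply: eq_bigr => b _; rewrite scalerA.
under eq_bigr => i _ do rewrite exchange_big /=.
rewrite exchange_big /=; apply: eq_bigr => a _.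
under eq_bigr => i _ do rewrite exchange_big /=.
rewrite exchange_big /=; apply: eq_bigr => b _.
rewrite scaler_sumr; apply: eq_bigr => i _; rewrite scaler_sumr.
by apply: eq_bigr => j _; rewrite scalerA mulrC.
Qed.

End Tsum.

Lemma tsum_tsum U V (U' V' W : vectType k) (F : U' -> V' -> W) (G : U -> V -> tens U' V')
    (t : tens U V) :
  tsum F (tsum G t) = tsum (fun a b => tsum F (G a b)) t.
Proof. exact: (linear_tsum G t (tsum_linear F)). Qed.

End Tensors.

(** * Sums over iterated coproducts *)

Section Coalgebra.
Variables (k : fieldType) (H : hopfAlg k).

(** Coassociativity for an arbitrary, not necessarily trilinear, F: both sides
    evaluate F only at basis vectors, where F agrees with its multilinear
    extension. *)
Lemma comulA_tsum (W : vectType k) (F : H -> H -> H -> W) h :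
  \tsum_(a, b <- comul H h) \tsum_(a1, a2 <- comul H a) F a1 a2 b
  = \tsum_(a, b <- comul H h) \tsum_(b1, b2 <- comul H b) F a b1 b2.
Proof.
pose e := vbasis {:H}.
(* the trilinear map with the values of F on basis vectors *)
pose F' a b c := \sum_i \sum_j \sum_l
  (coord e i a * coord e j b * coord e l c) *: F e`_i e`_j e`_l.
have F'e (i j l : 'I_(\dim {:H})) : F' e`_i e`_j e`_l = F e`_i e`_j e`_l.
  have fe : free e by exact: basis_free (vbasisP _).
  rewrite /F' (bigD1 i) //= (bigD1 j) //= (bigD1 l) //= !coord_free // !eqxx.
  rewrite !mulr1 scale1r !big1 ?addr0 // => m ml.
  - rewrite big1 // => p _; rewrite big1 // => q _.
    by rewrite coord_free // eq_sym (negPf ml) !mul0r scale0r.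
  - rewrite big1 // => p _.
    by rewrite [X in _ * X * _]coord_free // eq_sym (negPf ml) mulr0 mul0r scale0r.
  - by rewrite [X in _ * X]coord_free // eq_sym (negPf ml) mulr0 scale0r.
have [lin1 lin2 lin3] : [/\ forall b c, linear (F' ^~ b ^~ c),
    forall a c, linear (F' a ^~ c) & forall a b, linear (F' a b)].
  split=> [b c|a c|a b] x u v; rewrite /F' scaler_sumr -big_split; apply: eq_bigr => i _ /=;
    rewrite scaler_sumr -big_split; apply: eq_bigr => j _ /=;
    rewrite scaler_sumr -big_split; apply: eq_bigr => l _ /=;
    by rewrite linearP /= ?mulrDr ?mulrDl ?mulrDl scalerDl scalerA; congr (_ *: _ + _); ring.
have bil a : is_bilinear (F' a) by [].
pose Phi := tsum (fun a (s : tens H H) => tsum (F' a) s).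
have bPhi : is_bilinear (fun a (s : tens H H) => tsum (F' a) s).
  split=> [a|s]; first exact: tsum_linear.
  move=> x u v; rewrite -tsumZ -tsumD; apply: eq_tsum => b c.
  by rewrite lin1.
have lPhi : linear Phi by exact: tsum_linear.
have /(congr1 Phi) := @comulA k H h.
rewrite !(linear_tsum _ _ lPhi).
under eq_tsum => a b do rewrite (linear_tsum _ _ lPhi).
under [in RHS]eq_tsum => a b do rewrite (linear_tsum _ _ lPhi).
under eq_tsum => a b do under eq_tsum => a1 a2 do
  rewrite /Phi (tsum_pure _ _ bPhi) (tsum_pure _ _ (bil _)).
under [in RHS]eq_tsum => a b do under eq_tsum => a1 a2 do
  rewrite /Phi (tsum_pure _ _ bPhi) (tsum_pure _ _ (bil _)).
rewrite /tsum => E.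
transitivity (\sum_i \sum_j comul H h i j *: \sum_i0 \sum_j0
      (comul H e`_i) i0 j0 *: F' e`_i0 e`_j0 e`_j).
  by do 2![apply: eq_bigr => ? _]; congr (_ *: _); do 2![apply: eq_bigr => ? _]; rewrite F'e.
rewrite E.
by do 2![apply: eq_bigr => ? _]; congr (_ *: _); do 2![apply: eq_bigr => ? _]; rewrite F'e.
Qed.

Lemma counitl_tsum (W : vectType k) (F : H -> W) h : linear F ->
  \tsum_(a, b <- comul H h) (counit H a : k) *: F b = F h.
Proof.
move=> lF; rewrite -[in RHS](counitl h) (linear_tsum _ _ lF).
by apply: eq_tsum => a b; rewrite -[F]/(lin_of lF : H -> W) linearZ.
Qed.

Lemma counitr_tsum (W : vectType k) (F : H -> W) h : linear F ->
  \tsum_(a, b <- comul H h) (counit H b : k) *: F a = F h.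
Proof.
move=> lF; rewrite -[in RHS](counitr h) (linear_tsum _ _ lF).
by apply: eq_tsum => a b; rewrite -[F]/(lin_of lF : H -> W) linearZ.
Qed.

Lemma comulM_tsum (W : vectType k) (F : H -> H -> W) g h : is_bilinear F ->
  tsum F (comul H (g * h)) = \tsum_(g1, g2 <- comul H g)
    \tsum_(h1, h2 <- comul H h) F (g1 * h1) (g2 * h2).
Proof.
move=> bF; rewrite comulM tsum_tsum; apply: eq_tsum => a b.
by rewrite tsum_tsum; apply: eq_tsum => a' b'; rewrite tsum_pure.
Qed.

Lemma antipodel_tsum (W : vectType k) (F : H -> W) h : linear F ->
  \tsum_(a, b <- comul H h) F (antipode H a * b) = (counit H h : k) *: F 1.
Proof.
move=> lF; transitivity (F ((counit H h : k) *: 1)).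
  by rewrite -antipodel (linear_tsum _ _ lF).
exact: (linearZ_LR (lin_of lF)).
Qed.

Lemma antipoder_tsum (W : vectType k) (F : H -> W) h : linear F ->
  \tsum_(a, b <- comul H h) F (a * antipode H b) = (counit H h : k) *: F 1.
Proof.
move=> lF; transitivity (F ((counit H h : k) *: 1)).
  by rewrite -antipoder (linear_tsum _ _ lF).
exact: (linearZ_LR (lin_of lF)).
Qed.

End Coalgebra.

(** * Algebras, subspaces and generators *)

Section AlgType.
Variables (k : fieldType) (A : algData k) (hA : is_alg A).

(** A type of its own, to carry the ring structure of the given product. *)
Definition alg_type of is_alg A : Type := A.
Local Notation B := (alg_type hA).

HB.instance Definition _ := Vector.copy B A.

Let mul : B -> B -> B := @alg_mul k A.
Let mulDl : left_distributive mul +%R.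
Proof. by move=> a b c; exact: bilinDl (is_alg_bilin hA) _ _ _. Qed.
Let mulDr : right_distributive mul +%R.
Proof. by move=> a b c; exact: bilinDr (is_alg_bilin hA) _ _ _. Qed.
HB.instance Definition _ := GRing.Zmodule_isNzRing.Build B
  (is_algA hA) (is_alg1l hA) (is_alg1r hA) mulDl mulDr (is_alg_neq0 hA).

Let scAl a (u v : B) : a *: (u * v) = (a *: u) * v.
Proof. by symmetry; exact: bilinZl (is_alg_bilin hA) _ _ _. Qed.
HB.instance Definition _ := GRing.Lmodule_isLalgebra.Build k B scAl.
Let scAr a (u v : B) : a *: (u * v) = u * (a *: v).
Proof. by symmetry; exact: bilinZr (is_alg_bilin hA) _ _ _. Qed.
HB.instance Definition _ := GRing.Lalgebra_isAlgebra.Build k B scAr.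
HB.instance Definition _ := Algebra_isFalgebra.Build k B.

Definition falg_of : falgType k := B.
End AlgType.

Lemma algData_falg (k : fieldType) (A : algData k) : is_alg A ->
  exists B : falgType k, A = @AlgData k B 1 *%R.
Proof.
move=> hA; exists (falg_of hA); case: A hA => V one mul hA.
by case: V one mul hA => V [].
Qed.

Lemma modAlg_falg (k : fieldType) (H : hopfAlg k) (A : modAlg H) :
  is_alg A -> exists (B : falgType k) (actB : H -> B -> B), A = modAlg_of actB.
Proof.
case: A => A aA /= /algData_falg[B eA]; subst A.
by exists B, aA.
Qed.

Section SubspacesAndGeneration.
Variable k : fieldType.

(** The dimensions of the subspaces contained in P are bounded, and one of
    maximal dimension must be all of P. *)
Lemma vspace_of_pred (V : vectType k) (P : V -> Prop) : P 0 ->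
  (forall a u v, P u -> P v -> P (a *: u + v)) ->
  exists K : {vspace V}, forall v, v \in K <-> P v.
Proof.
move=> P0 Plin.
pose Q m := `[< exists K : {vspace V}, (forall v, v \in K -> P v) /\ \dim K = m >].
have exQ : exists m, Q m.
  exists 0%N; apply/asboolP; exists 0%VS; rewrite dimv0; split=> // v.
  by rewrite memv0 => /eqP->.
have leQ m : Q m -> (m <= \dim {:V})%N.
  by case/asboolP=> K [_ <-]; rewrite dimvS ?subvf.
case: (ex_maxnP exQ leQ) => m /asboolP[K [KP dK]] maxm.
exists K => v; split=> [|Pv]; first exact: KP.
apply/contraT=> vK; suff: Q (\dim (<[v]> + K)%VS).
  move/maxm; rewrite -dK leqNgt => /negP[].
  rewrite ltn_neqAle dimvS ?addvSr // andbT; apply: contra vK => /eqP e.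
  have /eqP-> : K == (<[v]> + K)%VS by rewrite eqEdim addvSr e /=.
  by rewrite (subvP (addvSl _ _)) ?memv_line.
apply/asboolP; exists (<[v]> + K)%VS; split=> // w /memv_addP[u /vlineP[a ->]].
by case=> u' /KP Pu' ->; exact: Plin.
Qed.

(** A spanning property by left-normed words, in the form of an induction
    principle. *)
Definition generates (I : Type) (A : falgType k) (g : I -> A) :=
  forall P : A -> Prop, P 1 -> (forall a u v, P u -> P v -> P (a *: u + v)) ->
    (forall i u, P u -> P (g i * u)) -> forall u, P u.

(** Uniqueness in the universal property: the subalgebra spanned by the words
    in the generators is a retract of the whole algebra over the generators. *)
Lemma presented_generates (I : Type)
    (rels : forall B : algType k, (I -> B) -> Prop) (A : falgType k) (g : I -> A) :
  (forall (B : algType k) (j : {lrmorphism B -> A}) (gB : I -> B),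
     injective j -> (forall i, j (gB i) = g i) -> rels A g -> rels B gB) ->
  presented rels g -> generates g.
Proof.
move=> relS [rg univ] P P1 Plin Pg u.
have PD u1 u2 : P u1 -> P u2 -> P (u1 + u2).
  by move=> Pu Pv; rewrite -[u1]scale1r; apply: Plin.
have P0 : P 0 by rewrite -[0](addNr 1) -scaleN1r; apply: Plin.
have [K KP] := vspace_of_pred P0 Plin.
(* A subalgebra rather than the span K of P is needed to apply the universal
   property: take the elements whose left multiplication preserves K. *)
pose stab (v : A) : Prop := forall w, w \in K -> v * w \in K.
have stab0 : stab 0 by move=> w _; rewrite mul0r mem0v.
have stabL a v w : stab v -> stab w -> stab (a *: v + w).
  move=> sv sw z Kz; rewrite mulrDl -scalerAl.
  by apply: rpredD; [apply: rpredZ; apply: sv | apply: sw].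
have [S SP] := vspace_of_pred stab0 stabL.
have S1 : 1 \in S by apply/SP=> w; rewrite mul1r.
have algS : is_aspace S.
  rewrite /is_aspace has_algid1 //=.
  by apply/prodvP=> v w /SP sv /SP sw; apply/SP=> z Kz; rewrite -mulrA; apply/sv/sw.
pose SA : {aspace A} := ASpace algS.
have gS i : g i \in SA by apply/SP=> w /KP Pw; apply/KP; apply: Pg.
pose g' i : subvs_of SA := Subvs (gS i).
have v1 : vsval (1 : subvs_of SA) = 1 by apply/eqP; rewrite algid_eq1.
have mj : monoid_morphism (vsval : subvs_of SA -> A) by [].
pose j : {lrmorphism subvs_of SA -> A} := HB.pack (vsval : subvs_of SA -> A)
  (GRing.isLinear.Build k (subvs_of SA) A *:%R _ (@vsval_is_linear _ _ SA))
  (GRing.isMonoidMorphism.Build (subvs_of SA) A _ mj).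
have [f [fg _]] := univ _ g' (relS _ j g' (@subvs_inj _ _ _) (fun=> erefl) rg).
have [f0 [_ uniq]] := univ A g rg.
pose h : {lrmorphism A -> A} := (j \o f : {lrmorphism A -> A}).
have hid : h =1 idfun.
  move=> v; rewrite (uniq h) => [|i]; last by rewrite /= fg.
  by rewrite -(uniq idfun).
suff: u \in SA by move/SP/(_ 1); rewrite mulr1 !KP; apply.
by rewrite -[u]/(idfun u) -hid /=; exact: subvsP.
Qed.

End SubspacesAndGeneration.

Section Generation.
Variable k : fieldType.

Lemma E_generates n (E : hopfAlg k) (c : E) (x : 'I_n -> E) :
  is_En c x -> generates (oapp x c).
Proof.
case=> pres _ _ _ _ _ _; apply: presented_generates pres.
move=> B j g jI jg [/= cc cx xx x2]; have /= jc := jg None.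
have jx i : j (g (Some i)) = x i by exact: (jg (Some i)).
split=> [|i|i l|i]; apply: jI => /=.
- by rewrite rmorphXn rmorph1 /= jc cc.
- by rewrite rmorphD !rmorphM /= jc jx cx rmorph0.
- by rewrite rmorphD !rmorphM /= !jx xx rmorph0.
- by rewrite rmorphXn /= jx x2 rmorph0.
Qed.

Lemma C_generates n alpha (L : 'M[k]_n) (A : falgType k) (g : option 'I_n -> A) :
  presented (@C_rels k n alpha L) g -> generates g.
Proof.
apply: presented_generates => B j gB jI jg [/= uu uz zz z2].
split=> [|i|i l|i]; apply: jI => /=; rewrite ?rmorph_alg.
- by rewrite rmorphXn /= jg uu.
- by rewrite rmorphD !rmorphM /= !jg uz rmorph0.
- by rewrite rmorphD !rmorphM /= !jg zz.
- by rewrite rmorphXn /= jg z2.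
Qed.

Lemma Ct_generates t (A : falgType k) (y : A) :
  presented (fun (B : algType k) (b : unit -> B) => b tt ^+ 2 = t%:A)
        (fun=> y) -> generates (fun _ : unit => y).
Proof.
apply: presented_generates => B j gB jI jg y2.
by apply: jI; rewrite rmorphXn rmorph_alg /= jg.
Qed.
End Generation.

(** * Module algebras over E(n) *)

Section BilinearTools.
Variable k : fieldType.

Lemma linear_comp (U V W : vectType k) (f : V -> W) (g : U -> V) :
  linear f -> linear g -> linear (fun u => f (g u)).
Proof. by move=> lf lg a u v; rewrite lg lf. Qed.

Lemma bilin_comp (U V U' V' W : vectType k) (F : U' -> V' -> W) (f : U -> U')
    (g : V -> V') :
  is_bilinear F -> linear f -> linear g -> is_bilinear (fun u v => F (f u) (g v)).
Proof.
by move=> [Fl Fr] lf lg; split=> [u|v] a w z; rewrite ?lg ?lf ?Fl ?Fr.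
Qed.

Lemma tsum_linear_r (U V W W' : vectType k) (G : U -> V -> W -> W') (s : tens U V) :
  (forall a b, linear (G a b)) -> linear (fun w => tsum (fun a b => G a b w) s).
Proof.
move=> lG r u v; rewrite -tsumZ -tsumD.
by apply: eq_tsum => a b; rewrite lG.
Qed.

Section TsumAdditive.
Variables (U V W : vectType k) (F : U -> V -> W).
Let L : {linear tens U V -> W} := lin_of (tsum_linear F).
Lemma tsum_addl s t : tsum F (s + t) = tsum F s + tsum F t.
Proof. exact: (linearD L). Qed.
Lemma tsum_subl s t : tsum F (s - t) = tsum F s - tsum F t.
Proof. exact: (linearB L). Qed.
Lemma tsum_scalel a s : tsum F (a *: s) = a *: tsum F s.
Proof. exact: (linearZ_LR L). Qed.
End TsumAdditive.

Lemma coord_neq0 (V : vectType k) (v : V) : v != 0 ->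
  exists i, coord (vbasis {:V}) i v != 0.
Proof.
move=> v0; apply/existsP; rewrite -negb_forall; apply: contra v0 => /forallP v0.
rewrite (coord_vbasis (memvf v)) big1 // => i _.
by rewrite (eqP (v0 i)) scale0r.
Qed.

Lemma tpure_neq0 (U V : vectType k) (u : U) (v : V) :
  u != 0 -> v != 0 -> u ⊗ v != 0.
Proof.
move=> /coord_neq0[i ui] /coord_neq0[j vj]; apply/eqP=> /matrixP/(_ i j); rewrite !mxE.
by apply/eqP; rewrite mulf_neq0.
Qed.

Lemma mul_bilin (A : falgType k) : is_bilinear (@GRing.mul A).
Proof.
by split=> [u|v] a w z; rewrite ?mulrDr ?mulrDl -?scalerAl -?scalerAr.
Qed.
End BilinearTools.

Section ModuleAlgebras.
Variables (k : fieldType) (n : nat) (E : hopfAlg k) (c : E) (x : 'I_n -> E).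
Hypothesis hk : 2%N \notin [pchar k].
Hypothesis hE : is_En c x.

Lemma two_neq0 : (2 : k) != 0.
Proof. by move: hk; rewrite inE /=. Qed.

Lemma E_cc : c * c = 1.
Proof. by case: (En_presented hE) => [[/= + _ _ _] _]; rewrite expr2. Qed.

Lemma E_cx i : c * x i = - (x i * c).
Proof. by case: (En_presented hE) => [[/= _ + _ _] _] => /(_ i)/eqP; rewrite addr_eq0 => /eqP. Qed.

Lemma tsum_comulc (W : vectType k) (F : E -> E -> W) :
  is_bilinear F -> tsum F (comul E c) = F c c.
Proof. by move=> bF; rewrite (En_comulc hE) tsum_pure. Qed.

Lemma tsum_comulx (W : vectType k) (F : E -> E -> W) i :
  is_bilinear F -> tsum F (comul E (x i)) = F 1 (x i) + F (x i) c.
Proof.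
by move=> bF; rewrite (En_comulx hE) tsum_addl !tsum_pure.
Qed.

Lemma tsum_R0 (W : vectType k) (F : E -> E -> W) : is_bilinear F ->
  tsum F (R0 c) = 2^-1 *: (F 1 1 + F 1 c + F c 1 - F c c).
Proof.
by move=> bF; rewrite /R0 tsum_scalel tsum_subl !tsum_addl !tsum_pure.
Qed.

(** Both sides of the module algebra axioms are multiplicative in h, by the
    multiplicativity of the coproduct, so that c and the x_i suffice. *)
Lemma is_modAlg_generators (A : modAlg E) : is_alg A -> is_bilinear (@act _ _ A) ->
  (forall a : A, act 1 a = a) ->
  (forall g h (a : A), act (g * h) a = act g (act h a)) ->
  act c (alg_one A) = alg_one A -> (forall i, act (x i) (alg_one A) = 0) ->
  (forall a b : A, act c (alg_mul a b) = alg_mul (act c a) (act c b)) ->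
  (forall i (a b : A), act (x i) (alg_mul a b)
    = alg_mul a (act (x i) b) + alg_mul (act (x i) a) (act c b)) ->
  is_modAlg A.
Proof.
move=> hA; have [B [aB eA]] := modAlg_falg hA; subst A => /= bil a1 aM c1 x1 cM xM.
have genE := E_generates hE.
split=> //= [h|h a b].
  move: h; apply: genE => [|r u v eu ev|i u eu].
  - by rewrite a1 counit1 scale1r.
  - by rewrite (bilinDl bil) (bilinZl bil) eu ev linearP scalerDl scalerA.
  - rewrite aM eu (bilinZr bil) counitM mulrC -scalerA; congr (_ *: _).
    by case: i => [i|] /=; rewrite ?x1 ?c1 ?(En_counitc hE) ?(En_counitx hE) ?scale0r ?scale1r.
have bF a' b' : is_bilinear (fun h1 h2 => aB h1 a' * aB h2 b').
  by apply: bilin_comp (mul_bilin B) _ _; exact: bil.2.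
move: h a b; apply: genE => [|r u v eu ev|i u eu] a b.
- by rewrite comul1 tsum_pure // !a1.
- by rewrite (bilinDl bil) (bilinZl bil) eu ev linearP tsum_linear.
- rewrite aM eu (linear_tsum _ _ (bil.1 _)) (comulM_tsum _ _ (bF a b)) tsum_exchange.
  apply: eq_tsum => u1 u2; under eq_tsum => g1 g2 do rewrite !aM.
  case: i => [i|] /=.
    by rewrite (tsum_comulx _ (bF _ _)) xM !a1.
  by rewrite (tsum_comulc (bF _ _)) cM.
Qed.

End ModuleAlgebras.

(** * The grading by parity and the super tensor product *)

Section Parity.
Variables (k : fieldType) (n : nat) (E : hopfAlg k) (c : E) (x : 'I_n -> E).
Hypothesis hk : 2%N \notin [pchar k].
Hypothesis hE : is_En c x.

Definition homog (A : modAlg E) (e : bool) (a : A) := act c a = (-1) ^+ e *: a.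

Lemma act_cc (A : modAlg E) (a : A) : is_modAlg A -> act c (act c a) = a.
Proof. by move=> hA; rewrite -(is_modAlg_actA hA) (E_cc hE) (is_modAlg_1act hA). Qed.

Lemma actDr (A : modAlg E) h (a b : A) : is_modAlg A ->
  act h (a + b) = act h a + act h b.
Proof. by move=> hA; rewrite (bilinDr (is_modAlg_bilin hA)). Qed.
Lemma actBr (A : modAlg E) h (a b : A) : is_modAlg A ->
  act h (a - b) = act h a - act h b.
Proof. by move=> hA; rewrite (bilinBr (is_modAlg_bilin hA)). Qed.
Lemma actZr (A : modAlg E) h r (a : A) : is_modAlg A ->
  act h (r *: a) = r *: act h a.
Proof. by move=> hA; rewrite (bilinZr (is_modAlg_bilin hA)). Qed.

Lemma homog_split (A : modAlg E) (a : A) : is_modAlg A ->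
  exists a0 a1 : A, [/\ homog false a0, homog true a1 & a = a0 + a1].
Proof.
move=> hA; exists (2^-1 *: (a + act c a)), (2^-1 *: (a - act c a)); split.
- by rewrite /homog actZr // actDr // act_cc // scale1r addrC.
- by rewrite /homog actZr // actBr // act_cc // expr1 scaleN1r -scalerN opprB.
- rewrite -scalerDr addrACA subrr addr0 -mulr2n -scaler_nat scalerA.
  by rewrite mulVf ?scale1r // two_neq0.
Qed.

Lemma homog_ind (A : modAlg E) (P : A -> Prop) : is_modAlg A ->
  (forall a b, P a -> P b -> P (a + b)) -> (forall e a, homog e a -> P a) ->
  forall a, P a.
Proof.
move=> hA PD Ph a; have [a0 [a1 [h0 h1 ->]]] := homog_split a hA.
by apply: PD; [exact: Ph h0 | exact: Ph h1].
Qed.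

Lemma tens_homog_ind (A B : modAlg E) (P : tens A B -> Prop) :
  is_modAlg A -> is_modAlg B ->
  (forall r s t, P s -> P t -> P (r *: s + t)) ->
  (forall e e' a b, homog e a -> homog e' b -> P (a ⊗ b)) -> forall t, P t.
Proof.
move=> hA hB Plin Ph; have PD s t : P s -> P t -> P (s + t).
  by move=> Ps Pt; rewrite -[s]scale1r; apply: Plin.
have Pp a b : P (a ⊗ b).
  elim/homog_ind: a => // [a a'|e a ha].
    by rewrite (bilinDl (tpure_bilin _ _)); exact: PD.
  elim/homog_ind: b => // [b b'|e' b hb]; last exact: Ph ha hb.
  by rewrite (bilinDr (tpure_bilin _ _)); exact: PD.
apply: tens_ind => //; have := Pp 0 0.
by rewrite (bilin0l (tpure_bilin _ _)).
Qed.

Lemma homog1 (A : modAlg E) : is_modAlg A -> homog false (alg_one A).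
Proof. by move=> hA; rewrite /homog (is_modAlg_act1 hA) (En_counitc hE). Qed.

Lemma act_cM (A : modAlg E) (a b : A) : is_modAlg A ->
  act c (alg_mul a b) = alg_mul (act c a) (act c b).
Proof.
move=> hA; rewrite (is_modAlg_actM hA) (tsum_comulc hE) //.
apply: bilin_comp (is_alg_bilin (is_modAlg_alg hA)) _ _;
  exact: (is_modAlg_bilin hA).2.
Qed.

Lemma act_xM (A : modAlg E) i (a b : A) : is_modAlg A ->
  act (x i) (alg_mul a b)
    = alg_mul a (act (x i) b) + alg_mul (act (x i) a) (act c b).
Proof.
move=> hA; rewrite (is_modAlg_actM hA) (tsum_comulx hE) ?(is_modAlg_1act hA) //.
apply: bilin_comp (is_alg_bilin (is_modAlg_alg hA)) _ _;
  exact: (is_modAlg_bilin hA).2.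
Qed.

Lemma homogM (A : modAlg E) e e' (a b : A) : is_modAlg A ->
  homog e a -> homog e' b -> homog (e (+) e') (alg_mul a b).
Proof.
move=> hA ha hb; have bil := is_alg_bilin (is_modAlg_alg hA).
by rewrite /homog act_cM // ha hb (bilinZl bil) (bilinZr bil) scalerA signr_addb.
Qed.

Lemma homog_x (A : modAlg E) i e (a : A) : is_modAlg A ->
  homog e a -> homog (~~ e) (act (x i) a).
Proof.
move=> hA ha; rewrite /homog -(is_modAlg_actA hA) (E_cx hE).
rewrite (bilinNl (is_modAlg_bilin hA)) (is_modAlg_actA hA) ha actZr //.
by rewrite -scaleNr -signrN.
Qed.

Lemma homog_c (A : modAlg E) e (a : A) : is_modAlg A ->
  homog e a -> homog e (act c a).
Proof. by move=> hA ha; rewrite /homog {1}ha actZr. Qed.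

(** The reason for which (E, R0)-module algebras are superalgebras: the four terms
    of R0 add up to the sign of the super flip. *)
Lemma R0_homog (A B : modAlg E) (W : vectType k) (G : B -> A -> W) e e' b a :
  is_modAlg A -> is_modAlg B -> is_bilinear G -> homog e b -> homog e' a ->
  \tsum_(r1, r2 <- R0 c) G (act r1 b) (act r2 a) = (-1) ^+ (e && e') *: G b a.
Proof.
move=> hA hB bG hb ha; rewrite tsum_R0; last first.
  by apply: bilin_comp bG _ _; [exact: (is_modAlg_bilin hB).2 | exact: (is_modAlg_bilin hA).2].
rewrite !(is_modAlg_1act hA) !(is_modAlg_1act hB) hb ha.
have h2 := two_neq0 hk; rewrite !(bilinZl bG) !(bilinZr bG) scalerA.
set g := G b a; set s := (-1) ^+ e; set s' := (-1) ^+ e'.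
transitivity (2^-1 *: ((1 + s' + s - s * s') *: g)).
  by rewrite scalerBl !scalerDl scale1r.
(* (1 + s' + s - s s') / 2 is -1 when both signs are -1, and 1 otherwise *)
rewrite scalerA; congr (_ *: _); apply: (mulfI h2); rewrite mulrA mulfV // mul1r.
rewrite /s /s'; case: e e' {hb ha s s'} => [] []; rewrite /=; ring.
Qed.

Section Smash.
Variables (A B : modAlg E) (hA : is_modAlg A) (hB : is_modAlg B).
Let R := R0 c.
Let bA := is_modAlg_bilin hA.
Let bB := is_modAlg_bilin hB.
Let mA := is_alg_bilin (is_modAlg_alg hA).
Let mB := is_alg_bilin (is_modAlg_alg hB).
Let AB := smash R A B.
Let tb := tpure_bilin A B.

Lemma smash_ind (P : AB -> Prop) :
  (forall r (s t : AB), P s -> P t -> P (r *: s + t)) ->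
  (forall e e' (a : A) (b : B), homog e a -> homog e' b -> P (a ⊗ b)) ->
  forall t : AB, P t.
Proof. exact: tens_homog_ind. Qed.

Lemma smash_mulE (s t : AB) : alg_mul s t =
  \tsum_(a, b <- s) \tsum_(a', b' <- t) \tsum_(r1, r2 <- R)
      (alg_mul a (act r2 a') ⊗ alg_mul (act r1 b) b').
Proof. by []. Qed.

Lemma smash_mul_inner (a : A) (b : B) : is_bilinear (fun (a' : A) (b' : B) =>
  \tsum_(r1, r2 <- R) (alg_mul a (act r2 a') ⊗ alg_mul (act r1 b) b')).
Proof.
split=> [a'|b']; apply: tsum_linear_r => r1 r2.
- exact: linear_comp (tb.1 _) (mB.1 _).
- exact: linear_comp (linear_comp (tb.2 _) (mA.1 a)) (bA.1 r2).
Qed.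

Lemma smash_mul_bilin : is_bilinear (@alg_mul _ AB).
Proof.
split=> [s|t]; last exact: tsum_linear.
by apply: tsum_linear_r => a b; exact: tsum_linear.
Qed.

Lemma smashM_R (a a' : A) (b b' : B) :
  @alg_mul _ AB (a ⊗ b) (a' ⊗ b') = \tsum_(r1, r2 <- R)
      (alg_mul a (act r2 a') ⊗ alg_mul (act r1 b) b').
Proof.
rewrite smash_mulE tsum_pure; first by rewrite (tsum_pure _ _ (smash_mul_inner a b)).
split=> [a1|b1]; apply: tsum_linear_r => a2 b2; apply: tsum_linear_r => r1 r2.
- exact: linear_comp (linear_comp (tb.1 _) (mB.2 _)) (bB.1 r1).
- exact: linear_comp (tb.2 _) (mA.2 _).
Qed.

Lemma smashM_homog e e' (a a' : A) (b b' : B) : homog e b -> homog e' a' ->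
  @alg_mul _ AB (a ⊗ b) (a' ⊗ b')
    = (-1) ^+ (e && e') *: (alg_mul a a' ⊗ alg_mul b b').
Proof.
move=> hb ha'; rewrite smashM_R.
apply: (R0_homog (G := fun b a' => alg_mul a a' ⊗ alg_mul b b')) hb ha' => //.
by split=> [b1|a1];
  [exact: linear_comp (tb.2 _) (mA.1 _) | exact: linear_comp (tb.1 _) (mB.2 _)].
Qed.

Lemma smash_act_inner (h : E) :
  is_bilinear (fun (a : A) (b : B) => \tsum_(h1, h2 <- comul E h)
      (act h1 a ⊗ act h2 b)).
Proof.
split=> [a|b]; apply: tsum_linear_r => h1 h2.
- exact: linear_comp (tb.1 _) (bB.1 _).
- exact: linear_comp (tb.2 _) (bA.1 _).
Qed.

Lemma smash_act_pure (h : E) (a : A) (b : B) :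
  @act _ _ AB h (a ⊗ b) = \tsum_(h1, h2 <- comul E h) (act h1 a ⊗ act h2 b).
Proof. exact: (tsum_pure a b (smash_act_inner h)). Qed.

Lemma smash_act_bilin : is_bilinear (@act _ _ AB).
Proof.
split=> [h|s]; first exact: tsum_linear.
by apply: tsum_linear_r => a b r u v; rewrite linearP tsum_linear.
Qed.

Let act2_bilin (a : A) (b : B) : is_bilinear (fun h1 h2 => act h1 a ⊗ act h2 b).
Proof. by apply: bilin_comp tb _ _; [exact: bA.2 | exact: bB.2]. Qed.

Lemma smash_c (a : A) (b : B) : @act _ _ AB c (a ⊗ b) = act c a ⊗ act c b.
Proof. by rewrite smash_act_pure (tsum_comulc hE). Qed.

Lemma smash_x i (a : A) (b : B) :
  @act _ _ AB (x i) (a ⊗ b) = a ⊗ act (x i) b + act (x i) a ⊗ act c b.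
Proof. by rewrite smash_act_pure (tsum_comulx hE) // (is_modAlg_1act hA). Qed.

Lemma homog_tpure e e' (a : A) (b : B) : homog e a -> homog e' b ->
  @homog AB (e (+) e') (a ⊗ b).
Proof.
move=> ha hb; rewrite /homog smash_c ha hb (bilinZl tb) (bilinZr tb).
by rewrite scalerA signr_addb.
Qed.

Lemma smash_is_alg : is_alg AB.
Proof.
have mAB := smash_mul_bilin.
have o1 := homog1 hA; have o1' := homog1 hB.
split; first exact: mAB.
- elim/smash_ind => [r s s' Ps Ps' t u|e1 e1' a a' ha ha'].
    by rewrite !(bilinDl mAB) !(bilinZl mAB) Ps Ps'.
  elim/smash_ind => [r s s' Ps Ps' u|e2 e2' b b' hb hb'].
    by rewrite !(bilinDl mAB, bilinDr mAB, bilinZl mAB, bilinZr mAB) Ps Ps'.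
  elim/smash_ind => [r s s' Ps Ps'|e3 e3' d d' hd hd'].
    by rewrite !(bilinDr mAB) !(bilinZr mAB) Ps Ps'.
  rewrite (smashM_homog _ _ hb' hd) (smashM_homog _ _ ha' hb).
  rewrite (bilinZr mAB) (bilinZl mAB).
  rewrite (smashM_homog _ _ ha' (homogM hA hb hd)).
  rewrite (smashM_homog _ _ (homogM hB ha' hb') hd) !scalerA -!signr_addb.
  rewrite !is_algA; try exact: is_modAlg_alg.
  by congr (_ *: _); congr (_ ^+ nat_of_bool _); clear; case: e1' e2 e2' e3 => [] [] [] [].
- elim/smash_ind => [r s s' Ps Ps'|e e' a b ha hb].
    by rewrite (bilinDr mAB) (bilinZr mAB) Ps Ps'.
  rewrite [alg_one _]/(alg_one A ⊗ alg_one B) (smashM_homog _ _ o1' ha) scale1r.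
  by rewrite !is_alg1l //; exact: is_modAlg_alg.
- elim/smash_ind => [r s s' Ps Ps'|e e' a b ha hb].
    by rewrite (bilinDl mAB) (bilinZl mAB) Ps Ps'.
  rewrite [alg_one _]/(alg_one A ⊗ alg_one B) (smashM_homog _ _ hb o1) andbF scale1r.
  by rewrite !is_alg1r //; exact: is_modAlg_alg.
- apply: tpure_neq0; exact: is_alg_neq0 (is_modAlg_alg _).
Qed.

Lemma smash_is_modAlg : is_modAlg AB.
Proof.
have mAB := smash_mul_bilin; have aAB := smash_act_bilin.
have act1 (a : AB) : act 1 a = a.
  elim/smash_ind: a => [r s s' Ps Ps'|e e' a b ha hb].
    by rewrite (bilinDr aAB) (bilinZr aAB) Ps Ps'.
  rewrite smash_act_pure comul1 tsum_pure //.
  by rewrite (is_modAlg_1act hA) (is_modAlg_1act hB).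
apply: (is_modAlg_generators hE smash_is_alg aAB act1).
- move=> g h; elim/smash_ind => [r s s' Ps Ps'|e e' a b ha hb].
    by rewrite !(bilinDr aAB) !(bilinZr aAB) Ps Ps'.
  rewrite !smash_act_pure (comulM_tsum _ _ (act2_bilin a b)).
  rewrite (linear_tsum _ _ (aAB.1 g)) tsum_exchange; apply: eq_tsum => h1 h2.
  rewrite smash_act_pure; apply: eq_tsum => g1 g2.
  by rewrite (is_modAlg_actA hA) (is_modAlg_actA hB).
- by rewrite [alg_one _]/(alg_one A ⊗ alg_one B) smash_c !homog1 // !scale1r.
- move=> i; rewrite [alg_one _]/(alg_one A ⊗ alg_one B) smash_x.
  rewrite (is_modAlg_act1 hA) (is_modAlg_act1 hB) (En_counitx hE) !scale0r.
  by rewrite (bilin0l tb) (bilin0r tb) addr0.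
- elim/smash_ind => [r s s' Ps Ps' t|e1 e1' a a' ha ha'].
    by rewrite !(bilinDr aAB, bilinDl mAB, bilinZr aAB, bilinZl mAB) Ps Ps'.
  elim/smash_ind => [r s s' Ps Ps'|e2 e2' b b' hb hb'].
    by rewrite !(bilinDr aAB, bilinDr mAB, bilinZr aAB, bilinZr mAB) Ps Ps'.
  rewrite (smashM_homog _ _ ha' hb) (bilinZr aAB) !smash_c !act_cM //.
  by rewrite (smashM_homog _ _ (homog_c hB ha') (homog_c hA hb)).
- move=> i; elim/smash_ind => [r s s' Ps Ps' t|e1 e1' a a' ha ha'].
    rewrite !(bilinDr aAB, bilinDl mAB, bilinZr aAB, bilinZl mAB) Ps Ps' scalerDr.
    by rewrite addrACA.
  elim/smash_ind => [r s s' Ps Ps'|e2 e2' b b' hb hb'].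
    rewrite !(bilinDr aAB, bilinDr mAB, bilinZr aAB, bilinZr mAB) Ps Ps' scalerDr.
    by rewrite addrACA.
  rewrite (smashM_homog _ _ ha' hb) (bilinZr aAB) !smash_x smash_c !act_xM //.
  rewrite act_cM // (bilinDr mAB) (bilinDl mAB) (smashM_homog _ _ ha' hb).
  rewrite (smashM_homog _ _ ha' (homog_x i hA hb)).
  rewrite (smashM_homog _ _ (homog_x i hB ha') (homog_c hA hb)).
  rewrite (smashM_homog _ _ (homog_c hB ha') (homog_c hA hb)).
  rewrite (bilinDr tb) (bilinDl tb) ha' hb.
  rewrite !(bilinZl tb, bilinZr tb, bilinZl mA, bilinZr mA, bilinZl mB, bilinZr mB).
  rewrite !scalerDr !scalerA -!addrA; congr (_ + _); rewrite addrCA.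
  by clear; case: e1' e2 => [] []; rewrite /= !(mulN1r, mulr1, mul1r, mulrN1, opprK).
Qed.
End Smash.
End Parity.

(** * The opposite algebra and the maps F' and G' *)

Section Azumaya.
Variables (k : fieldType) (n : nat) (E : hopfAlg k) (c : E) (x : 'I_n -> E).
Hypothesis hk : 2%N \notin [pchar k].
Hypothesis hE : is_En c x.
Variables (A : modAlg E) (hA : is_modAlg A).
Let R := R0 c.
Let bA := is_modAlg_bilin hA.
Let mA := is_alg_bilin (is_modAlg_alg hA).
Let Aop := modAlg_opp R A.
Implicit Types a b w : A.

Lemma opp_homog e e' a b : homog c e a -> homog c e' b ->
  @alg_mul _ Aop a b = (-1) ^+ (e && e') *: alg_mul b a.
Proof.
move=> ha hb.
have bG : is_bilinear (fun a b => alg_mul b a).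
  by split=> [a1|b1]; [exact: mA.2 | exact: mA.1].
exact: (R0_homog hk hA hA bG ha hb).
Qed.

Lemma opp_mul_bilin : is_bilinear (@alg_mul _ Aop).
Proof.
split=> [a|b]; apply: tsum_linear_r => r1 r2.
- exact: linear_comp (mA.2 _) (bA.1 _).
- exact: linear_comp (mA.1 _) (bA.1 _).
Qed.

Lemma opp_is_modAlg : is_modAlg Aop.
Proof.
have hind (P : A -> Prop) := @homog_ind _ _ _ _ _ hk hE A P hA.
have mO := opp_mul_bilin.
have isA := is_modAlg_alg hA.
have o1 := homog1 hE hA.
have isO : is_alg Aop.
  split=> //; last exact: is_alg_neq0 isA.
  - move=> a b d; elim/hind: a => [a a' ea ea'|e a ha].
      by rewrite !(bilinDl mO) ea ea'.
    elim/hind: b => [b b' eb eb'|e' b hb].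
      by rewrite !(bilinDr mO, bilinDl mO) eb eb'.
    elim/hind: d => [d d' ed ed'|e'' d hd]; first by rewrite !(bilinDr mO) ed ed'.
    rewrite (opp_homog hb hd) (opp_homog ha hb) (bilinZl mO) (bilinZr mO).
    rewrite (opp_homog ha (homogM hE hA hd hb)) (opp_homog (homogM hE hA hb ha) hd).
    rewrite !scalerA -!signr_addb is_algA //.
    by congr (_ *: _); congr (_ ^+ nat_of_bool _); clear; case: e e' e'' => [] [] [].
  - move=> a; elim/hind: a => [a a' ea ea'|e a ha].
      by rewrite (bilinDr mO) ea ea'.
    by rewrite (opp_homog o1 ha) scale1r is_alg1r.
  - move=> a; elim/hind: a => [a a' ea ea'|e a ha].
      by rewrite (bilinDl mO) ea ea'.
    by rewrite (opp_homog ha o1) andbF scale1r is_alg1l.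
apply: (is_modAlg_generators hE isO bA (is_modAlg_1act hA) (is_modAlg_actA hA)).
- by rewrite [act _ _]o1 scale1r.
- by move=> i; rewrite [LHS](is_modAlg_act1 hA) (En_counitx hE) scale0r.
- move=> a b; elim/hind: a => [a a' ea ea'|e a ha].
    by rewrite !(bilinDl mO, bilinDr bA) ea ea'.
  elim/hind: b => [b b' eb eb'|e' b hb].
    by rewrite !(bilinDr mO, bilinDr bA) eb eb'.
  rewrite (opp_homog ha hb) (opp_homog (homog_c hA ha) (homog_c hA hb)).
  by rewrite (bilinZr bA) (act_cM hE).
- move=> i a b; elim/hind: a => [a a' ea ea'|e a ha].
    by rewrite !(bilinDl mO, bilinDr bA) ea ea' addrACA.
  elim/hind: b => [b b' eb eb'|e' b hb].
    by rewrite !(bilinDr mO, bilinDr bA) eb eb' addrACA.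
  rewrite (opp_homog ha hb) (opp_homog ha (homog_x hE i hA hb)).
  rewrite (opp_homog (homog_x hE i hA ha) (homog_c hA hb)).
  rewrite (bilinZr bA) (act_xM hE) // ha hb.
  rewrite !(bilinZl mA, bilinZr mA) scalerDr !scalerA addrC.
  by clear; case: e e' => [] []; rewrite /= ?(mulN1r, mulr1, mul1r, mulrN1, opprK).
Qed.

Lemma azumayaF_E (s : smash R A Aop) w : azumayaF s w =
  \tsum_(a, b <- s) \tsum_(r1, r2 <- R)
    alg_mul (alg_mul a (act r2 w)) (act r1 b).
Proof.
apply: linfun_lin; apply: tsum_linear_r => a b; apply: tsum_linear_r => r1 r2.
exact: linear_comp (mA.2 _) (linear_comp (mA.1 _) (bA.1 _)).
Qed.

Lemma azumayaF_linear : linear (@azumayaF _ _ R A).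
Proof.
move=> r s t; apply/lfunP=> w; rewrite add_lfunE scale_lfunE !azumayaF_E.
exact: tsum_linear.
Qed.

Lemma azumayaFZ r (s : smash R A Aop) : azumayaF (r *: s) = r *: azumayaF s.
Proof. exact: (linearZ_LR (lin_of azumayaF_linear)). Qed.

Lemma azumayaF_homog e e' a b w : homog c e b -> homog c e' w ->
  azumayaF (a ⊗ b : smash R A Aop) w
    = (-1) ^+ (e && e') *: alg_mul (alg_mul a w) b.
Proof.
move=> hb hw; rewrite azumayaF_E tsum_pure; last first.
  split=> [a1|b1]; apply: tsum_linear_r => r1 r2.
  - exact: linear_comp (mA.1 _) (bA.1 _).
  - exact: linear_comp (mA.2 _) (mA.2 _).
have bG : is_bilinear (fun b w => alg_mul (alg_mul a w) b).
  split=> [b1|w1]; last exact: mA.1.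
  exact: linear_comp (mA.2 _) (mA.1 _).
exact: (R0_homog hk hA hA bG hb hw).
Qed.

Lemma azumayaG_E (s : smash R Aop A) w : azumayaG s w =
  \tsum_(a, b <- s) \tsum_(r1, r2 <- R)
    alg_mul (alg_mul (act r2 a) (act r1 w)) b.
Proof.
apply: linfun_lin; apply: tsum_linear_r => a b; apply: tsum_linear_r => r1 r2.
exact: linear_comp (mA.2 _) (linear_comp (mA.1 _) (bA.1 _)).
Qed.

Lemma azumayaG_linear : linear (@azumayaG _ _ R A).
Proof.
move=> r s t; apply/lfunP=> w; rewrite add_lfunE scale_lfunE !azumayaG_E.
exact: tsum_linear.
Qed.

Lemma azumayaGZ r (s : smash R Aop A) : azumayaG (r *: s) = r *: azumayaG s.
Proof. exact: (linearZ_LR (lin_of azumayaG_linear)). Qed.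

Lemma azumayaG_homog e e' a b w : homog c e a -> homog c e' w ->
  azumayaG (a ⊗ b : smash R Aop A) w
    = (-1) ^+ (e' && e) *: alg_mul (alg_mul a w) b.
Proof.
move=> ha hw; rewrite azumayaG_E tsum_pure; last first.
  split=> [a1|b1]; apply: tsum_linear_r => r1 r2.
  - exact: mA.1 _.
  - exact: linear_comp (mA.2 _) (linear_comp (mA.2 _) (bA.1 _)).
have bG : is_bilinear (fun w a => alg_mul (alg_mul a w) b).
  split=> [b1|w1]; first exact: linear_comp (mA.2 _) (mA.2 _).
  exact: linear_comp (mA.2 _) (mA.1 _).
exact: (R0_homog hk hA hA bG hw ha).
Qed.

Lemma lfun_homogP (f g : 'End(A)) :
  (forall e w, homog c e w -> f w = g w) -> f = g.
Proof.
move=> fg; apply/lfunP=> w.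
apply: (homog_ind hk hE hA (P := fun w => f w = g w)) w => [a b fa fb|e w hw].
  by rewrite !linearD /= fa fb.
exact: fg hw.
Qed.

Lemma azumayaF1 : azumayaF (alg_one (smash R A Aop)) = alg_one (End_alg A).
Proof.
have isA := is_modAlg_alg hA.
apply: lfun_homogP => e w hw; rewrite (azumayaF_homog _ (homog1 hE hA) hw).
by rewrite scale1r is_alg1l // is_alg1r // id_lfunE.
Qed.

Lemma azumayaG1 : azumayaG (alg_one (smash R Aop A)) = alg_one (op_alg (End_alg A)).
Proof.
have isA := is_modAlg_alg hA.
apply: lfun_homogP => e w hw; rewrite (azumayaG_homog _ (homog1 hE hA) hw).
by rewrite andbF scale1r is_alg1l // is_alg1r // id_lfunE.
Qed.

Lemma azumayaFM (s t : smash R A Aop) :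
  azumayaF (alg_mul s t) = (azumayaF s \o azumayaF t)%VF.
Proof.
have hO := opp_is_modAlg; have isA := is_modAlg_alg hA.
have mS := smash_mul_bilin c A Aop.
have lF := azumayaF_linear.
elim/(smash_ind hk hE hA hO): s => [r s s' Ps Ps'|e1 e1' a a' ha ha'].
  by rewrite (bilinDl mS) (bilinZl mS) !lF Ps Ps' comp_lfunDl comp_lfunZl.
elim/(smash_ind hk hE hA hO): t => [r s s' Ps Ps'|e2 e2' b b' hb hb'].
  by rewrite (bilinDr mS) (bilinZr mS) !lF Ps Ps' comp_lfunDr comp_lfunZr.
apply: lfun_homogP => e w hw.
rewrite (smashM_homog hk hA hO _ _ ha' hb) (opp_homog ha' hb').
rewrite (bilinZr (tpure_bilin _ _)) scalerA.
rewrite azumayaFZ scale_lfunE.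
rewrite comp_lfunE (azumayaF_homog _ hb' hw) linearZ_LR /=.
rewrite (azumayaF_homog _ ha' (homogM hE hA (homogM hE hA hb hw) hb')).
rewrite (azumayaF_homog _ (homogM hE hA hb' ha') hw) !scalerA -!signr_addb.
rewrite !is_algA //; congr (_ *: _); congr (_ ^+ nat_of_bool _); clear.
by case: e1' e2 e2' e => [] [] [] [].
Qed.

Lemma azumayaGM (s t : smash R Aop A) :
  azumayaG (alg_mul s t) = (azumayaG t \o azumayaG s)%VF.
Proof.
have hO := opp_is_modAlg; have isA := is_modAlg_alg hA.
have mS := smash_mul_bilin c Aop A.
have lF := azumayaG_linear.
elim/(smash_ind hk hE hO hA): s => [r s s' Ps Ps'|e1 e1' a a' ha ha'].
  by rewrite (bilinDl mS) (bilinZl mS) !lF Ps Ps' comp_lfunDr comp_lfunZr.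
elim/(smash_ind hk hE hO hA): t => [r s s' Ps Ps'|e2 e2' b b' hb hb'].
  by rewrite (bilinDr mS) (bilinZr mS) !lF Ps Ps' comp_lfunDl comp_lfunZl.
apply: lfun_homogP => e w hw.
rewrite (smashM_homog hk hO hA _ _ ha' hb) (opp_homog ha hb).
rewrite (bilinZl (tpure_bilin _ _)) scalerA.
rewrite azumayaGZ scale_lfunE.
rewrite comp_lfunE (azumayaG_homog _ ha hw) linearZ_LR /=.
rewrite (azumayaG_homog _ hb (homogM hE hA (homogM hE hA ha hw) ha')).
rewrite (azumayaG_homog _ (homogM hE hA hb ha) hw) !scalerA -!signr_addb.
rewrite !is_algA //; congr (_ *: _); congr (_ ^+ nat_of_bool _); clear.
by case: e1 e1' e2 e => [] [] [] [].
Qed.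
End Azumaya.

(** * Super full algebras *)

Lemma linear_surj_bij (k : fieldType) (U V : vectType k) (f : U -> V) :
  linear f -> \dim {:U} = \dim {:V} -> (forall v, exists u, f u = v) -> bijective f.
Proof.
move=> lf dUV sf; pose F : 'Hom(U, V) := linfun f.
have Ff u : F u = f u by exact: linfun_lin.
have imF : limg F = fullv.
  apply/eqP; rewrite eqEsubv subvf; apply/subvP=> v _; have [u <-] := sf v.
  by rewrite -Ff memv_img ?memvf.
have kF : lker F == 0%VS.
  rewrite -dimv_eq0 -(eqn_add2r (\dim {:V})) add0n -[in X in _ == X]dUV.
  by rewrite -[X in _ == X](limg_ker_dim F) imF capfv.
exists (F^-1)%VF => [u|v]; rewrite -Ff; first exact: lker0_lfunK.
by apply: limg_lfunVK; rewrite imF memvf.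
Qed.

Section SuperFull.
Variables (k : fieldType) (n : nat) (E : hopfAlg k) (c : E) (x : 'I_n -> E).
Hypothesis hk : 2%N \notin [pchar k].
Hypothesis hE : is_En c x.

Definition opL (A : modAlg E) (a : A) : 'End(A) := linfun (alg_mul a).
Definition opR (A : modAlg E) (a : A) : 'End(A) := linfun (fun w => alg_mul w a).
Definition opc (A : modAlg E) : 'End(A) := linfun (act c).

Definition op_closed (V : vectType k) (T : 'End(V) -> Prop) :=
  (forall r f g, T f -> T g -> T (r *: f + g)) /\
  (forall f g, T f -> T g -> T (f \o g)%VF).

(** The signed right multiplications w |-> (-1)^(|a||w|) w a are opR a for a even
    and opR a composed with the grading for a odd. Generation is expressed as an
    induction principle on operators. *)
Definition superfull (A : modAlg E) := forall T : 'End(A) -> Prop, op_closed T ->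
  (forall a, T (opL a)) -> (forall a, homog c false a -> T (opR a)) ->
  (forall a, homog c true a -> T (opR a \o opc A)%VF) -> forall f, T f.

Section Multiplications.
Variables (A : modAlg E) (hA : is_modAlg A).
Let R := R0 c.
Let bA := is_modAlg_bilin hA.
Let isA := is_modAlg_alg hA.
Let mA := is_alg_bilin isA.

Lemma opLE (a w : A) : opL a w = alg_mul a w.
Proof. exact: linfun_lin (mA.1 a) w. Qed.
Lemma opRE (a w : A) : opR a w = alg_mul w a.
Proof. exact: linfun_lin (mA.2 a) w. Qed.
Lemma opcE (w : A) : opc A w = act c w.
Proof. exact: linfun_lin (bA.1 c) w. Qed.

Lemma op_closedD (V : vectType k) (T : 'End(V) -> Prop) f g : op_closed T ->
  T f -> T g -> T (f + g).
Proof. by move=> cT Tf Tg; rewrite -[f]scale1r; apply: cT.1. Qed.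

Lemma op_closed0 (V : vectType k) (T : 'End(V) -> Prop) f : op_closed T ->
  T f -> T 0.
Proof. by move=> cT Tf; rewrite -[0](addNr f) -scaleN1r; apply: cT.1. Qed.

Lemma op_closedZ (V : vectType k) (T : 'End(V) -> Prop) r f : op_closed T ->
  T f -> T (r *: f).
Proof.
by move=> cT Tf; rewrite -[_ *: _]addr0; apply: cT.1 => //; apply: op_closed0 Tf.
Qed.

Lemma opL1 : opL (alg_one A) = \1%VF.
Proof. by apply/lfunP=> w; rewrite opLE is_alg1l // id_lfunE. Qed.

Lemma opRD (a b : A) : opR (a + b) = opR a + opR b.
Proof. by apply/lfunP=> w; rewrite add_lfunE !opRE (bilinDr mA). Qed.
Lemma opLD (a b : A) : opL (a + b) = opL a + opL b.
Proof. by apply/lfunP=> w; rewrite add_lfunE !opLE (bilinDl mA). Qed.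

Lemma dim_azumaya (B C : modAlg E) : (B : vectType k) = A -> (C : vectType k) = A ->
  \dim {:smash R B C} = \dim {:End_alg A}.
Proof. by move=> /= -> ->; rewrite !dimvf /dim /= -!dimvf. Qed.

(** F'(a # 1) and F'(1 # b) are the left and the signed right multiplications. *)
Lemma superfull_F_surj : superfull A -> forall f, exists s, @azumayaF _ _ R A s = f.
Proof.
move=> fullA; have lF := azumayaF_linear hA (c := c).
apply: fullA => [|a|b hb|b hb].
- split=> [r _ _ [s <-] [t <-]|_ _ [s <-] [t <-]].
    by exists (r *: s + t); rewrite lF.
  by exists (alg_mul s t); rewrite (azumayaFM hk hE hA).
- exists (a ⊗ alg_one A); apply: (lfun_homogP hk hE hA) => e w hw.
  rewrite (azumayaF_homog hk hA _ (homog1 hE hA) hw) scale1r opLE.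
  by rewrite is_alg1r.
- exists (alg_one A ⊗ b); apply: (lfun_homogP hk hE hA) => e w hw.
  by rewrite (azumayaF_homog hk hA _ hb hw) scale1r opRE is_alg1l.
- exists (alg_one A ⊗ b); apply: (lfun_homogP hk hE hA) => e w hw.
  rewrite (azumayaF_homog hk hA _ hb hw) comp_lfunE opRE opcE hw.
  by rewrite (bilinZl mA) is_alg1l.
Qed.

(** Here the signs sit on the left multiplications instead. An even operator and
    an odd operator composed with the grading lie in the image of G', and every
    operator is a sum f0 + f1 of an even and an odd one. Applied to the grading
    itself, which is even, this puts the grading in the image, and composing with
    it moves the signs to the other side. *)
Lemma superfull_G_surj : superfull A -> forall f, exists s, @azumayaG _ _ R A s = f.
Proof.
move=> fullA; have lG := azumayaG_linear hA (c := c).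
pose T f := exists s, @azumayaG _ _ R A s = f; rewrite -/(forall f, T f).
have cT : op_closed T.
  split=> [r _ _ [s <-] [t <-]|_ _ [s <-] [t <-]].
    by exists (r *: s + t); rewrite lG.
  by exists (alg_mul t s); rewrite (azumayaGM hk hE hA).
have h2 := two_neq0 hk.
have cc : (opc A \o opc A = \1)%VF.
  by apply/lfunP=> w; rewrite comp_lfunE !opcE (act_cc hE) // id_lfunE.
have TL e a : homog c e a -> T (if e then opL a \o opc A else opL a)%VF.
  move=> ha; exists (a ⊗ alg_one A); apply: (lfun_homogP hk hE hA) => e' w hw.
  rewrite (azumayaG_homog hk hA _ ha hw) is_alg1r //.
  case: e {ha}; rewrite ?comp_lfunE opLE ?opcE ?hw ?(bilinZr mA) ?andbT //.
  by rewrite andbF scale1r.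
have TR b : T (opR b).
  exists (alg_one A ⊗ b); apply: (lfun_homogP hk hE hA) => e w hw.
  by rewrite (azumayaG_homog hk hA _ (homog1 hE hA) hw) andbF scale1r opRE is_alg1l.
have T0 : T 0 by exact: op_closed0 cT (TR 0).
pose par (e : bool) f := (opc A \o f)%VF = (-1) ^+ e *: (f \o opc A)%VF.
have par0 e : par e 0 by rewrite /par comp_lfun0l comp_lfun0r scaler0.
have parL e a : homog c e a -> par e (opL a).
  move=> ha; apply/lfunP=> w; rewrite scale_lfunE !comp_lfunE !opcE !opLE.
  by rewrite (act_cM hE) // ha (bilinZl mA).
have parR e a : homog c e a -> par e (opR a).
  move=> ha; apply/lfunP=> w; rewrite scale_lfunE !comp_lfunE !opcE !opRE.
  by rewrite (act_cM hE) // ha (bilinZr mA).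
have parM e e' f g : par e f -> par e' g -> par (e (+) e') (f \o g)%VF.
  move=> pf pg; rewrite /par comp_lfunA pf -comp_lfunZl -[((f \o _) \o g)%VF]comp_lfunA pg.
  by rewrite -comp_lfunZr scalerA signr_addb comp_lfunA.
have parD e r f g : par e f -> par e g -> par e (r *: f + g).
  move=> pf pg; rewrite /par comp_lfunDr comp_lfunDl -comp_lfunZr -comp_lfunZl pf pg.
  by rewrite scalerDr !scalerA mulrC.
have parA e f g : par e f -> par e g -> par e (f + g).
  by move=> pf pg; rewrite -[f]scale1r; apply: parD.
pose T' f := exists f0 f1, [/\ par false f0, par true f1, T f0, T (f1 \o opc A)%VF
  & f = f0 + f1].
have Tc : T (opc A).
  have : T' (opc A).
    apply: fullA => [|a|b hb|b hb].
    - split=> [r _ _ [f0 [f1 [p0 p1 T0' T1 ->]]] [g0 [g1 [q0 q1 S0 S1 ->]]]|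
               _ _ [f0 [f1 [p0 p1 T0' T1 ->]]] [g0 [g1 [q0 q1 S0 S1 ->]]]].
        exists (r *: f0 + g0), (r *: f1 + g1); split; try exact: parD.
        + exact: cT.1.
        + by rewrite comp_lfunDl -comp_lfunZl; apply: cT.1.
        + by rewrite scalerDr addrACA.
      exists ((f0 \o g0) + (f1 \o g1))%VF, ((f0 \o g1) + (f1 \o g0))%VF; split.
      + by apply: parA; [exact: parM p0 q0 | exact: parM p1 q1].
      + by apply: parA; [exact: parM p0 q1 | exact: parM p1 q0].
      + apply: (op_closedD cT); first exact: cT.2.
        have -> : (f1 \o g1 = - 1 *: ((f1 \o opc A) \o (g1 \o opc A)))%VF.
          rewrite comp_lfunA -[((f1 \o _) \o g1)%VF]comp_lfunA q1 expr1.
          by rewrite -comp_lfunZr -!comp_lfunZl scalerA mulN1r opprK scale1r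
                     -!comp_lfunA cc comp_lfun1r.
        by apply: (op_closedZ _ cT); apply: cT.2.
      + rewrite comp_lfunDl; apply: (op_closedD cT).
          by rewrite -comp_lfunA; apply: cT.2.
        rewrite -comp_lfunA -[(g0 \o opc A)%VF]scale1r -q0 comp_lfunA.
        exact: cT.2.
      + by rewrite comp_lfunDr !comp_lfunDl addrACA [X in _ + X]addrC addrACA addrA.
    - have [a0 [a1 [h0 h1 ->]]] := homog_split hk hE a hA.
      exists (opL a0), (opL a1); split; try exact: parL; last exact: opLD.
      + exact: TL h0.
      + exact: TL h1.
    - exists (opR b), 0; split=> //; [exact: parR | by rewrite comp_lfun0l |].
      by rewrite addr0.
    - exists 0, (opR b \o opc A)%VF; split=> //; last by rewrite add0r.
      + rewrite -[true]addbF; apply: parM; first exact: parR.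
        by rewrite /par scale1r.
      + by rewrite -comp_lfunA cc comp_lfun1r.
  case=> f0 [f1 [p0 p1 Tf0 _ ef]]; suff f10 : f1 = 0 by rewrite ef f10 addr0.
  (* f1 anticommutes with the grading f0 + f1, and so it vanishes *)
  have e1 : (f1 \o opc A = - (f1 \o opc A))%VF.
    apply: (@addrI _ (f0 \o opc A)%VF); rewrite -comp_lfunDl -ef {2}ef.
    by rewrite comp_lfunDr p0 p1 scale1r expr1 scaleN1r.
  have e2 : (f1 \o opc A = 0)%VF.
    apply/eqP; rewrite -(inj_eq (scalerI h2)) scaler0 scaler_nat mulr2n.
    by rewrite {1}e1 addNr.
  by rewrite -[f1]comp_lfun1r -cc comp_lfunA e2 comp_lfun0l.
apply: fullA => // [a|b hb]; last exact: cT.2.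
have [a0 [a1 [h0 h1 ->]]] := homog_split hk hE a hA; rewrite opLD.
apply: (op_closedD cT); first exact: TL h0.
rewrite -[opL a1]comp_lfun1r -cc comp_lfunA; apply: cT.2 => //; exact: TL h1.
Qed.

(** Source and target of F' and G' have the same dimension, so that surjectivity
    is enough. *)
Lemma superfull_azumaya : superfull A -> azumaya R A.
Proof.
move=> fullA; split=> //; split.
- exact: azumayaF_linear.
- apply: linear_surj_bij (superfull_F_surj fullA); first exact: azumayaF_linear.
  exact: dim_azumaya.
- exact: (azumayaF1 hk hE hA).
- exact: (azumayaFM hk hE hA).
- exact: azumayaG_linear.
- apply: linear_surj_bij (superfull_G_surj fullA); first exact: azumayaG_linear.
  exact: dim_azumaya.
- exact: (azumayaG1 hk hE hA).
- exact: (azumayaGM hk hE hA).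
Qed.

End Multiplications.

(** The kernel is stable under all the multiplications, hence under all of End(A),
    and some operator takes any nonzero element to 1. *)
Lemma superfull_inj (A B : modAlg E) (f : A -> B) : is_modAlg A -> is_modAlg B ->
  superfull A -> linear f -> f (alg_one A) = alg_one B ->
  (forall a b, f (alg_mul a b) = alg_mul (f a) (f b)) ->
  (forall a, f (act c a) = act c (f a)) -> injective f.
Proof.
move=> hA hB fullA lf f1 fM fc.
have mB := is_alg_bilin (is_modAlg_alg hB).
pose T (t : 'End(A)) := forall w, f w = 0 -> f (t w) = 0.
have Tall : forall t, T t.
  apply: fullA => [|a w fw|a _ w fw|a _ w fw].
  - split=> [r t s Tt Ts w fw|t s Tt Ts w fw].
      by rewrite add_lfunE scale_lfunE lf Tt // Ts // scaler0 addr0.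
    by rewrite comp_lfunE; apply/Tt/Ts.
  - by rewrite opLE // fM fw (bilin0r mB).
  - by rewrite opRE // fM fw (bilin0l mB).
  - rewrite comp_lfunE opRE // opcE // fM fc fw (bilin0r (is_modAlg_bilin hB)).
    by rewrite (bilin0l mB).
pose F : {linear A -> B} := lin_of lf.
apply: (raddf_inj (f := F)) => w fw; apply/eqP/contraT => w0.
have [i wi] := coord_neq0 w0.
pose t v := (coord (vbasis {:A}) i v / coord (vbasis {:A}) i w) *: alg_one A.
have lt : linear t by move=> r u v; rewrite /t linearP /= mulrDl scalerDl scalerA mulrA.
have := Tall (linfun t) w fw; rewrite (linfun_lin lt) /t mulfV // scale1r f1.
by move/eqP; rewrite (negPf (is_alg_neq0 (is_modAlg_alg hB))).
Qed.
End SuperFull.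

(** * Operators on tensor products and on endomorphism algebras *)

Section OperatorSpans.
Variable k : fieldType.

Lemma op_closed_sum (V : vectType k) (T : 'End(V) -> Prop) (I : Type) (r : seq I)
    (F : I -> 'End(V)) : op_closed T -> T 0 -> (forall i, T (F i)) ->
  T (\sum_(i <- r) F i).
Proof. by move=> cT T0 TF; elim/big_rec: _ => // i g _; exact: op_closedD. Qed.

Definition munit (V : vectType k) (i j : 'I_(\dim {:V})) : 'End(V) :=
  linfun (fun v => coord (vbasis {:V}) j v *: (vbasis {:V})`_i).

Lemma munitE (V : vectType k) (i j : 'I_(\dim {:V})) v :
  munit i j v = coord (vbasis {:V}) j v *: (vbasis {:V})`_i.
Proof.
by apply: linfun_lin => r u w; rewrite linearP /= scalerDl scalerA.
Qed.

Definition tmap (U V : vectType k) (f : 'End(U)) (g : 'End(V)) : 'End(tens U V) :=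
  linfun (tsum (fun u v => f u ⊗ g v)).

Lemma tmap_pure (U V : vectType k) (f : 'End(U)) (g : 'End(V)) u v :
  tmap f g (u ⊗ v) = f u ⊗ g v.
Proof.
rewrite (linfun_lin (tsum_linear _)) tsum_pure //.
by apply: bilin_comp (tpure_bilin _ _) _ _ => r a b; rewrite linearP.
Qed.

Lemma tens_lfunP (U V W : vectType k) (f g : 'Hom(tens U V, W)) :
  (forall u v, f (u ⊗ v) = g (u ⊗ v)) -> f = g.
Proof.
by move=> fg; apply/lfunP; apply: tens_linear_eq fg => r s t; rewrite linearP.
Qed.

(** End(U (x) V) is spanned by the tensor products of matrix units. *)
Lemma tmap_span (U V : vectType k) (T : 'End(tens U V) -> Prop) : op_closed T ->
  (forall f g, T (tmap f g)) -> forall h, T h.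
Proof.
move=> cT Tm h; have T0 : T 0 by exact: op_closed0 cT (Tm 0 0).
pose e := vbasis {:U}; pose e' := vbasis {:V}.
pose w i j := h (e`_i ⊗ e'`_j).
have -> : h = \sum_(i < \dim {:U}) \sum_(j < \dim {:V})
    \sum_(l < \dim {:U}) \sum_(m < \dim {:V})
      w i j l m *: tmap (munit l i) (munit m j).
  apply: tens_lfunP => u v.
  have tb := tpure_bilin U V.
  rewrite {1}(coord_vbasis (memvf u)) (bilin_suml tb) linear_sum sum_lfunE.
  apply: eq_bigr => i _.
  rewrite {1}(coord_vbasis (memvf v)) (bilin_sumr tb) linear_sum sum_lfunE.
  apply: eq_bigr => j _; rewrite (bilinZl tb) (bilinZr tb) !linearZ /=.
  rewrite -/e -/e' [h _]tens_basis -/(w i j) scaler_sumr scaler_sumr sum_lfunE.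
  apply: eq_bigr => l _; rewrite scaler_sumr scaler_sumr sum_lfunE.
  apply: eq_bigr => m _; rewrite scale_lfunE tmap_pure !munitE.
  by rewrite (bilinZl tb) (bilinZr tb) !scalerA mulrC mulrA.
do 4![apply: op_closed_sum => // ?].
exact: op_closedZ.
Qed.

(** End(End(V)) is spanned by the maps w |-> e w e' with e, e' matrix units. *)
Lemma sandwich_span (V : vectType k) (T : 'End('End(V)) -> Prop) : op_closed T ->
  (forall S : 'End('End(V)) , (exists f g, forall w, S w = (f \o w \o g)%VF) -> T S) ->
  forall h, T h.
Proof.
move=> cT TS h.
have sand (f g : 'End(V)) : linear (fun w : 'End(V) => (f \o w \o g)%VF).
  by move=> r u v; rewrite comp_lfunDr comp_lfunDl -comp_lfunZr -comp_lfunZl.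
pose S f g : 'End('End(V)) := linfun (fun w => (f \o w \o g)%VF).
have SE f g w : S f g w = (f \o w \o g)%VF by exact: (@linfun_lin k 'End(V) 'End(V) _ (sand f g) w).
have TSS f g : T (S f g) by apply: TS; exists f, g.
have T0 : T 0 by exact: op_closed0 cT (TSS 0 0).
pose e := vbasis {:V}.
have dec (w : 'End(V)) :
    w = \sum_(i < \dim {:V}) \sum_(j < \dim {:V}) coord e i (w e`_j) *: munit i j.
  apply/lfunP=> v; rewrite {1}(coord_vbasis (memvf v)) linear_sum /=.
  rewrite sum_lfunE; under [RHS]eq_bigr => i _ do rewrite sum_lfunE.
  rewrite exchange_big /=; apply: eq_bigr => j _; rewrite linearZ /=.
  rewrite {1}(coord_vbasis (memvf (w e`_j))) scaler_sumr.
  apply: eq_bigr => i _; rewrite scale_lfunE munitE !scalerA mulrC.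
  by [].
have -> : h = \sum_(i < \dim {:V}) \sum_(j < \dim {:V})
  \sum_(a < \dim {:V}) \sum_(b < \dim {:V})
    coord e a (h (munit i j) e`_b) *: S (munit a i) (munit j b).
  apply/lfunP=> w; rewrite {1}(dec w) linear_sum /= sum_lfunE.
  apply: eq_bigr => i _; rewrite linear_sum /= sum_lfunE.
  apply: eq_bigr => j _; rewrite linearZ /= {1}(dec (h _)) scaler_sumr sum_lfunE.
  apply: eq_bigr => a _; rewrite scaler_sumr sum_lfunE.
  apply: eq_bigr => b _; rewrite scale_lfunE SE scalerA mulrC -scalerA.
  congr (_ *: _); apply/lfunP=> v; rewrite scale_lfunE !comp_lfunE !munitE.
  by rewrite [w (_ *: _)]linearZ /= [in RHS]linearZ /= scalerA mulrC.
do 4![apply: op_closed_sum => // ?].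
exact: op_closedZ.
Qed.

End OperatorSpans.

Section SuperFullExamples.
Variables (k : fieldType) (n : nat) (E : hopfAlg k) (c : E) (x : 'I_n -> E).
Hypothesis hk : 2%N \notin [pchar k].
Hypothesis hE : is_En c x.
Let R := R0 c.

(** The multiplications by a # 1 are those of A acting on the first factor alone,
    and generate End(A) (x) 1. This contains the grading of A, which is what is
    needed to remove the signs from the multiplications by 1 # b. *)
Lemma smash_superfull (A B : modAlg E) : is_modAlg A -> is_modAlg B ->
  superfull c A -> superfull c B -> superfull c (smash R A B).
Proof.
move=> hA hB fA fB T cT TL TR TRc.
have isA := is_modAlg_alg hA; have isB := is_modAlg_alg hB.
have mA := is_alg_bilin isA; have mB := is_alg_bilin isB.
have hS := smash_is_modAlg hk hE hA hB.
have isS := is_modAlg_alg hS.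
have o1 := homog1 hE hA; have o1' := homog1 hE hB.
have tb := tpure_bilin A B.
have homP (f g : 'End(smash R A B)) : (forall e e' (a : A) (b : B),
    homog c e a -> homog c e' b -> f (a ⊗ b) = g (a ⊗ b)) -> f = g.
  move=> fg; apply/lfunP; apply: (smash_ind hk hE hA hB) => [r s t es et|e e' a b ha hb].
    by rewrite !linearP /= es et.
  exact: fg ha hb.
have T1 t : T (tmap t \1%VF).
  move: t; apply: fA => [|a|a ha|a ha].
  - split=> [r f g Tf Tg|f g Tf Tg].
      suff -> : tmap (r *: f + g) \1 = r *: tmap f \1 + tmap g \1 :> 'End(smash R A B).
        exact: cT.1.
      apply: tens_lfunP => a b; rewrite add_lfunE scale_lfunE !tmap_pure.
      by rewrite add_lfunE scale_lfunE (bilinDl tb) (bilinZl tb).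
    suff -> : tmap (f \o g) \1 = (tmap f \1 \o tmap g \1)%VF :> 'End(smash R A B).
      exact: cT.2.
    by apply: tens_lfunP => a b; rewrite comp_lfunE !tmap_pure comp_lfunE !id_lfunE.
  - suff -> : tmap (opL a) \1 = opL (a ⊗ alg_one B : smash R A B) by exact: TL.
    apply: homP => e e' a' b ha' hb; rewrite tmap_pure !opLE // id_lfunE.
    by rewrite (smashM_homog hk hA hB _ _ o1' ha') scale1r is_alg1l.
  - suff -> : tmap (opR a) \1 = opR (a ⊗ alg_one B : smash R A B).
      by apply: TR; exact: (homog_tpure hE hA hB ha o1').
    apply: homP => e e' a' b ha' hb; rewrite tmap_pure !opRE // id_lfunE.
    by rewrite (smashM_homog hk hA hB _ _ hb ha) andbF scale1r is_alg1r.
  - suff -> : tmap (opR a \o opc c A) \1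
        = (opR (a ⊗ alg_one B : smash R A B) \o opc c (smash R A B))%VF.
      by apply: TRc; exact: (homog_tpure hE hA hB ha o1').
    apply: homP => e e' a' b ha' hb; rewrite tmap_pure !comp_lfunE !opRE // id_lfunE.
    rewrite !opcE // (smash_c hE hA hB) (smashM_homog hk hA hB _ _ (homog_c hB hb) ha).
    by rewrite hb (bilinZl mB) (bilinZr tb) scalerA andbT -signr_addb addbb scale1r is_alg1r.
have TM f g : T (tmap \1%VF g) -> T (tmap f g).
  move=> Tg; suff -> : tmap f g = (tmap f \1 \o tmap \1 g)%VF by exact: cT.2.
  by apply: tens_lfunP => a b; rewrite comp_lfunE !tmap_pure !id_lfunE.
apply: tmap_span => // f g; apply: TM; move: g; apply: fB => [|b|b hb|b hb].
- split=> [r f' g Tf Tg|f' g Tf Tg].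
    suff -> : tmap \1 (r *: f' + g) = r *: tmap \1 f' + tmap \1 g :> 'End(smash R A B).
      exact: cT.1.
    apply: tens_lfunP => a b; rewrite add_lfunE scale_lfunE !tmap_pure.
    by rewrite add_lfunE scale_lfunE (bilinDr tb) (bilinZr tb).
  suff -> : tmap \1 (f' \o g) = (tmap \1 f' \o tmap \1 g)%VF :> 'End(smash R A B).
    exact: cT.2.
  by apply: tens_lfunP => a b; rewrite comp_lfunE !tmap_pure comp_lfunE !id_lfunE.
- have Th e (b' : B) : homog c e b' -> T (tmap \1%VF (opL b')).
    move=> hb'.
    suff -> : tmap \1 (opL b') = (opL (alg_one A ⊗ b' : smash R A B)
        \o tmap (if e then opc c A else \1) \1)%VF by exact: cT.2.
    apply: homP => e1 e2 a' b1 ha' hb1; rewrite comp_lfunE !tmap_pure !opLE // !id_lfunE.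
    have -> : (if e then opc c A else \1%VF) a' = (-1) ^+ (e && e1) *: a'.
      by case: e {hb'}; rewrite ?opcE ?id_lfunE ?scale1r.
    rewrite (bilinZl tb) (bilinZr (smash_mul_bilin c A B)).
    rewrite (smashM_homog hk hA hB _ _ hb' ha') scalerA -signr_addb addbb scale1r.
    by rewrite is_alg1l.
  have [b0 [b1 [h0 h1 ->]]] := homog_split hk hE b hB.
  suff -> : tmap \1 (opL (b0 + b1)) = tmap \1 (opL b0) + tmap \1 (opL b1)
    :> 'End(smash R A B).
    by apply: (op_closedD cT); [exact: Th h0 | exact: Th h1].
  apply: tens_lfunP => a b'; rewrite add_lfunE !tmap_pure !opLE //.
  by rewrite (bilinDl mB) (bilinDr tb).
- suff -> : tmap \1 (opR b) = opR (alg_one A ⊗ b : smash R A B).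
    by apply: TR; exact: (homog_tpure hE hA hB o1 hb).
  apply: homP => e e' a' b' ha' hb'; rewrite tmap_pure !opRE // id_lfunE.
  by rewrite (smashM_homog hk hA hB _ _ hb' o1) andbF scale1r is_alg1r.
- suff -> : tmap \1 (opR b \o opc c B)
      = ((opR (alg_one A ⊗ b : smash R A B) \o opc c (smash R A B)) \o tmap (opc c A) \1)%VF.
    apply: cT.2 => //; apply: TRc; exact: (homog_tpure hE hA hB o1 hb).
  apply: homP => e e' a' b' ha' hb'; rewrite !comp_lfunE !tmap_pure !comp_lfunE.
  rewrite !opRE // !id_lfunE !opcE // (smash_c hE hA hB) (act_cc hE) //.
  by rewrite (smashM_homog hk hA hB _ _ (homog_c hB hb') o1) andbF scale1r is_alg1r.
Qed.

(** With the grading inner, given by U, the signed right multiplication by U g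
    composed with the left multiplication by U is, for g odd, w |-> w g. So all
    maps w |-> f w g are reached. *)
Lemma End_superfull (V : vectType k) (aV : E -> 'End(V) -> 'End(V)) (U : 'End(V)) :
  let A := @ModAlg k E (End_alg V) aV in is_modAlg A -> (U \o U = \1)%VF ->
  (forall f, aV c f = (U \o f \o U)%VF) -> superfull c A.
Proof.
move=> A hA UU cU T cT TL TR TRc.
have hsp := homog_split hk hE _ hA.
have opRDA (a b : A) : opR (a + b) = opR a + opR b by exact: opRD hA a b.
have TRall (g : A) : T (opR g).
  have [g0 [g1 [h0 h1 ->]]] := hsp g; rewrite opRDA; apply: (op_closedD cT); first exact: TR.
  have e1 : (U \o g1 \o U = - g1)%VF by rewrite -cU -[- g1]scaleN1r; exact: h1.
  have hU : homog c true (U \o g1 : A)%VF.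
    rewrite /homog [act _ _]cU !comp_lfunA UU comp_lfun1l expr1 scaleN1r.
    by rewrite -comp_lfunNr -e1 !comp_lfunA UU comp_lfun1l.
  suff -> : opR g1 = (opL (U : A) \o (opR (U \o g1 : A)%VF \o opc c A))%VF.
    by apply: cT.2 => //; exact: TRc.
  apply/lfunP=> w; rewrite !comp_lfunE (opRE hA) (opLE hA) [opR _ _](opRE hA) (opcE c hA).
  rewrite [act _ _]cU /=.
  by rewrite !comp_lfunA UU comp_lfun1l -[((w \o U) \o U)%VF]comp_lfunA UU comp_lfun1r.
apply: sandwich_span => // S [f [g Sfg]].
suff -> : S = (opL (f : A) \o opR (g : A))%VF by exact: cT.2.
by apply/lfunP=> w; rewrite Sfg comp_lfunE (opLE hA) (opRE hA) /= comp_lfunA.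
Qed.

End SuperFullExamples.

(** * The canonical anticommutation relations *)

Section CanonicalAnticommutation.
Variables (B : nzRingType) (I : eqType) (a b : I -> B).
Hypothesis aa : forall i j, a i * a j = - (a j * a i).
Hypothesis bb : forall i j, b i * b j = - (b j * b i).
Hypothesis ab : forall i j, a i * b j + b j * a i = (i == j)%:R.
Hypothesis a2 : forall i, a i * a i = 0.

(** With a_i annihilating and b_i creating, a_i b_i + b_i a_i = 1 and so a_i b_i is
    the idempotent onto the states in which i is empty; the product projects on
    the states in which all of s is empty. *)
Definition vacuum (s : seq I) : B := \prod_(i <- s) (a i * b i).

Lemma ab_neq i j : i != j -> a i * b j = - (b j * a i).
Proof. by move=> ij; apply/eqP; rewrite -addr_eq0 ab (negPf ij). Qed.

Lemma a_vacuum i s : i \notin s -> a i * vacuum s = vacuum s * a i.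
Proof.
elim: s => [|j s IHs]; rewrite /vacuum ?big_nil ?mulr1 ?mul1r //.
rewrite inE negb_or => /andP[ij /IHs]; rewrite /vacuum big_cons => IH.
rewrite -[RHS]mulrA -IH !mulrA; congr (_ * _).
by rewrite aa mulNr -[X in - X]mulrA (ab_neq ij) mulrN opprK mulrA.
Qed.

Lemma b_vacuum i s : i \notin s -> b i * vacuum s = vacuum s * b i.
Proof.
elim: s => [|j s IHs]; rewrite /vacuum ?big_nil ?mulr1 ?mul1r //.
rewrite inE negb_or => /andP[ij /IHs]; rewrite /vacuum big_cons => IH.
rewrite -[RHS]mulrA -IH !mulrA; congr (_ * _).
have X1 : b i * a j = - (a j * b i) by rewrite ab_neq ?opprK // eq_sym.
by rewrite -[LHS]mulrA mulrA X1 mulNr -[X in - X]mulrA [b i * b j]bb mulrN opprK mulrA.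
Qed.

Lemma a_vacuum0 i s : i \in s -> a i * vacuum s = 0.
Proof.
elim: s => // j s IHs; rewrite inE /vacuum big_cons.
have [-> _|ij /= /IHs IH] := eqVneq i j; first by rewrite !mulrA a2 !mul0r.
rewrite !mulrA aa mulNr -[_ * b j]mulrA (ab_neq ij) mulrN opprK mulrA.
by rewrite -[LHS]mulrA -/(vacuum s) IH mulr0.
Qed.

Lemma ab_ba i : a i * b i = 1 - b i * a i.
Proof.
have e : a i * b i + b i * a i = 1 by rewrite ab eqxx.
by rewrite -e addrK.
Qed.

(** In the matrix algebra generated by a_i and b_i, the idempotents pi = a_i b_i
    and b_i a_i = b_i pi a_i sum to 1; inserting this sum on both sides of p f p
    expresses p f p by corners of pi p. *)
Lemma vacuum_step (T : B -> Prop) i s : i \notin s ->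
  (forall f g, T f -> T g -> T (f + g)) -> (forall f g, T f -> T g -> T (f * g)) ->
  T (a i) -> T (b i) ->
  (forall f, T (vacuum (i :: s) * f * vacuum (i :: s))) ->
  forall f, T (vacuum s * f * vacuum s).
Proof.
move=> nis TD TM Ta Tb; rewrite {1 2}/vacuum big_cons -/(vacuum s) => TP f.
set p := vacuum s in TP *; set pi := a i * b i in TP *.
have pap : p * a i = a i * p by rewrite a_vacuum.
have pbp : p * b i = b i * p by rewrite b_vacuum.
have pip : pi * p = p * pi by rewrite /pi mulrA pap -!mulrA pbp.
have e1 : 1 = pi + b i * a i by rewrite /pi ab_ba subrK.
have qE : b i * a i = b i * pi * a i.
  by rewrite /pi ab_ba mulrBr mulr1 mulrBl -!mulrA a2 !mulr0 subr0.
pose u := b i; pose v := a i.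
have split_f : p * f * p = pi * p * f * (p * pi) + pi * p * (f * u) * (p * pi) * v
    + u * (pi * p * (v * f) * (p * pi)) + u * (pi * p * (v * f * u) * (p * pi)) * v.
  have -> : p * f * p = (pi + u * pi * v) * (p * f * p) * (pi + u * pi * v).
    by rewrite /u /v -qE -e1 mul1r mulr1.
  have ppu : pi * p * (f * u) * (p * pi) * v = pi * (p * f * p) * (u * pi * v).
    by rewrite !mulrA -[_ * f * u * p]mulrA -pbp !mulrA.
  have ppv : u * (pi * p * (v * f) * (p * pi)) = u * pi * v * (p * f * p) * pi.
    by rewrite !mulrA -[_ * p * v]mulrA pap !mulrA.
  have ppw : u * (pi * p * (v * f * u) * (p * pi)) * v
      = u * pi * v * (p * f * p) * (u * pi * v).
    by rewrite !mulrA -[_ * p * v]mulrA pap !mulrA -[_ * f * u * p]mulrA -pbp !mulrA.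
  rewrite ppu ppv ppw mulrDl mulrDl !mulrDr !addrA; congr (_ + _ + _ + _).
  by rewrite !mulrA.
have TP' g : T (pi * p * g * (p * pi)) by rewrite -pip; exact: TP.
rewrite split_f; apply: (TD); last by apply: (TM) => //; exact: TM.
by apply: (TD); [apply: (TD) => //; exact: TM | exact: TM].
Qed.

(** A subring that contains the a_i, the b_i and the corner of the full vacuum
    projection is everything: remove the indices one after the other. *)
Lemma vacuum_full (T : B -> Prop) (s r : seq I) : uniq (s ++ r) ->
  (forall f g, T f -> T g -> T (f + g)) -> (forall f g, T f -> T g -> T (f * g)) ->
  (forall i, T (a i)) -> (forall i, T (b i)) ->
  (forall f, T (vacuum (s ++ r) * f * vacuum (s ++ r))) ->
  forall f, T (vacuum r * f * vacuum r).
Proof.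
move=> us TD TM Ta Tb; elim: s us => //= i s IHs /andP[nis us] TP.
by apply: IHs => // f; apply: vacuum_step nis TD TM _ _ TP f.
Qed.

End CanonicalAnticommutation.

(** * Clifford algebras as Fock spaces *)

Section CliffordSuperFull.
Variables (k : fieldType) (n : nat) (E : hopfAlg k) (c : E) (x : 'I_n -> E).
Hypothesis hk : 2%N \notin [pchar k].
Hypothesis hE : is_En c x.
Variables (A : falgType k) (aA : E -> A -> A).
Hypothesis hA : is_modAlg (modAlg_of aA).
Let sM (a b : A) : aA c (a * b) = aA c a * aA c b.
Proof. exact: (act_cM hE (A := modAlg_of aA)). Qed.
Let ss (a : A) : aA c (aA c a) = a.
Proof. exact: (act_cc hE (A := modAlg_of aA)). Qed.
Let bA := is_modAlg_bilin hA : is_bilinear aA.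

Import FalgLfun.

(** The operators w |-> u w + p (-1)^|w| w u. For equal signs p they anticommute,
    for opposite signs their anticommutator is twice the form (Dop_anticomm). So
    p = 1 gives creation and p = -1 annihilation operators on a Clifford
    algebra. *)
Definition Dop (p : k) (u : A) : 'End(A) :=
  opL (u : modAlg_of aA) + p *: (opR (u : modAlg_of aA) \o opc c (modAlg_of aA))%VF.

Lemma DopE p u w : Dop p u w = u * w + p *: (aA c w * u).
Proof.
rewrite add_lfunE scale_lfunE comp_lfunE; congr (_ + _ *: _).
  exact: (opLE hA u w).
by rewrite [LHS](opRE hA) (opcE c hA).
Qed.

Lemma Dop_anticomm p q u u' beta : aA c u = - u -> aA c u' = - u' ->
  u * u' + u' * u = beta%:A ->
  Dop p u * Dop q u' + Dop q u' * Dop p u = ((1 - p * q) * beta) *: 1.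
Proof.
move=> su su' uu'; apply/lfunP=> w.
rewrite add_lfunE !lfun_mulE scale_lfunE !DopE.
rewrite [(1 : 'End(A)) w]id_lfunE.
rewrite !(bilinDr bA) !(bilinZr bA) !sM !ss su su'.
rewrite !mulrDl !mulrDr !scalerDr -!scalerAr -!scalerAl !scalerA.
rewrite !(mulrN, mulNr, scalerN) !mulrA.
have e1 : u * u' * w = beta *: w - u' * u * w.
  by rewrite -[beta *: w]mul1r -scalerAr scalerAl -uu' mulrDl addrK.
have e2 : w * u' * u = beta *: w - w * u * u'.
  by rewrite -[beta *: w]mulr1 -scalerAl scalerAr -uu' mulrDr -!mulrA addrAC subrr add0r.
rewrite e1 e2 mul1r scalerBl scalerBr scalerA [q * p]mulrC.
move: (u' * u * w) (p *: _) (q *: _) ((p * q) *: (w * u * u')) (beta *: w)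
  ((p * q * beta) *: w) => X1 X2 X3 Y B C.
rewrite opprB !addrA [LHS](ACl ((1*6)*(2*8)*(7*3)*(9*4)*(5*10))) /=.
by rewrite !subrr !add0r.
Qed.

(* y is the family dual to v with respect to the Clifford form S *)
Variable I : finType.
Variables (v y : I -> A) (S S' : I -> I -> k) (r : I -> I -> k).
Hypothesis sv : forall i, aA c (v i) = - v i.
Hypothesis sy : forall i, aA c (y i) = - y i.
Hypothesis vv : forall i j, v i * v j + v j * v i = (S i j)%:A.
Hypothesis yy : forall i j, y i * y j + y j * y i = (S' i j)%:A.
Hypothesis vy : forall i j, v i * y j + y j * v i = ((i == j)%:R)%:A.
Hypothesis vdec : forall i, v i = \sum_j r i j *: y j.
Hypothesis gen : generates v.

Let h2 : (2 : k) != 0 := two_neq0 hk.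
Let create i : 'End(A) := 2^-1 *: Dop 1 (v i).
Let annih i : 'End(A) := Dop (-1) (y i).

(** The span of the states obtained from 1, which all annih i kill, by the
    creation operators. *)
Inductive fock : A -> Prop :=
| fock1 : fock 1
| fock_create i w : fock w -> fock (create i w)
| fock_lin r u w : fock u -> fock w -> fock (r *: u + w).

Let cc_anti i j : create i * create j = - (create j * create i).
Proof.
apply/eqP; rewrite -addr_eq0 -!scalerAl -!scalerAr -!scalerDr.
by rewrite (Dop_anticomm _ _ (sv i) (sv j) (vv i j)) mulr1 subrr mul0r !scale0r !scaler0.
Qed.

Let aa_anti i j : annih i * annih j = - (annih j * annih i).
Proof.
apply/eqP; rewrite -addr_eq0 (Dop_anticomm _ _ (sy i) (sy j) (yy i j)).
by rewrite mulrNN mulr1 subrr mul0r scale0r.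
Qed.

Let ca_anti i j : create i * annih j + annih j * create i = (i == j)%:R.
Proof.
rewrite -scalerAl -scalerAr -scalerDr (Dop_anticomm _ _ (sv i) (sy j) (vy i j)).
rewrite scalerA mul1r opprK mulrA mulVf // mul1r.
by case: (i == j); rewrite ?scale1r ?scale0r.
Qed.

Let cc0 i : create i * create i = 0.
Proof.
have := cc_anti i i => /eqP; rewrite -addr_eq0 -mulr2n -scaler_nat.
by rewrite scaler_eq0 (negPf h2) => /eqP.
Qed.

Let annih1 i : annih i 1 = 0.
Proof.
rewrite DopE mulr1 (_ : aA c 1 = 1) ?mul1r ?scaleN1r ?subrr //.
by have := homog1 hE hA; rewrite /homog scale1r.
Qed.

Let fock0 : fock 0.
Proof. by rewrite -[0](addNr 1) -scaleN1r; apply: fock_lin; exact: fock1. Qed.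

Let fockZ a w : fock w -> fock (a *: w).
Proof. by move=> fw; rewrite -[_ *: _]addr0; exact: fock_lin. Qed.

Let fock_sum (J : finType) (F : J -> A) : (forall j, fock (F j)) -> fock (\sum_j F j).
Proof.
move=> fF; elim/big_ind: _ => // u w fu fw.
by rewrite -[u]scale1r; exact: fock_lin.
Qed.

Let fock_annih j w : fock w -> fock (annih j w).
Proof.
elim=> {w} [|i w fw fa|a u w fu fau fw faw]; first by rewrite annih1.
- have -> : annih j (create i w) = (i == j)%:R *: w + (-1) *: create i (annih j w).
    have /lfunP/(_ w) := ca_anti i j; rewrite add_lfunE !lfun_mulE.
    move=> /(canRL (addrK _)) ->; rewrite scaleN1r; congr (_ - _).
    case: (i == j); last by rewrite scale0r zero_lfunE.
    by rewrite scale1r [LHS]id_lfunE.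
  by apply: fock_lin => //; apply: fockZ; exact: fock_create.
- by rewrite linearP; exact: fock_lin.
Qed.

(** Left multiplication by v_i is a creation operator plus a combination of
    annihilation operators, so that the Fock space is closed under it. *)
Let fock_all w : fock w.
Proof.
move: w; apply: gen => [|a u w fu fw|i w fw]; first exact: fock1.
  exact: fock_lin.
have -> : v i * w = create i w + 2^-1 *: \sum_j r i j *: annih j w.
  rewrite scale_lfunE -scalerDr DopE scale1r.
  have -> : \sum_j r i j *: annih j w = v i * w - aA c w * v i.
    rewrite [in RHS]vdec mulr_suml mulr_sumr -sumrB; apply: eq_bigr => j _.
    by rewrite DopE scaleN1r scalerBr scalerAl scalerAr.
  by rewrite addrACA subrr addr0 -mulr2n -scaler_nat scalerA mulVf // scale1r.
rewrite -[create i w]scale1r; apply: fock_lin; first exact: fock_create.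
by apply/fockZ/fock_sum => j; apply/fockZ/fock_annih.
Qed.

(* The ring product of End(A) is the composition in the opposite order, and so the
   creation operators come first here. *)
Let P := vacuum create annih (enum I).

Let P1 : P 1 = 1.
Proof.
rewrite /P; elim: (enum I) => [|i s IHs]; rewrite /vacuum ?big_nil ?big_cons ?id_lfunE //.
rewrite lfun_mulE.
have -> : (create i * annih i) 1 = 1.
  have /lfunP/(_ 1) := ca_anti i i; rewrite eqxx add_lfunE [X in _ + X]lfun_mulE.
  by rewrite annih1 linear0 addr0 [RHS]id_lfunE.
exact: IHs.
Qed.

(** The projection P kills all states except the vacuum 1. *)
Let P_scalar w : exists a : k, P w = a%:A.
Proof.
elim: (fock_all w) => {w} [|i w fw _|a u w _ [b eb] _ [d ed]].
- by exists 1; rewrite P1 scale1r.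
- exists 0; rewrite scale0r -lfun_mulE (a_vacuum0 cc_anti ca_anti cc0) ?mem_enum //.
  by rewrite zero_lfunE.
- by exists (a * b + d); rewrite linearP /= eb ed scalerA -scalerDl.
Qed.

(** All creation and annihilation operators are super multiplications, and the
    corner of End(A) cut out by the projection P on the line of 1 consists of
    the multiples of P. *)
Lemma clifford_superfull : superfull c (modAlg_of aA).
Proof.
move=> T cT TL TR TRc f.
have TD f1 f2 : T f1 -> T f2 -> T (f1 + f2) by exact: op_closedD.
have TM f1 f2 : T f1 -> T f2 -> T (f1 * f2) by move=> T1 T2; exact: cT.2.
have TDop p u : aA c u = - u -> T (Dop p u).
  move=> su; apply: (TD) => //; apply: (op_closedZ _ cT); apply: TRc.
  by rewrite /homog [act _ _]su expr1 scaleN1r.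
have Tc i : T (create i) by apply: (op_closedZ _ cT); exact: TDop.
have Ta i : T (annih i) by exact: TDop.
have T1 : T (1 : 'End(A)).
  have <- : opL (1 : modAlg_of aA) = 1 :> 'End(A) by exact: opL1 hA.
  exact: TL.
have TP : T P.
  by rewrite /P /vacuum; elim/big_ind: _ => // i _; exact: TM.
have := vacuum_full cc_anti aa_anti ca_anti cc0 (T := T) (s := enum I) (r := [::]).
rewrite cats0 enum_uniq => /(_ isT TD TM Tc Ta) /=.
rewrite /vacuum big_nil => Tf; rewrite -[f]mul1r -[_ * f]mulr1; apply: Tf => {}f.
have [a ea] := P_scalar (f 1).
suff -> : P * f * P = a *: P by exact: op_closedZ.
apply/lfunP=> w; rewrite !lfun_mulE scale_lfunE.
have [b ->] := P_scalar w; rewrite !linearZ /= ea.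
by rewrite !scalerA mulrC.
Qed.
End CliffordSuperFull.

Section CliffordExamples.
Variables (k : fieldType) (n : nat) (E : hopfAlg k) (c : E) (x : 'I_n -> E).
Hypothesis hk : 2%N \notin [pchar k].
Hypothesis hE : is_En c x.

(** A nondegenerate form: s is the inverse of the matrix S of the form, and
    y = s v is the dual family. *)
Lemma clifford_superfull_gram (A : falgType k) (aA : E -> A -> A) (I : finType)
    (v : I -> A) (S s : I -> I -> k) :
  is_modAlg (modAlg_of aA) -> (forall i, aA c (v i) = - v i) ->
  (forall i j, v i * v j + v j * v i = (S i j)%:A) ->
  (forall i j, s i j = s j i) ->
  (forall i j, \sum_l S i l * s l j = (i == j)%:R) -> generates v ->
  superfull c (modAlg_of aA).
Proof.
move=> hA sv vv ssym Ss gen; pose y j := \sum_l s j l *: v l.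
have bA := is_modAlg_bilin hA : is_bilinear aA.
have vy i j : v i * y j + y j * v i = ((i == j)%:R)%:A.
  rewrite mulr_sumr mulr_suml -big_split -Ss scaler_suml; apply: eq_bigr => l _ /=.
  by rewrite -scalerAr -scalerAl -scalerDr vv scalerA mulrC ssym.
apply: (clifford_superfull hk hE hA (v := v) (y := y) (S := S) (r := S)
  (S' := fun j l => \sum_i s j i * (i == l)%:R)) => //.
- move=> j; rewrite (bilin_sumr bA) -sumrN; apply: eq_bigr => l _.
  by rewrite (bilinZr bA) sv scalerN.
- move=> i j; rewrite {1 4}/y mulr_suml mulr_sumr -big_split scaler_suml.
  apply: eq_bigr => l _ /=.
  by rewrite -scalerAl -scalerAr -scalerDr vy scalerA.
- move=> i; transitivity (\sum_l (\sum_j S i j * s j l) *: v l).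
    under eq_bigr => l _ do rewrite Ss.
    rewrite (bigD1 i) //= eqxx scale1r big1 ?addr0 // => l li.
    by rewrite eq_sym (negPf li) scale0r.
  under [RHS]eq_bigr => j _ do rewrite scaler_sumr.
  rewrite [RHS]exchange_big; apply: eq_bigr => l _; rewrite scaler_suml.
  by apply: eq_bigr => j _; rewrite scalerA.
Qed.

Lemma big_option (V : nmodType) (m : nat) (F : option 'I_m -> V) :
  \sum_i F i = F None + \sum_i F (Some i).
Proof.
rewrite (bigD1 None) //=; congr (_ + _).
rewrite (reindex_omap Some id) //=; last by case.
by apply: eq_bigl => i; rewrite eqxx.
Qed.

Lemma C_superfull alpha (L : 'M[k]_n) (A : falgType k) (aA : E -> A -> A)
    (u : A) (z : 'I_n -> A) : alpha != 0 -> L^T = L -> L \in unitmx ->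
  is_modAlg (modAlg_of aA) -> presented (@C_rels k n alpha L) (oapp z u) ->
  aA c u = - u -> (forall i, aA c (z i) = - z i) -> superfull c (modAlg_of aA).
Proof.
move=> a0 Lsym Linv hA pr su sz; have h2 := two_neq0 hk.
have [[/= uu uz zz _] _] := pr.
pose S (i j : option 'I_n) := match i, j with
  None, None => 2 * alpha | Some i, Some j => 2 * L i j | _, _ => 0 end.
pose s (i j : option 'I_n) := match i, j with
  None, None => (2 * alpha)^-1 | Some i, Some j => 2^-1 * invmx L i j | _, _ => 0 end.
have LiT : (invmx L)^T = invmx L by rewrite trmx_inv Lsym.
apply: (clifford_superfull_gram (S := S) (s := s) hA _ _ _ _ (C_generates pr)).
- by case.
- case=> [i|] [j|] /=; rewrite ?scale0r.
  + exact: zz.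
  + by rewrite addrC uz.
  + exact: uz.
  + by rewrite -expr2 uu -mulr2n -scaler_nat scalerA.
- by case=> [i|] [j|] //=; rewrite -[in LHS]LiT mxE.
- case=> [i|] [j|] /=; rewrite big_option /=.
  + rewrite mul0r add0r; have /matrixP/(_ i j) := mulmxV Linv; rewrite !mxE => <-.
    apply: eq_bigr => l _; field. exact: h2.
  + by rewrite mul0r add0r big1 // => l _; rewrite mulr0.
  + by rewrite mulr0 add0r big1 // => l _; rewrite mul0r.
  + by rewrite mulfV ?mulf_neq0 // big1 ?addr0 // => l _; rewrite mul0r.
Qed.

Lemma Ct_superfull t (A : falgType k) (aA : E -> A -> A) (y : A) : t != 0 ->
  is_modAlg (modAlg_of aA) ->
  presented (fun (B : algType k) (b : unit -> B) => b tt ^+ 2 = t%:A) (fun=> y) ->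
  aA c y = - y -> superfull c (modAlg_of aA).
Proof.
move=> t0 hA pr sy; have h2 := two_neq0 hk; have [y2 _] := pr.
apply: (clifford_superfull_gram (S := fun _ _ => 2 * t) (s := fun _ _ => (2 * t)^-1)
  hA _ _ _ _ (Ct_generates pr)) => //.
- by move=> _ _; rewrite -expr2 y2 -mulr2n -scaler_nat scalerA.
- move=> [] []; rewrite (bigD1 tt) //= big1 ?addr0 => [|[]] //.
  by rewrite mulfV ?mulf_neq0.
Qed.

End CliffordExamples.

(** * Convolution and strongly inner actions *)

Section Convolution.
Variables (k : fieldType) (H : hopfAlg k).

Lemma comul4_tsum (W : vectType k) (G : H -> H -> H -> H -> W) h :
  \tsum_(a, b <- comul H h) \tsum_(a1, a2 <- comul H a)
    \tsum_(b1, b2 <- comul H b) G a1 a2 b1 b2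
  = \tsum_(a, b <- comul H h) \tsum_(b1, b2 <- comul H b)
    \tsum_(d1, d2 <- comul H b1) G a d1 d2 b2.
Proof.
rewrite (comulA_tsum (fun a1 a2 b => \tsum_(b1, b2 <- comul H b) G a1 a2 b1 b2)).
by apply: eq_tsum => a b; rewrite (comulA_tsum (fun b1 b2 b3 => G a b1 b2 b3)).
Qed.

Definition form_inverse (w w' : 'Hom(tens H H, k^o)) := forall g h : H,
  \tsum_(g1, g2 <- comul H g) \tsum_(h1, h2 <- comul H h)
    (w (g1 ⊗ h1) : k^o) * w' (g2 ⊗ h2) = counit H g * counit H h.

Section Convolution2.
Variable B : falgType k.
Implicit Types F G K : H -> H -> B.

Lemma mulr_tsuml (U V : vectType k) (F : U -> V -> B) t b :
  tsum F t * b = tsum (fun u v => F u v * b) t.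
Proof. by rewrite (linear_tsum _ _ ((mul_bilin B).2 b)). Qed.

Lemma mulr_tsumr (U V : vectType k) (F : U -> V -> B) t b :
  b * tsum F t = tsum (fun u v => b * F u v) t.
Proof. by rewrite (linear_tsum _ _ ((mul_bilin B).1 b)). Qed.

Definition conv2 F G (g h : H) : B :=
  \tsum_(g1, g2 <- comul H g) \tsum_(h1, h2 <- comul H h) F g1 h1 * G g2 h2.

Lemma eq_conv2 F F' G G' g h : (forall g h, F g h = F' g h) ->
  (forall g h, G g h = G' g h) -> conv2 F G g h = conv2 F' G' g h.
Proof. by move=> FF' GG'; do 2![apply: eq_tsum => ? ?]; rewrite FF' GG'. Qed.

Lemma conv2_bilin F G : is_bilinear (conv2 F G).
Proof.
split=> [g|h]; last by move=> r u v; rewrite /conv2 linearP tsum_linear.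
by apply: tsum_linear_r => g1 g2 r u v; rewrite linearP tsum_linear.
Qed.

(** Associativity of convolution. It lets the cocycle computations be done with
    words in functions of two variables instead of with indices. *)
Lemma conv2A F G K g h : conv2 F (conv2 G K) g h = conv2 (conv2 F G) K g h.
Proof.
rewrite /conv2.
transitivity (\tsum_(g1, g2 <- comul H g) \tsum_(h1, h2 <- comul H h)
    \tsum_(g21, g22 <- comul H g2) \tsum_(h21, h22 <- comul H h2)
      (F g1 h1 * (G g21 h21 * K g22 h22))).
  do 2![apply: eq_tsum => ? ?]; rewrite mulr_tsumr; apply: eq_tsum => ? ?.
  by rewrite mulr_tsumr.
transitivity (\tsum_(g1, g2 <- comul H g) \tsum_(g21, g22 <- comul H g2)
  \tsum_(h1, h2 <- comul H h) \tsum_(h11, h12 <- comul H h1)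
      (F g1 h11 * (G g21 h12 * K g22 h2))).
  apply: eq_tsum => g1 g2; rewrite tsum_exchange; apply: eq_tsum => g21 g22.
  by rewrite (comulA_tsum (fun a b d => F g1 a * (G g21 b * K g22 d))).
rewrite -(comulA_tsum (fun a b d => \tsum_(h1, h2 <- comul H h)
  \tsum_(h11, h12 <- comul H h1) (F a h11 * (G b h12 * K d h2)))).
apply: eq_tsum => g1 g2; rewrite tsum_exchange; apply: eq_tsum => h1 h2.
rewrite mulr_tsuml; apply: eq_tsum => g11 g12; rewrite mulr_tsuml.
by apply: eq_tsum => h11 h12; rewrite mulrA.
Qed.

Definition eps2 (g h : H) : B := ((counit H g : k) * (counit H h : k)) *: 1.

Lemma conv2_1l F g h : is_bilinear F -> conv2 eps2 F g h = F g h.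
Proof.
move=> bF; rewrite /conv2 -[RHS](counitl_tsum _ (bF.2 h)).
apply: eq_tsum => g1 g2; rewrite -(counitl_tsum h (bF.1 g2)) -tsumZ.
by apply: eq_tsum => h1 h2; rewrite -scalerAl mul1r scalerA.
Qed.

Lemma conv2_1r F g h : is_bilinear F -> conv2 F eps2 g h = F g h.
Proof.
move=> bF; rewrite /conv2 -[RHS](counitr_tsum _ (bF.2 h)).
apply: eq_tsum => g1 g2; rewrite -(counitr_tsum h (bF.1 g1)) -tsumZ.
by apply: eq_tsum => h1 h2; rewrite -scalerAr mulr1 scalerA.
Qed.

Definition form2 (w : 'Hom(tens H H, k^o)) (g h : H) : B := (w (g ⊗ h) : k) *: 1.

Lemma form2_inv (w w' : 'Hom(tens H H, k^o)) g h :
  form_inverse w w' -> conv2 (form2 w) (form2 w') g h = eps2 g h.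
Proof.
move=> ww'; rewrite /eps2 -[_ * _](ww' g h).
have lin1 : linear (fun r : k^o => (r : k) *: (1 : B)).
  by move=> a r r'; rewrite scalerDl scalerA.
rewrite (linear_tsum _ _ lin1); apply: eq_tsum => g1 g2.
rewrite (linear_tsum _ _ lin1); apply: eq_tsum => h1 h2.
by rewrite /form2 -scalerAl mul1r scalerA.
Qed.

Lemma conv2_form2l w F g h : conv2 (form2 w) F g h =
  \tsum_(g1, g2 <- comul H g) \tsum_(h1, h2 <- comul H h)
    (w (g1 ⊗ h1) : k) *: F g2 h2.
Proof. by do 2![apply: eq_tsum => ? ?]; rewrite /form2 -scalerAl mul1r. Qed.

Lemma conv2_form2r w F g h : conv2 F (form2 w) g h =
  \tsum_(g1, g2 <- comul H g) \tsum_(h1, h2 <- comul H h)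
    (w (g2 ⊗ h2) : k) *: F g1 h1.
Proof. by do 2![apply: eq_tsum => ? ?]; rewrite /form2 -scalerAr mulr1. Qed.

(** What laziness is used for: the form is central with respect to the functions
    of the product. *)
Lemma lazy_conv2 w (Q : H -> B) g h : is_lazy w -> linear Q ->
  conv2 (form2 w) (fun g h => Q (g * h)) g h
  = conv2 (fun g h => Q (g * h)) (form2 w) g h.
Proof.
move=> lw lQ; rewrite conv2_form2l conv2_form2r.
have lZ r a : Q (r *: a) = r *: Q a by exact: (linearZ_LR (lin_of lQ)).
transitivity (Q (twist_mul w g h)).
  rewrite (linear_tsum _ _ lQ); apply: eq_tsum => g1 g2.
  by rewrite (linear_tsum _ _ lQ); apply: eq_tsum => h1 h2; rewrite lZ.
rewrite lw (linear_tsum _ _ lQ); apply: eq_tsum => g1 g2.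
by rewrite (linear_tsum _ _ lQ); apply: eq_tsum => h1 h2; rewrite lZ.
Qed.

End Convolution2.

Section StronglyInner.
Variables (B : falgType k) (u v : H -> B) (w w' : 'Hom(tens H H, k^o)).
Hypothesis lu : linear u.
Hypothesis lv : linear v.
Hypothesis uv : forall h, \tsum_(h1, h2 <- comul H h) u h1 * v h2 = (counit H h : k) *: 1.
Hypothesis vu : forall h, \tsum_(h1, h2 <- comul H h) v h1 * u h2 = (counit H h : k) *: 1.
Hypothesis u1 : u 1 = 1.
Hypothesis uM : forall g h, u g * u h =
  \tsum_(g1, g2 <- comul H g) \tsum_(h1, h2 <- comul H h)
    (w (g1 ⊗ h1) : k) *: u (g2 * h2).
Hypotheses (ww' : form_inverse w w') (w'w : form_inverse w' w).
Hypothesis lazy_w : is_lazy w.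

Definition inner_act (h : H) (f : B) : B :=
  \tsum_(h1, h2 <- comul H h) u h1 * f * v h2.

Let ufv_bilin f : is_bilinear (fun h1 h2 => u h1 * f * v h2).
Proof.
split=> [h1|h2]; first exact: linear_comp ((mul_bilin B).1 _) lv.
exact: linear_comp ((mul_bilin B).2 _) (linear_comp ((mul_bilin B).2 _) lu).
Qed.

Let mu_bilin (f : H -> B) : linear f -> is_bilinear (fun g h => f (g * h)).
Proof.
by move=> lf; split=> [g|h]; [exact: linear_comp lf ((mul_bilin H).1 _)
                           | exact: linear_comp lf ((mul_bilin H).2 _)].
Qed.

Let U2 g h := u g * u h.
Let W2 g h := v h * v g.
Let Mu g h := u (g * h).
Let Mv g h := v (g * h).

Let W2_bilin : is_bilinear W2.
Proof.
split=> [g|h]; first exact: linear_comp ((mul_bilin B).2 _) lv.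
exact: linear_comp ((mul_bilin B).1 _) lv.
Qed.

Let U2E g h : U2 g h = conv2 (form2 B w) Mu g h.
Proof. by rewrite conv2_form2l /U2 uM. Qed.

Let U2W2 g h : conv2 U2 W2 g h = eps2 B g h.
Proof.
transitivity (\tsum_(g1, g2 <- comul H g) (counit H h : k) *: (u g1 * v g2)).
  apply: eq_tsum => g1 g2; rewrite -[u g1]mulr1 scalerAl scalerAr -uv.
  rewrite mulr_tsumr mulr_tsuml; apply: eq_tsum => h1 h2.
  by rewrite /U2 /W2 !mulrA.
by rewrite tsumZ uv scalerA mulrC.
Qed.

Let MvMu g h : conv2 Mv Mu g h = eps2 B g h.
Proof.
rewrite /eps2 -(counitM g h) -vu (comulM_tsum (F := fun a b => v a * u b)) //.
exact: bilin_comp (mul_bilin B) lv lu.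
Qed.

(* both sides are the convolution inverse of U2 *)
Let W2E g h : W2 g h = conv2 Mv (form2 B w') g h.
Proof.
set X := conv2 Mv (form2 B w').
have XU2 g' h' : conv2 X U2 g' h' = eps2 B g' h'.
  rewrite (eq_conv2 (G' := conv2 (form2 B w) Mu) (F' := X)) // /X -conv2A.
  rewrite -MvMu; apply: eq_conv2 => // a b; rewrite conv2A.
  rewrite (eq_conv2 (G' := Mu) (F' := eps2 B)) // => [|a' b']; last exact: form2_inv.
  by rewrite conv2_1l //; exact: mu_bilin.
rewrite -[LHS](conv2_1l g h W2_bilin) -[RHS](conv2_1r g h (conv2_bilin _ _)).
rewrite (eq_conv2 (F' := conv2 X U2) (G' := W2)) // -conv2A.
by apply: eq_conv2 => // a b; exact: U2W2.
Qed.

Let act_lin f : linear (inner_act^~ f).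
Proof. by move=> r g h; rewrite /inner_act linearP tsum_linear. Qed.

(** If U2(g,h) = u(g) u(h) = w * u(gh), then its convolution inverse is
    v(h) v(g) = v(gh) * w^-1. In g.(h.f) the factors w and w^-1 thus enclose the
    function Q(gh) = (gh).f, and cancel as w is central. *)
Lemma inner_act_actA g h f : inner_act (g * h) f = inner_act g (inner_act h f).
Proof.
pose Q p := inner_act p f.
pose N g h := f * Mv g h.
have QE a b : conv2 Mu N a b = Q (a * b).
  rewrite /Q /inner_act (comulM_tsum _ _ (ufv_bilin f)).
  by do 2![apply: eq_tsum => ? ?]; rewrite /Mu /N /Mv mulrA.
have NE a b : f * W2 a b = conv2 N (form2 B w') a b.
  rewrite W2E /conv2 mulr_tsumr; apply: eq_tsum => ? ?.
  by rewrite mulr_tsumr; apply: eq_tsum => ? ?; rewrite mulrA.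
have bQ : is_bilinear (fun a b => Q (a * b)) by exact: mu_bilin (act_lin f).
have -> : inner_act g (inner_act h f) = conv2 U2 (fun a b => f * W2 a b) g h.
  apply: eq_tsum => g1 g2; rewrite mulr_tsumr mulr_tsuml.
  by apply: eq_tsum => h1 h2; rewrite /U2 /W2 !mulrA.
rewrite (eq_conv2 g h U2E NE) -conv2A.
have -> : conv2 (form2 B w) (conv2 Mu (conv2 N (form2 B w'))) g h =
    conv2 (form2 B w) (conv2 (fun a b => Q (a * b)) (form2 B w')) g h.
  apply: eq_conv2 => // a b; rewrite conv2A.
  by apply: eq_conv2 => // a' b'; exact: QE.
rewrite conv2A.
rewrite (eq_conv2 g h (fun a b => lazy_conv2 a b lazy_w (act_lin f)) (fun a b => erefl)).
rewrite -conv2A -[LHS](conv2_1r g h bQ).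
by apply: eq_conv2 => // a b; rewrite form2_inv.
Qed.

(** Multiplicativity of the action holds because v(h_(2)) u(h_(3)) cancels in
    u(h_(1)) a v(h_(2)) u(h_(3)) b v(h_(4)). *)
Lemma inner_is_modAlg : is_modAlg (modAlg_of inner_act).
Proof.
have v1 : v 1 = 1.
  have := uv 1; rewrite comul1 (tsum_pure (F := fun a b => u a * v b)).
    by rewrite u1 mul1r counit1 scale1r.
  exact: bilin_comp (mul_bilin B) lu lv.
split=> /=.
- split=> /=; [exact: mul_bilin | exact: mulrA | exact: mul1r | exact: mulr1 | exact: oner_neq0].
- split=> [h|f]; last exact: act_lin.
  apply: tsum_linear_r => h1 h2.
  exact: linear_comp ((mul_bilin B).2 _) ((mul_bilin B).1 _).
- move=> f; rewrite /inner_act comul1 (tsum_pure _ _ (ufv_bilin f)).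
  by rewrite u1 v1 mulr1 mul1r.
- exact: inner_act_actA.
- by move=> h; rewrite /inner_act -uv; apply: eq_tsum => a b; rewrite mulr1.
- move=> h a b; rewrite /inner_act.
  transitivity (\tsum_(h1, h2 <- comul H h) \tsum_(a1, a2 <- comul H h1)
      \tsum_(b1, b2 <- comul H h2) (u a1 * a * v a2 * (u b1 * b * v b2))); last first.
    apply: eq_tsum => h1 h2; rewrite mulr_tsuml; apply: eq_tsum => a1 a2.
    by rewrite mulr_tsumr.
  rewrite (comul4_tsum (fun a1 a2 b1 b2 => u a1 * a * v a2 * (u b1 * b * v b2))).
  apply: eq_tsum => h1 h2.
  have lF : linear (fun d => u h1 * (a * b) * v d).
    exact: linear_comp ((mul_bilin B).1 _) lv.
  rewrite -(counitl_tsum _ lF); apply: eq_tsum => b1 b2.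
  rewrite -[u h1 * (a * b)]mulr1.
  transitivity (u h1 * a * (\tsum_(d1, d2 <- comul H b1) v d1 * u d2) * b * v b2).
    by rewrite vu mulr1 -!scalerAr mulr1 -!scalerAl !mulrA.
  rewrite mulr_tsumr !mulr_tsuml; apply: eq_tsum => d1 d2.
  by rewrite !mulrA.
Qed.

End StronglyInner.
End Convolution.

Lemma strongly_inner_modAlg (k : fieldType) (H : hopfAlg k)
    (w w' : 'Hom(tens H H, k^o)) (B : algData k) (hB : is_alg B) (u v : H -> B) :
  is_lazy w -> form_inverse w w' -> form_inverse w' w ->
  linear u -> linear v -> u 1 = alg_one B ->
  (forall h, \tsum_(h1, h2 <- comul H h) alg_mul (u h1) (v h2)
     = (counit H h : k) *: alg_one B) ->
  (forall h, \tsum_(h1, h2 <- comul H h) alg_mul (v h1) (u h2)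
     = (counit H h : k) *: alg_one B) ->
  (forall g h, alg_mul (u g) (u h) =
    \tsum_(g1, g2 <- comul H g) \tsum_(h1, h2 <- comul H h)
      (w (g1 ⊗ h1) : k) *: u (g2 * h2)) ->
  is_modAlg (@ModAlg k H B (fun h f =>
    \tsum_(h1, h2 <- comul H h) alg_mul (alg_mul (u h1) f) (v h2))).
Proof.
have [B' eB] := algData_falg hB; subst B => lazy ww' w'w lu lv u1 uv vu uM.
exact: (@inner_is_modAlg k H B' u v w w').
Qed.

(** * The regular representation twisted by a lazy cocycle *)

Section TwistedRegular.
Variables (k : fieldType) (H : hopfAlg k) (w : 'Hom(tens H H, k^o)).
Hypothesis cw : is_cocycle w.
Hypothesis lw : is_lazy w.

Lemma twist_mul_bilin : is_bilinear (twist_mul w).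
Proof.
split=> [g|h]; last by move=> r a b; rewrite /twist_mul linearP tsum_linear.
by apply: tsum_linear_r => g1 g2 r a b; rewrite linearP tsum_linear.
Qed.

Lemma twist_lmulE g h : twist_lmul w g h = twist_mul w g h.
Proof. exact: linfun_lin (twist_mul_bilin.1 g) h. Qed.

Lemma twist_lmul_linear : linear (twist_lmul w).
Proof.
move=> r a b; apply/lfunP=> h; rewrite add_lfunE scale_lfunE !twist_lmulE.
exact: twist_mul_bilin.2.
Qed.

Lemma lfun_tsumE (U V W W' : vectType k) (F : U -> V -> 'Hom(W, W')) t x :
  (tsum F t) x = tsum (fun a b => F a b x) t.
Proof. by apply: (linear_tsum (f := fun f : 'Hom(W, W') => f x)) => r f g; rewrite add_lfunE scale_lfunE. Qed.

Let wb : is_bilinear (fun a b => w (a ⊗ b) : k^o).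
Proof.
by split=> [a|b] r u v; [rewrite (bilinDr (tpure_bilin _ _)) (bilinZr (tpure_bilin _ _))
  | rewrite (bilinDl (tpure_bilin _ _)) (bilinZl (tpure_bilin _ _))]; rewrite linearP.
Qed.

Lemma twist_mul1 h : twist_mul w 1 h = h.
Proof.
have [_ w1 _] := cw; rewrite /twist_mul comul1 tsum_pure.
  rewrite -[RHS](counitl h); apply: eq_tsum => h1 h2.
  by rewrite (w1 _).2 mul1r.
split=> [a|b].
  apply: tsum_linear_r => h1 h2 r u v.
  by rewrite mulrDl -scalerAl scalerDr !scalerA mulrC.
by apply: tsum_linear_r => h1 h2 r u v; rewrite wb.2 scalerDl scalerA.
Qed.

(** Associativity of the twisted product, in the form in which left
    multiplications compose up to w. Both sides become sums of products
    g_(2) h_(2) l_(2) whose coefficients are the two sides of the cocycle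
    condition at g_(1), h_(1), l_(1). *)
Lemma twist_mulA g h l : twist_mul w g (twist_mul w h l) =
  \tsum_(g1, g2 <- comul H g) \tsum_(h1, h2 <- comul H h)
    (w (g1 ⊗ h1) : k) *: twist_mul w (g2 * h2) l.
Proof.
have [_ _ cocy] := cw.
have lg : linear (twist_mul w g) := twist_mul_bilin.1 g.
pose om (a b : H) : k^o := w (a ⊗ b).
have bF (g1 g2 : H) : is_bilinear (fun p1 p2 => om g1 p1 *: (g2 * p2)).
  split=> [a|b] r u v; first by rewrite mulrDr -scalerAr scalerDr !scalerA mulrC.
  by rewrite /om wb.1 scalerDl scalerA.
have bF' (l1 l2 : H) : is_bilinear (fun p1 p2 => om p1 l1 *: (p2 * l2)).
  split=> [a|b] r u v; first by rewrite mulrDl -scalerAl scalerDr !scalerA mulrC.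
  by rewrite /om wb.2 scalerDl scalerA.
transitivity (\tsum_(g1, g2 <- comul H g) \tsum_(h1, h2 <- comul H h)
   \tsum_(l1, l2 <- comul H l)
     (\tsum_(a1, a2 <- comul H h1) \tsum_(b1, b2 <- comul H l1)
        (om a1 b1 * om g1 (a2 * b2)) : k) *: (g2 * (h2 * l2))).
  transitivity (\tsum_(h1, h2 <- comul H h) \tsum_(l1, l2 <- comul H l)
     \tsum_(g1, g2 <- comul H g)  \tsum_(a1, a2 <- comul H h2)
      \tsum_(b1, b2 <- comul H l2) (om h1 l1 * om g1 (a1 * b1)) *: (g2 * (a2 * b2))).
    rewrite (linear_tsum _ _ lg); apply: eq_tsum => h1 h2.
    rewrite (linear_tsum _ _ lg); apply: eq_tsum => l1 l2.
    rewrite (bilinZr twist_mul_bilin) -tsumZ; apply: eq_tsum => g1 g2.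
    rewrite (comulM_tsum _ _ (bF g1 g2)) -tsumZ; apply: eq_tsum => a1 a2.
    by rewrite -tsumZ; apply: eq_tsum => b1 b2; rewrite scalerA.
  under eq_tsum => h1 h2 do rewrite tsum_exchange.
  rewrite tsum_exchange; apply: eq_tsum => g1 g2.
  under eq_tsum => h1 h2 do rewrite tsum_exchange.
  rewrite -(comulA_tsum (fun a1 a2 b => \tsum_(l1, l2 <- comul H l)
    \tsum_(b1, b2 <- comul H l2) (om a1 l1 * om g1 (a2 * b1)) *: (g2 * (b * b2)))).
  apply: eq_tsum => h1 h2.
  under eq_tsum => a1 a2 do rewrite -(comulA_tsum (fun l1 b1 b2 =>
     (om a1 l1 * om g1 (a2 * b1)) *: (g2 * (h2 * b2)))).
  rewrite tsum_exchange; apply: eq_tsum => l1 l2.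
  have lS : linear (fun r : k^o => (r : k) *: (g2 * (h2 * l2))).
    by move=> r u v; rewrite scalerDl scalerA.
  rewrite (linear_tsum _ _ lS); apply: eq_tsum => a1 a2.
  by rewrite (linear_tsum _ _ lS).
transitivity (\tsum_(g1, g2 <- comul H g) \tsum_(h1, h2 <- comul H h)
   \tsum_(l1, l2 <- comul H l)
     (\tsum_(a1, a2 <- comul H g1) \tsum_(b1, b2 <- comul H h1)
        (om a1 b1 * om (a2 * b2) l1) : k) *: (g2 * (h2 * l2))).
  apply: eq_tsum => g1 g2; apply: eq_tsum => h1 h2; apply: eq_tsum => l1 l2.
  by congr (_ *: _); exact: cocy.
transitivity (\tsum_(g1, g2 <- comul H g) \tsum_(a1, a2 <- comul H g1)
   \tsum_(h1, h2 <- comul H h) \tsum_(b1, b2 <- comul H h1)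
   \tsum_(l1, l2 <- comul H l)
     ((om a1 b1 * om (a2 * b2) l1)) *: (g2 * (h2 * l2))).
  apply: eq_tsum => g1 g2; rewrite [RHS]tsum_exchange; apply: eq_tsum => h1 h2.
  under [RHS]eq_tsum => a1 a2 do rewrite tsum_exchange.
  rewrite [RHS]tsum_exchange; apply: eq_tsum => l1 l2.
  have lS : linear (fun r : k^o => (r : k) *: (g2 * (h2 * l2))).
    by move=> r u v; rewrite scalerDl scalerA.
  rewrite (linear_tsum _ _ lS); apply: eq_tsum => a1 a2.
  by rewrite (linear_tsum _ _ lS).
rewrite (comulA_tsum (fun a1 a2 b => \tsum_(h1, h2 <- comul H h)
   \tsum_(b1, b2 <- comul H h1) \tsum_(l1, l2 <- comul H l)
     ((om a1 b1 * om (a2 * b2) l1)) *: (b * (h2 * l2)))).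
apply: eq_tsum => g1 g2.
under eq_tsum => a1 a2 do rewrite (comulA_tsum (fun b1 b2 h2 =>
   \tsum_(l1, l2 <- comul H l) ((om g1 b1 * om (a1 * b2) l1)) *: (a2 * (h2 * l2)))).
rewrite tsum_exchange; apply: eq_tsum => h1 h2.
rewrite /twist_mul (comulM_tsum (F := fun p1 p2 => \tsum_(l1, l2 <- comul H l) om p1 l1 *: (p2 * l2))).
  rewrite -tsumZ; apply: eq_tsum => a1 a2; rewrite -tsumZ; apply: eq_tsum => b1 b2.
  by rewrite -tsumZ; apply: eq_tsum => l1 l2; rewrite scalerA mulrA.
by split=> [a|b]; apply: tsum_linear_r => l1 l2; [exact: (bF' l1 l2).1 | exact: (bF' l1 l2).2].
Qed.

Lemma twist_lmulM g h : (twist_lmul w g \o twist_lmul w h)%VF =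
  \tsum_(g1, g2 <- comul H g) \tsum_(h1, h2 <- comul H h)
    (w (g1 ⊗ h1) : k) *: twist_lmul w (g2 * h2).
Proof.
apply/lfunP=> l; rewrite comp_lfunE !twist_lmulE twist_mulA lfun_tsumE.
apply: eq_tsum => g1 g2; rewrite lfun_tsumE; apply: eq_tsum => h1 h2.
by rewrite scale_lfunE twist_lmulE.
Qed.

Section Inverse.
Variable w' : 'Hom(tens H H, k^o).
Hypotheses (ww' : form_inverse w w') (w'w : form_inverse w' w).

Let V (g p : H) : H := \tsum_(p1, p2 <- comul H p) (w' (g ⊗ p2) : k) *: p1.

(** By laziness h.l is also the sum of h_(1) l_(1) w(h_(2), l_(2)). To undo it, apply
    S(h), which removes h_(1), and then V, the inverse form. *)
Definition twist_linv_fun (h l : H) : H :=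
  \tsum_(h1, h2 <- comul H h) V h1 (antipode H h2 * l).

Let V_bilin : is_bilinear V.
Proof.
split=> [g|p]; first by move=> r u v; rewrite /V linearP tsum_linear.
apply: tsum_linear_r => p1 p2 r u v.
by rewrite (bilinDl (tpure_bilin _ _)) (bilinZl (tpure_bilin _ _)) linearP scalerDl scalerA.
Qed.

Let linv_bilin : is_bilinear twist_linv_fun.
Proof.
split=> [h|l]; last by move=> r u v; rewrite /twist_linv_fun linearP tsum_linear.
apply: tsum_linear_r => h1 h2.
exact: linear_comp (V_bilin.1 _) ((mul_bilin H).1 _).
Qed.

Lemma twist_linv_r h l : \tsum_(h1, h2 <- comul H h)
  twist_mul w h1 (twist_linv_fun h2 l) = (counit H h : k) *: l.
Proof.
pose K (g m : H) : H := g * m.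
have tE g m : twist_mul w g m = conv2 K (form2 H w) g m.
  by rewrite lw conv2_form2r.
transitivity (\tsum_(h1, h2 <- comul H h)
   conv2 (twist_mul w) (form2 H w') h1 (antipode H h2 * l)).
  transitivity (\tsum_(h1, h2 <- comul H h) \tsum_(b1, b2 <- comul H h2)
     \tsum_(m1, m2 <- comul H (antipode H b2 * l))
        (w' (b1 ⊗ m2) : k) *: twist_mul w h1 m1).
    apply: eq_tsum => h1 h2; rewrite (linear_tsum _ _ (twist_mul_bilin.1 h1)).
    apply: eq_tsum => b1 b2; rewrite (linear_tsum _ _ (twist_mul_bilin.1 h1)).
    by apply: eq_tsum => m1 m2; rewrite (bilinZr twist_mul_bilin).
  rewrite -(comulA_tsum (fun h1 b1 b2 => \tsum_(m1, m2 <- comul H (antipode H b2 * l))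
        (w' (b1 ⊗ m2) : k) *: twist_mul w h1 m1)).
  by apply: eq_tsum => h1 h2; rewrite conv2_form2r.
transitivity (\tsum_(h1, h2 <- comul H h) (h1 * antipode H h2) * l).
  apply: eq_tsum => h1 h2; rewrite (eq_conv2 _ _ tE (fun _ _ => erefl)) -conv2A.
  have bK : is_bilinear K by exact: mul_bilin.
  rewrite -[_ * _ * _]mulrA -[RHS](conv2_1r h1 (antipode H h2 * l) bK).
  by apply: eq_conv2 => // a b; exact: form2_inv.
by rewrite (antipoder_tsum _ ((mul_bilin H).2 l)) mul1r.
Qed.

Lemma twist_linv_l h l : \tsum_(h1, h2 <- comul H h)
  twist_linv_fun h1 (twist_mul w h2 l) = (counit H h : k) *: l.
Proof.
transitivity (\tsum_(h1, h2 <- comul H h) \tsum_(a1, a2 <- comul H h1)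
    \tsum_(b1, b2 <- comul H h2) \tsum_(l1, l2 <- comul H l)
       (w (b2 ⊗ l2) : k) *: V a1 (antipode H a2 * b1 * l1)).
  apply: eq_tsum => h1 h2; apply: eq_tsum => a1 a2.
  have lF : linear (fun m => V a1 (antipode H a2 * m)).
    exact: linear_comp (V_bilin.1 _) ((mul_bilin H).1 _).
  rewrite lw (linear_tsum _ _ lF); apply: eq_tsum => b1 b2.
  rewrite (linear_tsum _ _ lF); apply: eq_tsum => l1 l2.
  by rewrite -scalerAr (bilinZr V_bilin) mulrA.
rewrite (comul4_tsum (fun a1 a2 b1 b2 => \tsum_(l1, l2 <- comul H l)
       (w (b2 ⊗ l2) : k) *: V a1 (antipode H a2 * b1 * l1))).
transitivity (\tsum_(h1, h2 <- comul H h) \tsum_(l1, l2 <- comul H l)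
       (w (h2 ⊗ l2) : k) *: V h1 l1).
  apply: eq_tsum => h1 h2.
  have lG : linear (fun b => \tsum_(l1, l2 <- comul H l) (w (b ⊗ l2) : k) *: V h1 l1).
    by apply: tsum_linear_r => l1 l2 r u v; rewrite wb.2 scalerDl scalerA.
  rewrite -(counitl_tsum _ lG); apply: eq_tsum => b1 b2.
  rewrite tsum_exchange -tsumZ; apply: eq_tsum => l1 l2.
  have lF : linear (fun m => (w (b2 ⊗ l2) : k) *: V h1 (m * l1)).
    move=> r u v; rewrite mulrDl -scalerAl (bilinDr V_bilin) (bilinZr V_bilin).
    by rewrite scalerDr !scalerA mulrC.
  by rewrite (antipodel_tsum _ lF) mul1r.
transitivity (\tsum_(h1, h2 <- comul H h) \tsum_(l1, l2 <- comul H l)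
   \tsum_(b1, b2 <- comul H l2) ((w' (h1 ⊗ b1) : k) * w (h2 ⊗ b2)) *: l1).
  apply: eq_tsum => h1 h2.
  rewrite -(comulA_tsum (fun l1 b1 b2 => ((w' (h1 ⊗ b1) : k) * w (h2 ⊗ b2)) *: l1)).
  apply: eq_tsum => l1 l2; rewrite /V -tsumZ; apply: eq_tsum => m1 m2.
  by rewrite scalerA mulrC.
rewrite tsum_exchange -[in RHS](counitr l) -tsumZ; apply: eq_tsum => l1 l2.
have lS : linear (fun r : k^o => (r : k) *: l1).
  by move=> r u v; rewrite scalerDl scalerA.
rewrite scalerA -[_ * _](w'w h l2) (linear_tsum _ _ lS); apply: eq_tsum => h1 h2.
by rewrite (linear_tsum _ _ lS).
Qed.

Definition twist_linv : 'Hom(H, 'End(H)) := linfun (fun h => linfun (twist_linv_fun h)).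

Lemma twist_linvE h l : twist_linv h l = twist_linv_fun h l.
Proof.
rewrite /twist_linv linfun_lin ?(linfun_lin (linv_bilin.1 h)) //.
move=> r a b; apply/lfunP=> m.
rewrite add_lfunE scale_lfunE !(linfun_lin (linv_bilin.1 _)).
exact: linv_bilin.2.
Qed.

Lemma twist_conv_inv : is_conv_inv (twist_lmul w) twist_linv.
Proof.
move=> h; split; apply/lfunP=> l; rewrite lfun_tsumE scale_lfunE id_lfunE.
  rewrite -twist_linv_r; apply: eq_tsum => h1 h2.
  by rewrite comp_lfunE twist_lmulE twist_linvE.
rewrite -twist_linv_l; apply: eq_tsum => h1 h2.
by rewrite comp_lfunE twist_lmulE twist_linvE.
Qed.
End Inverse.

(** The choice made in the definition of A^omega is not vacuous: as omega is lazy,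
    twist_linv inverts left multiplication. *)
Lemma conv_invP : is_conv_inv (twist_lmul w) (conv_inv (twist_lmul w)).
Proof.
have [[w' ww] _ _] := cw.
have P : is_conv_inv (twist_lmul w) (twist_linv w').
  by apply: twist_conv_inv => g h; have [? ?] := ww g h.
exact: classical_sets.xgetPex (ex_intro _ _ P).
Qed.

Lemma End_is_alg (V : vectType k) : (0 < \dim {:V})%N -> is_alg (End_alg V).
Proof.
move=> V0; split=> /=.
- split=> f r g h; first by rewrite comp_lfunDr comp_lfunZr.
  by rewrite comp_lfunDl comp_lfunZl.
- exact: comp_lfunA.
- exact: comp_lfun1l.
- exact: comp_lfun1r.
- apply/eqP=> /lfunP id0; move: V0; rewrite lt0n dimv_eq0 => /eqP[]; apply/eqP.
  by rewrite -subv0; apply/subvP=> v _; rewrite memv0 -[v]id_lfunE id0 zero_lfunE.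
Qed.

Lemma A_omega_is_modAlg : is_modAlg (A_omega w).
Proof.
have inv := conv_invP; have [[w' ww] _ _] := cw.
apply: (strongly_inner_modAlg (w := w) (w' := w') (B := End_alg H)
  (End_is_alg (adim_gt0 {:H})) (u := twist_lmul w) (v := conv_inv (twist_lmul w))) => //.
- by move=> g h; have [] := ww g h.
- by move=> g h; have [] := ww g h.
- exact: twist_lmul_linear.
- exact: linearP.
- by apply/lfunP=> l; rewrite twist_lmulE twist_mul1 id_lfunE.
- by move=> h; have [] := inv h.
- by move=> h; have [] := inv h.
- exact: twist_lmulM.
Qed.

End TwistedRegular.

(** * Endomorphism algebras of modules *)

Section EndModules.
Variables (k : fieldType) (H : hopfAlg k).

(** The trivial cocycle, for which strongly inner actions are the actions on the
    endomorphisms of a module. *)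
Definition counit_form : 'Hom(tens H H, k^o) :=
  linfun (tsum (fun a b : H => (counit H a : k^o) * counit H b)).

Lemma counit_formE a b : counit_form (a ⊗ b) = counit H a * counit H b.
Proof.
rewrite (linfun_lin (tsum_linear _)) tsum_pure //.
split=> [u|v] r s t; rewrite linearP ?mulrDr ?mulrDl -?scalerAr -?scalerAl //.
Qed.

Lemma counit_form_suml (W : vectType k) (F : H -> H -> W) g h : is_bilinear F ->
  \tsum_(g1, g2 <- comul H g) \tsum_(h1, h2 <- comul H h)
    (counit_form (g1 ⊗ h1) : k) *: F g2 h2 = F g h.
Proof.
move=> bF; rewrite -[RHS](counitl_tsum _ (bF.2 h)); apply: eq_tsum => g1 g2.
rewrite -(counitl_tsum h (bF.1 g2)) -tsumZ; apply: eq_tsum => h1 h2.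
by rewrite counit_formE scalerA.
Qed.

Lemma counit_form_sumr (W : vectType k) (F : H -> H -> W) g h : is_bilinear F ->
  \tsum_(g1, g2 <- comul H g) \tsum_(h1, h2 <- comul H h)
    (counit_form (g2 ⊗ h2) : k) *: F g1 h1 = F g h.
Proof.
move=> bF; rewrite -[RHS](counitr_tsum _ (bF.2 h)); apply: eq_tsum => g1 g2.
rewrite -(counitr_tsum h (bF.1 g1)) -tsumZ; apply: eq_tsum => h1 h2.
by rewrite counit_formE scalerA.
Qed.

Lemma hact_linear (P : hmodule H) : linear (fun h => linfun (@hact _ _ P h)).
Proof.
have bP := hact_bilin P; move=> r a b; apply/lfunP=> p.
by rewrite add_lfunE scale_lfunE !(linfun_lin (bP.1 _)) bP.2.
Qed.

Lemma End_modAlg_is_modAlg (P : hmodule H) :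
  (0 < \dim {:P})%N -> is_modAlg (End_modAlg P).
Proof.
move=> P0; have bP := hact_bilin P.
have actE h (p : P) : linfun (@hact _ _ P h) p = @hact _ _ P h p.
  exact: linfun_lin (bP.1 h) p.
have lu := hact_linear P.
have uM g h : (linfun (@hact _ _ P g) \o linfun (@hact _ _ P h))%VF = linfun (@hact _ _ P (g * h)).
  by apply/lfunP=> p; rewrite comp_lfunE !actE hactA.
have u1 : linfun (@hact _ _ P 1) = \1%VF by apply/lfunP=> p; rewrite actE hact1 id_lfunE.
have conv : form_inverse counit_form counit_form.
  move=> g h; pose eg : H -> k^o := counit H; have le : linear eg by exact: linearP.
  transitivity (\tsum_(g1, g2 <- comul H g) (counit H g1 : k) *: (eg g2 * eg h)).
    apply: eq_tsum => g1 g2; rewrite -[eg h](counitl_tsum h le).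
    have lm r : linear (fun s : k^o => r * s).
      by move=> a s t; rewrite mulrDr -scalerAr.
    rewrite (linear_tsum _ _ (lm (eg g2))) -tsumZ; apply: eq_tsum => h1 h2.
    by rewrite !counit_formE /eg /GRing.scale /= mulrACA -!mulrA.
  apply: (counitl_tsum g (F := fun g => eg g * eg h)) => r a b.
  by rewrite le mulrDl -scalerAl.
apply: (strongly_inner_modAlg (w := counit_form) (w' := counit_form)
  (B := End_alg P) (End_is_alg P0) (u := fun h => linfun (@hact _ _ P h))
  (v := fun h => linfun (@hact _ _ P (antipode H h)))) => //.
- move=> g h; rewrite (counit_form_sumr _ _ (mul_bilin H)).
  exact: (counit_form_suml _ _ (mul_bilin H)).
- exact: linear_comp lu (fun r a b => linearP _ _ _ _).
- move=> h.
  transitivity (\tsum_(h1, h2 <- comul H h) linfun (@hact _ _ P (h1 * antipode H h2))).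
    by apply: eq_tsum => h1 h2; exact: uM.
  by rewrite (antipoder_tsum _ lu) u1.
- move=> h.
  transitivity (\tsum_(h1, h2 <- comul H h) linfun (@hact _ _ P (antipode H h1 * h2))).
    by apply: eq_tsum => h1 h2; exact: uM.
  by rewrite (antipodel_tsum _ lu) u1.
- move=> g h; rewrite (counit_form_suml (F := fun g h => linfun (@hact _ _ P (g * h)))).
    exact: uM.
  by split=> [a|b]; [exact: linear_comp lu ((mul_bilin H).1 _)
                   | exact: linear_comp lu ((mul_bilin H).2 _)].
Qed.
End EndModules.

(** * Actions by inner skew derivations *)

Section InnerActions.
Variables (k : fieldType) (n : nat) (E : hopfAlg k) (c : E) (x : 'I_n -> E).
Hypothesis hk : 2%N \notin [pchar k].
Hypothesis hE : is_En c x.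

(** The skew derivations a |-> y_i (c.a) - a y_i for odd y_i match the coproduct
    of x_i. *)
Definition inner_by (A : modAlg E) (y : 'I_n -> A) := forall i (a : A),
  act (x i) a = alg_mul (y i) (act c a) - alg_mul a (y i).

Lemma inner_by0 (A : modAlg E) : is_modAlg A -> (forall i (a : A), act (x i) a = 0) ->
  @inner_by A (fun=> 0).
Proof.
move=> hA xa i a; have mA := is_alg_bilin (is_modAlg_alg hA).
by rewrite xa (bilin0l mA) (bilin0r mA) subr0.
Qed.

(** The signs from moving y_i past b and y'_i past c.a turn b into c.b and c.a
    into a, as the coproduct of x_i requires. *)
Lemma smash_inner_by (A B : modAlg E) (y : 'I_n -> A) (y' : 'I_n -> B) :
  is_modAlg A -> is_modAlg B -> (forall i, homog c true (y i)) ->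
  (forall i, homog c true (y' i)) -> inner_by y -> inner_by y' ->
  @inner_by (smash (R0 c) A B) (fun i => y i ⊗ alg_one B + alg_one A ⊗ y' i).
Proof.
move=> hA hB oy oy' iy iy' i.
have isA := is_modAlg_alg hA; have isB := is_modAlg_alg hB.
have o1 := homog1 hE hA; have o1' := homog1 hE hB.
have tb := tpure_bilin A B; have mS := smash_mul_bilin c A B.
have bS := smash_act_bilin c A B.
elim/(smash_ind hk hE hA hB) => [r s t es et|e e' a b ha hb].
  rewrite !(bilinDr bS, bilinZr bS) es et.
  set Y := y i ⊗ _ + _; clearbody Y; clear es et.
  rewrite (bilinDr mS) (bilinDl mS) (bilinZr mS) (bilinZl mS) scalerBr opprD.
  by rewrite addrACA.
rewrite (smash_x hE hA hB) (smash_c hE hA hB) (bilinDl mS) (bilinDr mS).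
rewrite (smashM_homog hk hA hB _ _ o1' (homog_c hA ha)) scale1r.
rewrite (smashM_homog hk hA hB _ _ (oy' i) (homog_c hA ha)).
rewrite (smashM_homog hk hA hB _ _ hb (oy i)).
rewrite (smashM_homog hk hA hB _ _ hb o1) andbF scale1r andbT andTb.
rewrite !is_alg1l // !is_alg1r // iy iy' (bilinBl tb) (bilinBr tb).
have -> (t : B) : (-1) ^+ e *: (act c a ⊗ t) = a ⊗ t.
  by rewrite ha (bilinZl tb) scalerA -signr_addb addbb scale1r.
rewrite -(bilinZr tb) -hb addrC opprD !addrA; congr (_ - _).
by rewrite addrAC.
Qed.

(** Both sides are skew derivations, so that generators suffice; on an odd
    generator the inner skew derivation is minus an anticommutator. *)
Lemma generated_inner_by (I : Type) (A : falgType k) (aA : E -> A -> A) (g : I -> A)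
    (y : 'I_n -> A) : is_modAlg (modAlg_of aA) -> generates g ->
  (forall i, aA c (g i) = - g i) ->
  (forall i j, aA (x i) (g j) = - (y i * g j + g j * y i)) ->
  @inner_by (modAlg_of aA) y.
Proof.
move=> hA gen sg xg i; have bA := is_modAlg_bilin hA : is_bilinear aA.
have c1 : aA c 1 = 1 by have := homog1 hE hA; rewrite /homog scale1r.
apply: gen => /= [|r u v eu ev|j u eu].
- rewrite c1 mulr1 mul1r subrr; have := is_modAlg_act1 hA (x i).
  by rewrite (En_counitx hE) scale0r.
- rewrite !(bilinDr bA) !(bilinZr bA) eu ev mulrDr mulrDl -scalerAl -scalerAr.
  by rewrite scalerBr opprD addrACA.
- have := @act_xM _ _ _ _ _ hE (modAlg_of aA) i (g j) u hA => /= ->.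
  have := @act_cM _ _ _ _ _ hE (modAlg_of aA) (g j) u hA => /= ->.
  rewrite eu xg sg mulrBr !mulNr mulrN mulrDl !mulrA opprD.
  rewrite !addrA [LHS](ACl (1*4*3*2)) /= subrr add0r.
  by [].
Qed.

End InnerActions.

Section ParityModules.
Variables (k : fieldType) (n : nat) (E : hopfAlg k) (c : E) (x : 'I_n -> E).
Hypothesis hk : 2%N \notin [pchar k].
Hypothesis hE : is_En c x.

(** The universal property of E gives the character chi with chi(c) = -1 and
    chi(x_i) = 0; let E act on the even part by the counit and on the odd part by
    chi. *)
Lemma parity_module (V : vectType k) (s : 'End(V)) : (s \o s = \1)%VF ->
  exists a : E -> V -> V, [/\ is_bilinear a, forall m, a 1 m = m,
    forall g h m, a (g * h) m = a g (a h m), forall m, a c m = s m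
    & forall i m, a (x i) m = 0].
Proof.
move=> ss; have h2 := two_neq0 hk.
have [_ univ] := En_presented hE.
have [|chi [chig _]] := univ k^o (oapp (fun=> 0) (-1)).
  by split=> [|i|i j|i] /=; rewrite ?mulr0 ?mul0r ?addr0 ?sqrrN ?expr1n // expr0n.
have chic : chi c = -1 by exact: (chig None).
have chix i : chi (x i) = 0 by exact: (chig (Some i)).
have sK m : s (s m) = m by have /lfunP/(_ m) := ss; rewrite comp_lfunE id_lfunE.
pose p m := m + s m; pose q m := m - s m.
have lp r m m' : p (r *: m + m') = r *: p m + p m'.
  by rewrite /p linearP scalerDr addrACA.
have lq r m m' : q (r *: m + m') = r *: q m + q m'.
  by rewrite /q linearP scalerBr opprD addrACA.
have pp m : p (p m) = 2 *: p m.
  by rewrite {1}/p linearD /= sK [s m + m]addrC -mulr2n -scaler_nat.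
have qq m : q (q m) = 2 *: q m.
  by rewrite {1}/q linearB /= sK -[s m - m]opprB opprK -mulr2n -scaler_nat.
have pq m : p (q m) = 0.
  by rewrite {1}/p linearB /= sK -[s m - m]opprB subrr.
have qp m : q (p m) = 0.
  by rewrite {1}/q linearD /= sK [s m + m]addrC subrr.
have pql m : p m + q m = 2 *: m.
  by rewrite /p /q addrACA subrr addr0 -mulr2n -scaler_nat.
have lp0 r m : p (r *: m) = r *: p m by rewrite /p linearZ scalerDr.
have lq0 r m : q (r *: m) = r *: q m by rewrite /q linearZ scalerBr.
have pqs m : p m - q m = 2 *: s m.
  by rewrite /p /q opprB addrC addrA subrK -mulr2n -scaler_nat.
have pD u u' : p (u + u') = p u + p u' by rewrite -[u]scale1r lp !scale1r.
have qD u u' : q (u + u') = q u + q u' by rewrite -[u]scale1r lq !scale1r.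
clearbody p q.
pose a (h : E) (m : V) := (2^-1 * (counit E h : k)) *: p m
  + (2^-1 * (chi h : k)) *: q m.
exists a; split=> [|m|g h m|m|i m]; rewrite /a.
- split=> [h|m] r u v.
    rewrite lp lq !scalerDr !scalerA addrACA.
    by congr (_ *: _ + _ *: _ + _); ring.
  have -> : counit E (r *: u + v) = r * counit E u + counit E v by rewrite linearP.
  have -> : chi (r *: u + v) = r * chi u + chi v by rewrite linearP.
  rewrite !mulrDr !scalerDl addrACA scalerDr !scalerA.
  by congr (_ *: _ + _ *: _ + _); rewrite mulrCA.
- by rewrite counit1 rmorph1 mulr1 -scalerDr pql scalerA mulVf // scale1r.
- rewrite counitM rmorphM /= pD qD !lp0 !lq0 pp qq pq qp !scaler0 addr0 add0r !scalerA.
  by congr (_ *: _ + _ *: _); field.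
- rewrite (En_counitc hE) chic mulr1 mulrN1 scaleNr -scalerBr pqs.
  by rewrite scalerA mulVf // scale1r.
- by rewrite (En_counitx hE) chix mulr0 !scale0r addr0.
Qed.
End ParityModules.

(** * The algebra A^omega *)

Section Aomega.
Variables (k : fieldType) (n : nat) (E : hopfAlg k) (c : E) (x : 'I_n -> E).
Hypothesis hk : 2%N \notin [pchar k].
Hypothesis hE : is_En c x.
Variables (M : 'M[k]_n) (w : 'Hom(tens E E, k^o)).
Hypothesis hw : is_special_cocycle c x M w.
Let cw : is_cocycle w. Proof. by case: hw. Qed.
Let lw : is_lazy w. Proof. by case: hw. Qed.

(** The left multiplications by c and x_i in the twisted algebra. They satisfy
    Clifford relations; clif_y is the skew version of clif_x that implements the
    action of x_i. *)
Definition clif_c : 'End(E) := twist_lmul w c.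
Definition clif_x i : 'End(E) := twist_lmul w (x i).
Definition clif_y i : 'End(E) := (clif_x i \o clif_c)%VF.

Let q_bilin_l (h1 h2 : E) :
  is_bilinear (fun g1 g2 : E => (w (g1 ⊗ h1) : k) *: twist_lmul w (g2 * h2)).
Proof.
have lt := twist_lmul_linear w.
split=> [g|g] r u v.
  by rewrite mulrDl -scalerAl lt scalerDr !scalerA mulrC.
by rewrite (bilinDl (tpure_bilin _ _)) (bilinZl (tpure_bilin _ _)) linearP scalerDl scalerA.
Qed.

Let q_bilin_r (g1 g2 : E) :
  is_bilinear (fun h1 h2 : E => (w (g1 ⊗ h1) : k) *: twist_lmul w (g2 * h2)).
Proof.
have lt := twist_lmul_linear w.
split=> [g|g] r u v.
  by rewrite mulrDr -scalerAr lt scalerDr !scalerA mulrC.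
by rewrite (bilinDr (tpure_bilin _ _)) (bilinZr (tpure_bilin _ _)) linearP scalerDl scalerA.
Qed.

Let Q_bilin h : is_bilinear (fun g1 g2 : E => \tsum_(h1, h2 <- comul E h)
  (w (g1 ⊗ h1) : k) *: twist_lmul w (g2 * h2)).
Proof.
by split=> [g|g]; apply: tsum_linear_r => h1 h2; [exact: (q_bilin_l h1 h2).1
  | exact: (q_bilin_l h1 h2).2].
Qed.

Let w1r h : w (h ⊗ 1) = counit E h. Proof. by have [_ w1 _] := cw; case: (w1 h). Qed.
Let w1l h : w (1 ⊗ h) = counit E h. Proof. by have [_ w1 _] := cw; case: (w1 h). Qed.

Lemma twist_lmul1 : twist_lmul w 1 = \1%VF.
Proof. by apply/lfunP=> l; rewrite twist_lmulE twist_mul1 // id_lfunE. Qed.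

Lemma clif_cc : (clif_c \o clif_c = \1)%VF.
Proof.
have [_ _ wcc _ _] := hw.
rewrite /clif_c (twist_lmulM cw) (tsum_comulc hE (Q_bilin c)).
rewrite (tsum_comulc hE (q_bilin_r c c)) wcc scale1r (E_cc hE).
exact: twist_lmul1.
Qed.

Lemma clif_cx i : (clif_c \o clif_x i)%VF = twist_lmul w (c * x i).
Proof.
have [_ _ wcc wcx _] := hw.
rewrite /clif_c (twist_lmulM cw) (tsum_comulc hE (Q_bilin _)).
rewrite (tsum_comulx hE _ (q_bilin_r c c)) w1r (En_counitc hE) scale1r.
by rewrite (wcx i).1 scale0r addr0.
Qed.

Lemma clif_xc i : (clif_x i \o clif_c)%VF = twist_lmul w (x i * c).
Proof.
have [_ _ wcc wcx _] := hw.
rewrite /clif_c (twist_lmulM cw) (tsum_comulx hE _ (Q_bilin _)).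
rewrite !(tsum_comulc hE (q_bilin_r _ _)) w1l (En_counitc hE).
by rewrite (wcx i).2 scale0r addr0 scale1r.
Qed.

Lemma clif_cxN i : (clif_c \o clif_x i = - (clif_x i \o clif_c))%VF.
Proof.
rewrite clif_cx clif_xc (E_cx hE).
exact: (linearN (lin_of (twist_lmul_linear w))).
Qed.

(** Of the four terms of the twisted product x_i . x_j only the ordinary product
    and the term w(x_i, x_j) c c remain. *)
Lemma clif_xx i j : (clif_x i \o clif_x j)%VF =
  twist_lmul w (x i * x j) - M i j *: \1%VF.
Proof.
have [_ _ wcc wcx wxx] := hw.
rewrite /clif_x (twist_lmulM cw) (tsum_comulx hE _ (Q_bilin _)).
rewrite !(tsum_comulx hE _ (q_bilin_r _ _)) !w1l w1r counit1 !(En_counitx hE) wxx.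
rewrite scale1r !scale0r addr0 add0r (E_cc hE) scaleNr.
by rewrite twist_lmul1.
Qed.

Lemma clif_xxD i j : (clif_x i \o clif_x j)%VF + (clif_x j \o clif_x i)%VF
  = - (M i j + M j i) *: \1%VF.
Proof.
have [[/= _ _ xx _] _] := En_presented hE.
rewrite !clif_xx addrACA.
have -> : twist_lmul w (x i * x j) + twist_lmul w (x j * x i) = 0.
  rewrite -[LHS](linearD (lin_of (twist_lmul_linear w))) xx.
  exact: (linear0 (lin_of (twist_lmul_linear w))).
by rewrite add0r scaleNr scalerDl opprD.
Qed.

Lemma clif_yyD i j : (clif_y i \o clif_y j)%VF + (clif_y j \o clif_y i)%VF
  = (M i j + M j i) *: \1%VF.
Proof.
have yy a b : (clif_y a \o clif_y b = - (clif_x a \o clif_x b))%VF.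
  rewrite /clif_y -comp_lfunA [(clif_c \o (_ \o _))%VF]comp_lfunA clif_cxN.
  by rewrite comp_lfunNl -comp_lfunA clif_cc comp_lfun1r comp_lfunNr.
by rewrite !yy -opprD clif_xxD scaleNr opprK.
Qed.

Let inv := conv_invP cw lw.
Let v := conv_inv (twist_lmul w).
Let uv_bilin : is_bilinear (fun h1 h2 => (twist_lmul w h1 \o v h2)%VF).
Proof.
have lt := twist_lmul_linear w.
split=> [a|a] r b d; first by rewrite linearP comp_lfunDr comp_lfunZr.
by rewrite lt comp_lfunDl comp_lfunZl.
Qed.

Lemma conv_inv_c : v c = clif_c.
Proof.
have [e _] := inv c; rewrite (tsum_comulc hE uv_bilin) (En_counitc hE) scale1r in e.
by rewrite -[v c]comp_lfun1l -clif_cc -comp_lfunA e comp_lfun1r.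
Qed.

Lemma conv_inv_x i : v (x i) = - (clif_x i \o clif_c)%VF.
Proof.
have [+ _] := inv (x i); rewrite (tsum_comulx hE _ uv_bilin) (En_counitx hE) scale0r.
rewrite twist_lmul1 comp_lfun1l conv_inv_c => /eqP; rewrite addr_eq0 => /eqP.
by [].
Qed.

Let ufv_bilin f : is_bilinear (fun h1 h2 => (twist_lmul w h1 \o f \o v h2)%VF).
Proof.
have lt := twist_lmul_linear w.
split=> [a|a] r b d; first by rewrite linearP comp_lfunDr comp_lfunZr.
by rewrite lt !comp_lfunDl !comp_lfunZl.
Qed.

Lemma A_omega_c (f : A_omega w) : act c f = (clif_c \o f \o clif_c)%VF :> 'End(E).
Proof. by rewrite [LHS](tsum_comulc hE (ufv_bilin f)) conv_inv_c. Qed.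

(** From the coproduct of x_i, x_i.f = f v(x_i) + X_i f v(c), where
    v(x_i) = - X_i U and v(c) = U. *)
Lemma A_omega_inner : inner_by c x (A := A_omega w) clif_y.
Proof.
move=> i f; rewrite [LHS](tsum_comulx hE _ (ufv_bilin f)) conv_inv_c conv_inv_x.
rewrite twist_lmul1 comp_lfun1l comp_lfunNr addrC; congr (_ - _).
rewrite [act _ _]A_omega_c /= /clif_y -/(clif_x i).
by rewrite !comp_lfunA -[((clif_x i \o clif_c) \o clif_c)%VF]comp_lfunA clif_cc comp_lfun1r.
Qed.

Lemma clif_y_odd i : homog c (A := A_omega w) true (clif_y i).
Proof.
rewrite /homog [act _ _]A_omega_c expr1 scaleN1r /clif_y -!comp_lfunA clif_cc.
by rewrite comp_lfun1r clif_cxN.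
Qed.

End Aomega.

(** * Diagonalization of symmetric matrices *)

Section Diagonalization.
Variable k : fieldType.
Hypothesis h2 : (2 : k) != 0.

Lemma row_extend n (w : 'rV[k]_n.+1) : w != 0 ->
  exists2 h : 'M[k]_n.+1, h \in unitmx & exists a, w = a *: row 0 h.
Proof.
move=> w0; exists (row_ebase w); first exact: row_ebase_unit.
exists (col_ebase w 0 0); rewrite -{1}(mulmx_ebase w) [col_ebase w]mx11_scalar.
rewrite mul_scalar_mx -scalemxAl !mxE; congr (_ *: _).
have -> : \rank w = 1%N by rewrite rank_rV w0.
apply/rowP=> j; rewrite !mxE (bigD1 0) //= big1 ?addr0 => [|i i0]; rewrite !mxE //=.
  by rewrite mul1r.
by move: i0; rewrite -val_eqE /= eq_sym => /negPf->; rewrite mul0r.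
Qed.

(** Polarization: if the diagonal vanishes and L_ij does not, the vector
    e_i + e_j has square 2 L_ij. *)
Lemma exists_anisotropic n (L : 'M[k]_n) : L^T = L -> L != 0 ->
  exists w : 'rV[k]_n, (w *m L *m w^T) 0 0 != 0.
Proof.
move=> Ls L0; pose e i : 'rV[k]_n := delta_mx 0 i.
have Lij i j : (e i *m L *m (e j)^T) 0 0 = L i j.
  rewrite -rowE !mxE (bigD1 j) //= big1 ?addr0 => [|l lj]; rewrite !mxE.
    by rewrite !eqxx mulr1.
  by rewrite (negPf lj) andbF mulr0.
have [/existsP[i Lii]|/existsPn diag0] := boolP [exists i, L i i != 0].
  by exists (e i); rewrite Lij.
have d0 i : L i i = 0 by apply/eqP; have := diag0 i; rewrite negbK.
have [i [j nz]] : exists i j, L i j != 0.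
  apply: contrapT => all0; case/eqP: L0; apply/matrixP=> i j; rewrite [RHS]mxE.
  by apply/eqP/negPn/negP => nz; apply: all0; exists i, j.
exists (e i + e j); rewrite linearD /= !(mulmxDl, mulmxDr).
rewrite (_ : _ 0 0 = 2 * L i j) ?mulf_neq0 //.
have mxD (A B : 'M[k]_1) : (A + B) 0 0 = A 0 0 + B 0 0 by rewrite mxE.
have Lji : L j i = L i j by rewrite -[in LHS]Ls mxE.
by rewrite !mxD !Lij !d0 add0r addr0 Lji mulr_natl mulr2n.
Qed.

(** Split off an anisotropic vector, clear its row and column, and recurse on the
    complement. *)
Lemma symmetric_diag n (L : 'M[k]_n) : L^T = L ->
  exists2 g, g \in unitmx & forall i j, i != j -> (g *m L *m g^T) i j = 0.
Proof.
elim: n L => [|n IHn] L Ls; first by exists 1%:M; rewrite ?unitmx1 // => -[].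
have [->|L0] := eqVneq L 0.
  by exists 1%:M; rewrite ?unitmx1 // => i j _; rewrite mulmx0 mul0mx mxE.
have [w wLw] := exists_anisotropic Ls L0.
have w0 : w != 0 by apply: contraNneq wLw => ->; rewrite !mul0mx mxE.
have [h hu [r wh]] := row_extend w0.
pose M : 'M[k]_(1 + n) := h *m L *m h^T.
have Ms : M^T = M by rewrite /M !trmx_mul trmxK Ls mulmxA.
pose a := M 0 0; have a0 : a != 0.
  apply: contraNneq wLw => a0; rewrite wh -!scalemxAl linearZ /= -scalemxAr.
  have -> : row 0 h *m L *m (row 0 h)^T = row 0 (h *m L) *m (row 0 h)^T by rewrite row_mul.
  rewrite tr_row -row_mul !mxE /a /M in a0 *.
  suff -> : \sum_j (h *m L) 0 j * col 0 h^T j 0 = (h *m L *m h^T) 0 0 by rewrite a0 !mulr0.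
  by rewrite mxE; apply: eq_bigr => j _; rewrite !mxE.
pose b : 'rV[k]_n := ursubmx M; pose D := drsubmx M.
have Mb : M = block_mx a%:M b b^T D.
  rewrite -{1}(submxK M) /b trmx_ursub Ms; congr block_mx.
  rewrite [LHS]mx11_scalar /a; congr (_%:M); rewrite [LHS]mxE [LHS]mxE.
  by congr (M _ _); apply: val_inj.
pose g1 : 'M[k]_(1 + n) := block_mx 1%:M 0 (- a^-1 *: b^T) 1%:M.
pose D' := D - a^-1 *: (b^T *m b).
have Ds : D^T = D by rewrite /D trmx_drsub Ms.
have [|g2 g2u g2d] := IHn D'.
  by rewrite /D' linearB /= linearZ /= trmx_mul trmxK Ds.
pose g3 : 'M[k]_(1 + n) := block_mx 1%:M 0 0 g2.
have g1M : g1 *m M *m g1^T = block_mx a%:M 0 0 D'.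
  rewrite Mb /g1 tr_block_mx !mulmx_block !trmx1 !trmx0 !mul1mx !mulmx1 !mul0mx !mulmx0.
  rewrite !addr0 linearZ /= trmxK -!scalemxAl -!scalemxAr !mul_mx_scalar !mul_scalar_mx.
  have e p q (v : 'M[k]_(p, q)) : - a^-1 *: (a *: v) + v = 0.
    by rewrite scalerA mulNr mulVf // scaleN1r addNr.
  by rewrite !e mul0mx scaler0 add0r scaleNr addrC.
have g1u : g1 \in unitmx by rewrite unitmxE det_lblock !det1 mulr1 unitr1.
have g3u : g3 \in unitmx by rewrite unitmxE det_ublock det1 mul1r -unitmxE.
exists (g3 *m g1 *m h).
  by rewrite !unitmx_mul hu !andbT g3u.
have -> : g3 *m g1 *m h *m L *m (g3 *m g1 *m h)^T = g3 *m (g1 *m M *m g1^T) *m g3^T.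
  by rewrite /M !trmx_mul !mulmxA.
rewrite g1M /g3 tr_block_mx !mulmx_block !trmx1 !trmx0 !mul0mx !mulmx0 !addr0 !add0r.
rewrite mul1mx mulmx1 !mul0mx.
suff diag_block (i j : 'I_(1 + n)) : i != j ->
    block_mx a%:M 0 0 (g2 *m D' *m g2^T) i j = 0 by exact: diag_block.
rewrite -(splitK i) -(splitK j); case: (split i) => i'; case: (split j) => j' /= ij.
- by rewrite !ord1 eqxx in ij.
- by rewrite block_mxEur mxE.
- by rewrite block_mxEdl mxE.
- by rewrite block_mxEdr g2d //; apply: contraNneq ij => ->.
Qed.
End Diagonalization.

(** * Rotation of supercommuting Clifford families *)

Section QuarterTurn.
Variable k : fieldType.
Hypothesis h2 : (2 : k) != 0.
Variables (Y : falgType k) (s : Y -> Y).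
Hypothesis sl : linear s.
Hypothesis sM : forall a b, s (a * b) = s a * s b.
Hypothesis s1 : s 1 = 1.
Let sD a b : s (a + b) = s a + s b. Proof. exact: (linearD (lin_of sl)). Qed.
Let sZ' r a : s (r *: a) = r *: s a. Proof. exact: (linearZ_LR (lin_of sl)). Qed.
Let s0 : s 0 = 0. Proof. exact: (linear0 (lin_of sl)). Qed.

(** In an orthogonal basis, e_i = d_i^-1 z_i Z_i is even with e_i^2 = -1, and
    1 + e_i is, up to scaling, the rotation by a quarter turn in the plane of z_i
    and Z_i: (1 + e_i) Z_i = Z_i + z_i = z_i (1 + e_i). It commutes with the other
    vectors, so that the product over i rotates all planes. *)
Lemma quarter_turn_orthogonal n (z Z : 'I_n -> Y) (d : 'I_n -> k) (r : seq 'I_n) :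
  (forall i, d i != 0) -> (forall i, s (z i) = - z i) -> (forall i, s (Z i) = - Z i) ->
  (forall i, z i * z i = (d i)%:A) -> (forall i, Z i * Z i = (d i)%:A) ->
  (forall i j, i != j -> z i * z j = - (z j * z i)) ->
  (forall i j, i != j -> Z i * Z j = - (Z j * Z i)) ->
  (forall i j, z i * Z j = - (Z j * z i)) -> uniq r ->
  exists T T' : Y, [/\ T * T' = 1, T' * T = 1, s T = T,
    forall i, i \in r -> T * Z i = z i * T
    & forall i, i \notin r -> T * Z i = Z i * T /\ T * z i = z i * T].
Proof.
move=> d0 sz sZ zz ZZ zzN ZZN zZ; elim: r => [|i r IHr] /=.
  by exists 1, 1; rewrite !mulr1; split=> // i _; rewrite !mulr1 !mul1r.
case/andP=> nir /IHr[T [T' [TT' T'T sT Tin Tout]]].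
pose e := (d i)^-1 *: (z i * Z i); pose t := 1 + e; pose t' := 2^-1 *: (1 - e).
have ee : e * e = -1.
  rewrite /e -scalerAl -scalerAr -mulrA [Z i * (_ * _)]mulrA.
  have -> : Z i * z i = - (z i * Z i) by rewrite zZ opprK.
  rewrite mulNr -[z i * Z i * _]mulrA ZZ -scalerAr mulr1 mulrN -scalerAr zz.
  rewrite !scalerN !scalerA [X in X *: 1](_ : _ = 1) ?scale1r //.
  by field; exact: d0.
have tt' : t * t' = 1.
  rewrite /t /t' -scalerAr mulrBr mulr1 mulrDl mul1r ee.
  rewrite opprD opprK addrA addrK -mulr2n -scaler_nat scalerA mulVf //.
  by rewrite scale1r.
have t't : t' * t = 1.
  rewrite /t /t' -scalerAl mulrDr mulr1 mulrBl mul1r ee.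
  rewrite opprK addrA subrK -mulr2n -scaler_nat scalerA mulVf //.
  by rewrite scale1r.
have eZ : e * Z i = z i.
  by rewrite /e -scalerAl -mulrA ZZ -scalerAr mulr1 scalerA mulVf // scale1r.
have ze : z i * e = Z i.
  by rewrite /e -scalerAr mulrA zz -scalerAl mul1r scalerA mulVf // scale1r.
have se : s e = e by rewrite /e sZ' sM sz sZ mulrNN.
have comm a : z i * a = - (a * z i) -> Z i * a = - (a * Z i) -> t * a = a * t.
  move=> za Za; rewrite /t mulrDl mulrDr mul1r mulr1; congr (_ + _).
  by rewrite /e -scalerAl -scalerAr -mulrA Za mulrN mulrA za mulNr opprK mulrA.
have [TZ Tz] := Tout i nir.
have commz j : j != i -> t * z j = z j * t.
  by move=> ji; apply: comm; [apply: zzN; rewrite eq_sym | rewrite zZ opprK].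
have commZ j : j != i -> t * Z j = Z j * t.
  by move=> ji; apply: comm; [exact: zZ | apply: ZZN; rewrite eq_sym].
exists (t * T), (T' * t'); split.
- by rewrite mulrA -[t * T * T']mulrA TT' mulr1.
- by rewrite mulrA -[T' * t' * t]mulrA t't mulr1.
- by rewrite sM sT sD s1 se.
- move=> j; rewrite inE; case: eqVneq => [-> _|ji /= jr].
    rewrite -mulrA TZ !mulrA; congr (_ * _).
    by rewrite /t mulrDl mulrDr mul1r mulr1 eZ ze addrC.
  by rewrite -mulrA Tin // !mulrA commz.
- move=> j; rewrite inE negb_or => /andP[ji /Tout[TZj Tzj]].
  by rewrite -!mulrA TZj Tzj !mulrA commZ // commz.
Qed.

(** The relation T Z_i = z_i T is linear in the families, so that it may be proved
    after a change of basis that makes the form orthogonal. *)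
Lemma quarter_turn n (L : 'M[k]_n) (z Z : 'I_n -> Y) :
  L^T = L -> L \in unitmx ->
  (forall i, s (z i) = - z i) -> (forall i, s (Z i) = - Z i) ->
  (forall i j, z i * z j + z j * z i = (2 * L i j)%:A) ->
  (forall i j, Z i * Z j + Z j * Z i = (2 * L i j)%:A) ->
  (forall i j, z i * Z j + Z j * z i = 0) ->
  exists T T' : Y, [/\ T * T' = 1, T' * T = 1, s T = T
    & forall i, T * Z i = z i * T].
Proof.
move=> Ls Lu sz sZ zz ZZ zZ; have [g gu gd] := symmetric_diag h2 Ls.
pose G := g *m L *m g^T; pose d i := G i i.
have Gu : G \in unitmx by rewrite !unitmx_mul gu Lu unitmx_tr gu.
have GE i j : G i j = \sum_l \sum_m g i l * g j m * L l m.
  rewrite mxE exchange_big; apply: eq_bigr => m _; rewrite !mxE mulr_suml.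
  by apply: eq_bigr => l _; rewrite mulrAC.
have d0 i : d i != 0.
  apply/eqP=> di0; have := mulmxV Gu => /matrixP/(_ i i); rewrite !mxE eqxx.
  rewrite big1 => [/eqP|j _]; first by rewrite eq_sym oner_eq0.
  have [<-|ij] := eqVneq i j; first by rewrite -/(d i) di0 mul0r.
  by rewrite gd // mul0r.
pose tr (v : 'I_n -> Y) i := \sum_j g i j *: v j.
have tr_anti (v v' : 'I_n -> Y) (S : 'I_n -> 'I_n -> k) i j :
    (forall l m, v l * v' m + v' m * v l = (S l m)%:A) ->
    tr v i * tr v' j + tr v' j * tr v i = (\sum_l \sum_m g i l * g j m * S l m)%:A.
  move=> vv'; rewrite /tr mulr_suml mulr_sumr -big_split scaler_suml.
  apply: eq_bigr => l _ /=; rewrite mulr_suml mulr_sumr -big_split scaler_suml.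
  apply: eq_bigr => m _ /=; rewrite -!scalerAl -!scalerAr !scalerA [g j m * _]mulrC.
  by rewrite -scalerDr vv' scalerA.
have trG v i j : (forall l m, v l * v m + v m * v l = (2 * L l m)%:A) ->
    tr v i * tr v j + tr v j * tr v i = (2 * G i j)%:A.
  move=> /tr_anti->; rewrite GE mulr_sumr; congr (_ *: _); apply: eq_bigr => l _.
  by rewrite mulr_sumr; apply: eq_bigr => m _; rewrite mulrCA.
have tr_sq v i : (forall l m, v l * v m + v m * v l = (2 * L l m)%:A) ->
    tr v i * tr v i = (d i)%:A.
  move=> /(trG v i i)/(congr1 ( *:%R 2^-1)).
  by rewrite -mulr2n -scaler_nat !scalerA mulVf // mulrA mulVf // scale1r mul1r.
have tr_neq v i j : (forall l m, v l * v m + v m * v l = (2 * L l m)%:A) -> i != j ->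
    tr v i * tr v j = - (tr v j * tr v i).
  move=> vv ij; apply/eqP; rewrite -addr_eq0 trG // gd // mulr0 scale0r //.
have s_tr v i : (forall i, s (v i) = - v i) -> s (tr v i) = - tr v i.
  move=> sv; rewrite /tr -sumrN.
  elim/big_rec2: _ => // j a b _ IH.
  by rewrite sl IH sv scalerN.
have [|T [T' [TT' T'T sT Tin _]]] := @quarter_turn_orthogonal n (tr z) (tr Z) d
    (enum 'I_n) d0 (fun i => s_tr _ i sz) (fun i => s_tr _ i sZ) (fun i => tr_sq _ i zz)
    (fun i => tr_sq _ i ZZ) (fun i j => @tr_neq z i j zz) (fun i j => @tr_neq Z i j ZZ) _
    (enum_uniq _).
  move=> i j; apply/eqP; rewrite -addr_eq0 (tr_anti _ _ (fun _ _ => 0)).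
    by rewrite big1 ?scale0r // => l _; rewrite big1 // => m _; rewrite mulr0.
  by move=> l m; rewrite zZ scale0r.
exists T, T'; split=> // i.
have inv_tr v : v i = \sum_j invmx g i j *: tr v j.
  rewrite /tr; under eq_bigr => j _ do rewrite scaler_sumr.
  rewrite exchange_big (bigD1 i) //= [X in _ + X]big1 ?addr0 => [|l li].
    under eq_bigr => j _ do rewrite scalerA.
    by have /matrixP/(_ i i) := mulVmx gu; rewrite !mxE eqxx -scaler_suml => ->; rewrite scale1r.
  under eq_bigr => j _ do rewrite scalerA.
  have /matrixP/(_ i l) := mulVmx gu; rewrite !mxE -scaler_suml => ->.
  by rewrite eq_sym (negPf li) scale0r.
rewrite (inv_tr Z) (inv_tr z) mulr_sumr mulr_suml; apply: eq_bigr => j _.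
by rewrite -scalerAr -scalerAl Tin // mem_enum.
Qed.
End QuarterTurn.

(** * Superalgebra morphisms out of smash products *)

Section SuperMorphisms.
Variables (k : fieldType) (n : nat) (E : hopfAlg k) (c : E) (x : 'I_n -> E).
Hypothesis hk : 2%N \notin [pchar k].
Hypothesis hE : is_En c x.
Let R := R0 c.

(** Morphisms of superalgebras: no compatibility with the x_i. *)
Record super_hom (A B : modAlg E) (f : A -> B) : Prop := SuperHom {
  super_lin : linear f;
  super1 : f (alg_one A) = alg_one B;
  superM : forall a b, f (alg_mul a b) = alg_mul (f a) (f b);
  super_c : forall a, f (act c a) = act c (f a) }.

Lemma super_homog (A B : modAlg E) (f : A -> B) e a :
  super_hom f -> homog c e a -> homog c e (f a).
Proof.
move=> hf ha; rewrite /homog -(super_c hf) ha.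
exact: (linearZ_LR (lin_of (super_lin hf))).
Qed.

(** A homogeneous element of parity e moves past a at the price of twc e. *)
Definition twc (A : modAlg E) (e : bool) (a : A) : A := if e then act c a else a.

Lemma twc_homog (A : modAlg E) e e' (a : A) : homog c e' a ->
  twc e a = (-1) ^+ (e && e') *: a.
Proof. by case: e => //= _; rewrite scale1r. Qed.

Lemma twc_lin (A : modAlg E) e : is_modAlg A -> linear (@twc A e).
Proof. by case: e => hA // r a b; exact: (is_modAlg_bilin hA).1. Qed.

(** That the images supercommute is all that is needed to combine phi and psi to a
    map on the smash product (lift2). *)
Definition supercomm (A B Y : modAlg E) (phi : A -> Y) (psi : B -> Y) :=
  forall e b a, homog c e b ->
    alg_mul (psi b) (phi a) = alg_mul (phi (twc e a)) (psi b).

Lemma generated_supercomm (I : Type) (A : falgType k) (aA : E -> A -> A)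
    (g : I -> A) (Y : modAlg E) (phi : A -> Y) (y : Y) (e : bool) :
  is_modAlg (modAlg_of aA) -> is_modAlg Y -> @super_hom (modAlg_of aA) Y phi ->
  generates g -> (forall i, aA c (g i) = - g i) ->
  (forall i, alg_mul y (phi (g i)) = (-1) ^+ e *: alg_mul (phi (g i)) y) ->
  forall a, alg_mul y (phi a) = alg_mul (phi (@twc (modAlg_of aA) e a)) y.
Proof.
move=> hA hY hphi gen sg yg.
have isY := is_modAlg_alg hY; have mY := is_alg_bilin isY.
have lp := super_lin hphi.
apply: gen => [|r u v eu ev|i u eu].
- have -> : @twc (modAlg_of aA) e 1 = 1.
    by rewrite (twc_homog _ (homog1 hE hA)) andbF scale1r.
  by rewrite (super1 hphi) is_alg1l // is_alg1r.
- by rewrite (twc_lin e hA) !lp !(bilinDr mY, bilinDl mY, bilinZr mY, bilinZl mY) eu ev.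
- have -> : @twc (modAlg_of aA) e (g i * u)
      = (-1) ^+ e *: (g i * @twc (modAlg_of aA) e u).
    case: e {yg eu}; rewrite /twc ?expr0 ?scale1r //.
    rewrite [LHS](act_cM hE (A := modAlg_of aA)) //= sg expr1 scaleN1r.
    by rewrite mulNr.
  have -> : phi (g i * u) = alg_mul (phi (g i)) (phi u) by exact: (superM hphi).
  rewrite [phi (_ *: _)](linearZ_LR (lin_of lp)) /=.
  rewrite [phi (g i * _)](superM hphi) (is_algA isY) yg !(bilinZl mY).
  by rewrite -!(is_algA isY) eu.
Qed.

Section Lift.
Variables (A B Y : modAlg E) (phi : A -> Y) (psi : B -> Y).
Hypotheses (hA : is_modAlg A) (hB : is_modAlg B) (hY : is_modAlg Y).
Hypotheses (hphi : super_hom phi) (hpsi : super_hom psi).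
Hypothesis sc : supercomm phi psi.
Let mY := is_alg_bilin (is_modAlg_alg hY).
Let isY := is_modAlg_alg hY.
Let lphi := super_lin hphi.
Let lpsi := super_lin hpsi.

Definition lift2 (s : smash R A B) : Y := \tsum_(a, b <- s) alg_mul (phi a) (psi b).

Lemma lift2_pure a b : lift2 (a ⊗ b) = alg_mul (phi a) (psi b).
Proof. by rewrite /lift2 tsum_pure //; exact: bilin_comp mY lphi lpsi. Qed.

Lemma lift2_lin : linear lift2.
Proof. exact: tsum_linear. Qed.

Lemma lift2_super_hom : super_hom lift2.
Proof.
have mS := smash_mul_bilin c A B; have bS := smash_act_bilin c A B.
have bY := is_modAlg_bilin hY.
split; first exact: lift2_lin.
- by rewrite lift2_pure (super1 hphi) (super1 hpsi) is_alg1l.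
- move=> s t; elim/(smash_ind hk hE hA hB): s => [r s s' es es'|e1 e1' a a' ha ha'].
    by rewrite (bilinDl mS) (bilinZl mS) !lift2_lin (bilinDl mY) (bilinZl mY) es es'.
  elim/(smash_ind hk hE hA hB): t => [r s s' es es'|e2 e2' b b' hb hb'].
    by rewrite (bilinDr mS) (bilinZr mS) !lift2_lin (bilinDr mY) (bilinZr mY) es es'.
  rewrite (smashM_homog hk hA hB _ _ ha' hb) [lift2 (_ *: _)](linearZ_LR (lin_of lift2_lin)).
  rewrite [lin_of _ _]lift2_pure !lift2_pure (superM hphi) (superM hpsi).
  rewrite -[RHS](is_algA isY) [alg_mul (psi a') (alg_mul _ _)](is_algA isY) (sc _ ha') (twc_homog _ hb).
  rewrite [phi (_ *: _)](linearZ_LR (lin_of lphi)) /=.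
  by rewrite !(bilinZl mY) !(bilinZr mY) !(is_algA isY).
- elim/(smash_ind hk hE hA hB) => [r s s' es es'|e e' a b ha hb].
    by rewrite (bilinDr bS) (bilinZr bS) !lift2_lin (bilinDr bY) (bilinZr bY) es es'.
  by rewrite (smash_c hE hA hB) !lift2_pure (act_cM hE) // -(super_c hphi) -(super_c hpsi).
Qed.

Lemma lift2_supercomm (C : modAlg E) (chi : C -> Y) :
  supercomm phi chi -> supercomm psi chi -> supercomm lift2 chi.
Proof.
have hS := smash_is_modAlg hk hE hA hB.
move=> pc qc e y s hy; elim/(smash_ind hk hE hA hB): s => [r s s' es es'|e1 e1' a b ha hb].
  by rewrite (twc_lin e hS) !lift2_lin !(bilinDr mY, bilinDl mY, bilinZr mY, bilinZl mY) es es'.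
have -> : twc e (a ⊗ b : smash R A B) = twc e a ⊗ twc e b.
  by case: e {hy} => //; exact: (smash_c hE hA hB a b).
rewrite !lift2_pure (is_algA isY) (pc _ _ _ hy) -(is_algA isY) (qc _ _ _ hy).
by rewrite (is_algA isY).
Qed.
End Lift.

Lemma generated_super_hom (I : Type) (A B : falgType k) (aA : E -> A -> A)
    (aB : E -> B -> B) (g : I -> A) (f : {lrmorphism A -> B}) :
  is_modAlg (modAlg_of aA) -> is_modAlg (modAlg_of aB) -> generates g ->
  (forall i, aA c (g i) = - g i) -> (forall i, aB c (f (g i)) = - f (g i)) ->
  @super_hom (modAlg_of aA) (modAlg_of aB) f.
Proof.
move=> hA hB gen sg sfg; split=> /=.
- by move=> r a b; rewrite linearP.
- exact: rmorph1.
- exact: rmorphM.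
have bA := is_modAlg_bilin hA : is_bilinear aA.
have bB := is_modAlg_bilin hB : is_bilinear aB.
apply: gen => [|r a b ea eb|i a ea].
- have := homog1 hE hA; have := homog1 hE hB; rewrite /homog !scale1r /= => e1 ->.
  by rewrite rmorph1 e1.
- by rewrite (bilinDr bA) (bilinZr bA) !linearP /= (bilinDr bB) (bilinZr bB) ea eb.
- have -> : aA c (g i * a) = aA c (g i) * aA c a.
    exact: (act_cM hE (A := modAlg_of aA)).
  rewrite !rmorphM /= sg linearN /= ea -sfg.
  exact: esym (act_cM hE (A := modAlg_of aB) _ _ hB).
Qed.

Lemma C_lift alpha (L : 'M[k]_n) (A : falgType k) (aA : E -> A -> A)
    (u : A) (z : 'I_n -> A) (Y : modAlg E) (yu : Y) (yz : 'I_n -> Y) :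
  is_modAlg (modAlg_of aA) -> is_modAlg Y ->
  presented (@C_rels k n alpha L) (oapp z u) ->
  aA c u = - u -> (forall i, aA c (z i) = - z i) ->
  homog c true yu -> (forall i, homog c true (yz i)) ->
  alg_mul yu yu = alpha *: alg_one Y ->
  (forall i, alg_mul yu (yz i) + alg_mul (yz i) yu = 0) ->
  (forall i j, alg_mul (yz i) (yz j) + alg_mul (yz j) (yz i) = (2 * L i j) *: alg_one Y) ->
  exists phi : A -> Y, [/\ @super_hom (modAlg_of aA) Y phi, phi u = yu
    & forall i, phi (z i) = yz i].
Proof.
move=> hA hY pr su sz hu hz; have h2 := two_neq0 hk.
have [B [aB eY]] := modAlg_falg (is_modAlg_alg hY); subst Y => /= uu uz zz.
have [|f [fg _]] := pr.2 B (oapp yz yu).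
  split=> /=; [by rewrite expr2 | exact: uz | exact: zz | move=> i].
  apply: (scalerI h2); rewrite scalerA -zz -mulr2n -scaler_nat expr2.
  by [].
exists f; split; [| exact: (fg None) | by move=> i; exact: (fg (Some i))].
apply: (generated_super_hom hA hY (C_generates pr)) => [[]|i] //.
rewrite fg; case: i => [i|] /=; first by rewrite [LHS]hz expr1 scaleN1r.
by rewrite [LHS]hu expr1 scaleN1r.
Qed.

Lemma Ct_lift t (A : falgType k) (aA : E -> A -> A) (y : A) (Y : modAlg E) (yy : Y) :
  is_modAlg (modAlg_of aA) -> is_modAlg Y ->
  presented (fun (B : algType k) (b : unit -> B) => b tt ^+ 2 = t%:A) (fun=> y) ->
  aA c y = - y -> homog c true yy -> alg_mul yy yy = t *: alg_one Y ->
  exists phi : A -> Y, @super_hom (modAlg_of aA) Y phi /\ phi y = yy.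
Proof.
move=> hA hY pr sy hyy.
have [B [aB eY]] := modAlg_falg (is_modAlg_alg hY); subst Y => /= yyt.
have [|f [fg _]] := pr.2 B (fun=> yy); first by rewrite expr2.
exists f; split; last exact: fg tt.
apply: (generated_super_hom hA hY (Ct_generates pr)) => // i.
by rewrite (fg i) [LHS]hyy expr1 scaleN1r.
Qed.

(** Conjugation by the even unit T commutes with c, and the action of x_i is
    determined by c and the element implementing it. So the composite of f with
    this conjugation, which takes yX to yY, is compatible with the whole action.
    Surjectivity of f suffices, as f is injective on a super full algebra. *)
Lemma comparison (X Y : modAlg E) (f : X -> Y) (yX : 'I_n -> X) (yY : 'I_n -> Y)
    (T T' : Y) : is_modAlg X -> is_modAlg Y -> superfull c X -> super_hom f ->
  (forall y, exists a, f a = y) -> inner_by c x yX -> inner_by c x yY ->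
  alg_mul T T' = alg_one Y -> alg_mul T' T = alg_one Y -> act c T = T ->
  (forall i, alg_mul T (f (yX i)) = alg_mul (yY i) T) -> modAlg_isog X Y.
Proof.
move=> hX hY fullX hf fsurj iX.
have finj := superfull_inj hX hY fullX (super_lin hf) (super1 hf) (superM hf) (super_c hf).
have [B [aB eY]] := modAlg_falg (is_modAlg_alg hY); subst Y => /= iY TT' T'T cT Ty.
have lf := super_lin hf.
have bX := is_modAlg_bilin hX; have bB := is_modAlg_bilin hY : is_bilinear aB.
have cB a b : aB c (a * b) = aB c a * aB c b by exact: (act_cM hE (A := modAlg_of aB)).
have c1 : aB c 1 = 1 by have := homog1 hE hY; rewrite /homog scale1r.
have cT' : aB c T' = T'.
  by rewrite -[aB c T']mulr1 -TT' mulrA -{1}cT -cB T'T c1 mul1r.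
pose F (a : X) : B := T * f a * T'.
have TK (a : B) : T' * (T * a * T') * T = a.
  by rewrite -!mulrA T'T mulr1 mulrA T'T mul1r.
have TK' (a : B) : T * (T' * a * T) * T' = a.
  by rewrite -!mulrA TT' mulr1 mulrA TT' mul1r.
have Fb : bijective F.
  have ex y : exists a, F a = y.
    by have [a fa] := fsurj (T' * y * T); exists a; rewrite /F fa TK'.
  exists (fun y => projT1 (cid (ex y))) => [a|y]; last by case: cid.
  case: cid => b /= /(congr1 (fun y => T' * y * T)); rewrite /F !TK => fab.
  exact: finj.
have Fl : linear F.
  by move=> r a b; rewrite /F lf mulrDr mulrDl -scalerAr -scalerAl.
exists F; split.
  split=> //.
  - by rewrite /F (super1 hf) /= mulr1.
  - move=> a b; rewrite /F (superM hf) /=.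
    by rewrite !mulrA -[_ * T' * T]mulrA T'T mulr1.
have FM a b : F (alg_mul a b) = F a * F b.
  by rewrite /F (superM hf) /= !mulrA -[_ * T' * T]mulrA T'T mulr1.
apply: (E_generates hE) => [a|r u v eu ev a|[i|] u eu a] /=.
- by rewrite (is_modAlg_1act hX) [RHS](is_modAlg_1act hY).
- by rewrite (bilinDl bX) (bilinZl bX) Fl eu ev (bilinDl bB) (bilinZl bB).
- rewrite (is_modAlg_actA hX); transitivity (aB (x i) (aB u (F a))); last first.
    exact: esym (is_modAlg_actA hY _ _ _).
  rewrite -[aB u (F a)]eu; move: (act u a) => {}a; rewrite iX.
  have -> d e : F (d - e) = F d - F e by exact: (linearB (lin_of Fl)).
  have FY : F (yX i) = yY i by rewrite /F Ty -mulrA TT' mulr1.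
  rewrite !FM FY [RHS]iY /=; congr (_ * _ - _).
  by rewrite /F (super_c hf) !cB cT cT'.
- rewrite (is_modAlg_actA hX); transitivity (aB c (aB u (F a))); last first.
    exact: esym (is_modAlg_actA hY _ _ _).
  by rewrite -[aB u (F a)]eu /F (super_c hf) !cB cT cT'.
Qed.

End SuperMorphisms.

(** * Two by two matrices of operators *)

Section Pairs.
Variables (k : fieldType) (V : vectType k).

Definition mk22_fun (a b c d : 'End(V)) (p : (V * V)%type) : (V * V)%type :=
  (a p.1 + b p.2, c p.1 + d p.2).

Lemma mk22_lin a b c d : linear (mk22_fun a b c d).
Proof.
move=> r [p1 p2] [q1 q2]; rewrite /mk22_fun /= !linearP.
by congr (_, _); rewrite /= scalerDr addrACA.
Qed.

Definition mk22 (a b c d : 'End(V)) : 'End((V * V)%type) := linfun (mk22_fun a b c d).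

Lemma mk22E a b c d p : mk22 a b c d p = (a p.1 + b p.2, c p.1 + d p.2).
Proof. exact: (linfun_lin (mk22_lin a b c d)). Qed.

Lemma mk22M a b c d a' b' c' d' : (mk22 a b c d \o mk22 a' b' c' d')%VF =
  mk22 ((a \o a') + (b \o c'))%VF ((a \o b') + (b \o d'))%VF
       ((c \o a') + (d \o c'))%VF ((c \o b') + (d \o d'))%VF.
Proof.
apply/lfunP=> p; rewrite comp_lfunE !mk22E /= !add_lfunE !comp_lfunE !linearD.
by congr (_, _); rewrite addrACA.
Qed.

Lemma mk22P r a b c d a' b' c' d' : r *: mk22 a b c d + mk22 a' b' c' d' =
  mk22 (r *: a + a') (r *: b + b') (r *: c + c') (r *: d + d').
Proof.
apply/lfunP=> p; rewrite add_lfunE scale_lfunE !mk22E /= !add_lfunE !scale_lfunE.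
by congr (_, _); rewrite /= scalerDr addrACA.
Qed.

Lemma mk22D a b c d a' b' c' d' : mk22 a b c d + mk22 a' b' c' d' =
  mk22 (a + a') (b + b') (c + c') (d + d').
Proof. by rewrite -[mk22 a b c d]scale1r mk22P !scale1r. Qed.

Lemma mk22_0 : mk22 0 0 0 0 = 0.
Proof. by apply/lfunP=> p; rewrite mk22E !zero_lfunE addr0. Qed.

Lemma mk22Z r a b c d : r *: mk22 a b c d = mk22 (r *: a) (r *: b) (r *: c) (r *: d).
Proof. by rewrite -[LHS]addr0 -mk22_0 mk22P !addr0. Qed.

Lemma mk22_1 : mk22 \1 0 0 \1 = \1%VF.
Proof.
by apply/lfunP=> -[p1 p2]; rewrite mk22E !id_lfunE !zero_lfunE addr0 add0r.
Qed.

Lemma mk22_ex (F : 'End((V * V)%type)) : exists a b c d, F = mk22 a b c d.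
Proof.
have l1 : linear (fun v : V => (v, 0) : (V * V)%type).
  by move=> r u v; congr (_, _); rewrite /= scaler0 addr0.
have l2 : linear (fun v : V => (0, v) : (V * V)%type).
  by move=> r u v; congr (_, _); rewrite /= scaler0 addr0.
have lf (f : V -> (V * V)%type) : linear f -> linear (fun v => (F (f v)).1) /\
    linear (fun v => (F (f v)).2).
  by move=> lf; split=> r u v; rewrite lf linearP.
have [a1 a2] := lf _ l1; have [b1 b2] := lf _ l2.
exists (linfun (fun v : V => (F (v, 0)).1)), (linfun (fun v : V => (F (0, v)).1)),
  (linfun (fun v : V => (F (v, 0)).2)), (linfun (fun v : V => (F (0, v)).2)).
apply/lfunP=> -[p1 p2]; rewrite mk22E /= (linfun_lin a1) (linfun_lin a2).
rewrite (linfun_lin b1) (linfun_lin b2).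
have -> : (p1, p2) = (p1, 0) + (0, p2) :> (V * V)%type.
  by congr (_, _); rewrite /= ?addr0 ?add0r.
by rewrite [LHS]linearD /=; case: (F (p1, 0)) => ? ?; case: (F (0, p2)) => ? ?.
Qed.
End Pairs.

Lemma dim_gt0 (k : fieldType) (V : vectType k) (v : V) : v != 0 -> (0 < \dim {:V})%N.
Proof.
move=> v0; rewrite lt0n dimv_eq0; apply: contra v0 => /eqP V0.
by rewrite -memv0 -V0 memvf.
Qed.

(** * The factors of a smash product *)

Section SmashFactors.
Variables (k : fieldType) (n : nat) (E : hopfAlg k) (c : E) (x : 'I_n -> E).
Hypothesis hk : 2%N \notin [pchar k].
Hypothesis hE : is_En c x.
Variables (A B : modAlg E) (hA : is_modAlg A) (hB : is_modAlg B).
Let R := R0 c.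
Let AB := smash R A B.
Let isA := is_modAlg_alg hA.
Let isB := is_modAlg_alg hB.
Let mA := is_alg_bilin isA.
Let mB := is_alg_bilin isB.
Let tb := tpure_bilin A B.

Definition inl_smash (a : A) : AB := a ⊗ alg_one B.
Definition inr_smash (b : B) : AB := alg_one A ⊗ b.

Lemma inl_inr a b : alg_mul (inl_smash a) (inr_smash b) = (a ⊗ b : AB).
Proof.
rewrite (smashM_homog hk hA hB _ _ (homog1 hE hB) (homog1 hE hA)) scale1r.
by rewrite is_alg1r // is_alg1l.
Qed.

Lemma inr_inl e e' a b : homog c e a -> homog c e' b ->
  alg_mul (inr_smash b) (inl_smash a) = (-1) ^+ (e' && e) *: (a ⊗ b : AB).
Proof.
move=> ha hb; rewrite (smashM_homog hk hA hB _ _ hb ha).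
by rewrite is_alg1l // is_alg1r.
Qed.

Lemma inl_super_hom : @super_hom _ _ c A AB inl_smash.
Proof.
split.
- by move=> r u v; rewrite /inl_smash (bilinDl tb) (bilinZl tb).
- by [].
- have hind (P : A -> Prop) := @homog_ind _ _ _ _ _ hk hE A P hA.
  move=> a a'; elim/hind: a' => [u v eu ev|e a' ha'].
    rewrite /inl_smash in eu ev *.
    by rewrite (bilinDr mA) !(bilinDl tb) eu ev (bilinDr (smash_mul_bilin c A B)).
  by rewrite (smashM_homog hk hA hB _ _ (homog1 hE hB) ha') scale1r is_alg1l.
- by move=> a; rewrite /inl_smash (smash_c hE hA hB) (homog1 hE hB) scale1r.
Qed.

Lemma inr_super_hom : @super_hom _ _ c B AB inr_smash.
Proof.
split.
- by move=> r u v; rewrite /inr_smash (bilinDr tb) (bilinZr tb).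
- by [].
- have hind (P : B -> Prop) := @homog_ind _ _ _ _ _ hk hE B P hB.
  move=> b b'; elim/hind: b => [u v eu ev|e b hb].
    rewrite /inr_smash in eu ev *.
    by rewrite (bilinDl mB) !(bilinDr tb) eu ev (bilinDl (smash_mul_bilin c A B)).
  by rewrite (smashM_homog hk hA hB _ _ hb (homog1 hE hA)) andbF scale1r is_alg1l.
- by move=> b; rewrite /inr_smash (smash_c hE hA hB) (homog1 hE hA) scale1r.
Qed.

Lemma smash_x0 : (forall i (a : A), act (x i) a = 0) ->
  (forall i (b : B), act (x i) b = 0) -> forall i (s : AB), act (x i) s = 0.
Proof.
move=> xA xB i; have bS := smash_act_bilin c A B.
elim/(smash_ind hk hE hA hB) => [r s t es et|e e' a b _ _].
  by rewrite (bilinDr bS) (bilinZr bS) es et scaler0 addr0.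
by rewrite (smash_x hE hA hB) xA xB (bilin0l tb) (bilin0r tb) addr0.
Qed.

End SmashFactors.

Section GeneratedMaps.
Variables (k : fieldType) (n : nat) (E : hopfAlg k) (c : E) (x : 'I_n -> E).
Hypothesis hk : 2%N \notin [pchar k].
Hypothesis hE : is_En c x.

Lemma generated_supercomm2 (I J : Type) (A B : falgType k) (aA : E -> A -> A)
    (aB : E -> B -> B) (g : I -> A) (h : J -> B) (Y : modAlg E) (phi : A -> Y)
    (psi : B -> Y) :
  is_modAlg (modAlg_of aA) -> is_modAlg (modAlg_of aB) -> is_modAlg Y ->
  @super_hom _ _ c (modAlg_of aA) Y phi -> @super_hom _ _ c (modAlg_of aB) Y psi ->
  generates g -> generates h -> (forall i, aA c (g i) = - g i) ->
  (forall j, aB c (h j) = - h j) ->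
  (forall i j, alg_mul (phi (g i)) (psi (h j)) = - alg_mul (psi (h j)) (phi (g i))) ->
  @supercomm _ _ c (modAlg_of aA) (modAlg_of aB) Y phi psi.
Proof.
move=> hA hB hY hphi hpsi geng genh sg sh anti e b a hb.
have mY := is_alg_bilin (is_modAlg_alg hY).
apply: (generated_supercomm hE hA hY hphi geng sg) => i.
have := generated_supercomm hE (y := phi (g i)) (e := true) hB hY hpsi genh sh.
move=> /(_ _ b) -> => [|j]; last by rewrite anti expr1 scaleN1r.
rewrite (twc_homog _ hb) [psi (_ *: _)](linearZ_LR (lin_of (super_lin hpsi))) andTb.
by rewrite (bilinZl mY) scalerA -signr_addb addbb scale1r.
Qed.

Lemma x0_generated (I : Type) (A : falgType k) (aA : E -> A -> A) (g : I -> A) :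
  is_modAlg (modAlg_of aA) -> generates g -> (forall i, aA c (g i) = - g i) ->
  (forall i j, aA (x i) (g j) = 0) -> forall i (a : modAlg_of aA), act (x i) a = 0.
Proof.
move=> hA gen sg xg i a.
have := @generated_inner_by _ _ _ _ _ hE I A aA g (fun=> 0) hA gen sg.
move=> -> => [|i' j]; first by rewrite /= mul0r mulr0 subr0.
by rewrite xg mul0r mulr0 addr0 oppr0.
Qed.

Lemma quarter_turn_modAlg (L : 'M[k]_n) (Y : modAlg E) (z Z : 'I_n -> Y) :
  is_modAlg Y -> L^T = L -> L \in unitmx ->
  (forall i, homog c true (z i)) -> (forall i, homog c true (Z i)) ->
  (forall i j, alg_mul (z i) (z j) + alg_mul (z j) (z i) = (2 * L i j) *: alg_one Y) ->
  (forall i j, alg_mul (Z i) (Z j) + alg_mul (Z j) (Z i) = (2 * L i j) *: alg_one Y) ->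
  (forall i j, alg_mul (z i) (Z j) + alg_mul (Z j) (z i) = 0) ->
  exists T T' : Y, [/\ alg_mul T T' = alg_one Y, alg_mul T' T = alg_one Y, act c T = T
    & forall i, alg_mul T (Z i) = alg_mul (z i) T].
Proof.
move=> hY; have [B [aB eY]] := modAlg_falg (is_modAlg_alg hY); subst Y.
move=> Ls Lu hz hZ zz ZZ zZ.
apply: (@quarter_turn k (two_neq0 hk) B (aB c) _ _ _ n L z Z) => //.
- exact: (is_modAlg_bilin hY).1.
- by move=> a b; exact: (act_cM hE (A := modAlg_of aB)).
- by have := homog1 hE hY; rewrite /homog scale1r.
- by move=> i; have := hz i; rewrite /homog expr1 scaleN1r.
- by move=> i; have := hZ i; rewrite /homog expr1 scaleN1r.
Qed.

Lemma End_modAlg_bilin (P : hmodule E) (F : 'End(P)) :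
  is_bilinear (fun h1 h2 => (linfun (@hact _ _ P h1) \o F
    \o linfun (@hact _ _ P (antipode E h2)))%VF).
Proof.
have lu := hact_linear P; split=> [h|h] r a b; first by rewrite linearP lu comp_lfunDr comp_lfunZr.
by rewrite lu !comp_lfunDl !comp_lfunZl.
Qed.

Lemma End_modAlg_c (P : hmodule E) (s : 'End(P)) (F : End_modAlg P) :
  (forall p, hact c p = s p) -> act c F = (s \o F \o s)%VF :> 'End(P).
Proof.
move=> cs; rewrite [LHS](tsum_comulc hE (End_modAlg_bilin F)) (En_antipodec hE).
have -> // : linfun (@hact _ _ P c) = s.
by apply/lfunP=> p; rewrite (linfun_lin ((hact_bilin P).1 _)).
Qed.

Lemma End_modAlg_x (P : hmodule E) (F : End_modAlg P) i :
  (forall i (p : P), hact (x i) p = 0) -> act (x i) F = 0.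
Proof.
move=> xs; have bP := hact_bilin P.
rewrite [LHS](tsum_comulx hE _ (End_modAlg_bilin F)) (En_antipodex hE).
have -> : linfun (@hact _ _ P (x i)) = 0.
  by apply/lfunP=> p; rewrite (linfun_lin (bP.1 _)) zero_lfunE xs.
have -> : linfun (@hact _ _ P (c * x i)) = 0.
  apply/lfunP=> p; rewrite (linfun_lin (bP.1 _)) zero_lfunE hactA xs.
  exact: (bilin0r bP).
by rewrite comp_lfun0r !comp_lfun0l addr0.
Qed.

Lemma modAlg_isog_sym (X Y : modAlg E) : modAlg_isog X Y -> modAlg_isog Y X.
Proof.
case=> f [[lf bf f1 fM] fE]; have [g fK gK] := bf.
exists g; split; first split.
- move=> r u v; rewrite -{1}[u]gK -{1}[v]gK -lf fK //.
- by exists f.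
- by rewrite -f1 fK.
- by move=> a b; rewrite -{1}[a]gK -{1}[b]gK -fM fK.
- by move=> h a; rewrite -{1}[a]gK -fE fK.
Qed.

Lemma modAlg_isog_trans (X Y Z : modAlg E) :
  modAlg_isog X Y -> modAlg_isog Y Z -> modAlg_isog X Z.
Proof.
case=> f [[lf bf f1 fM] fE] [g [[lg bg g1 gM] gE]].
exists (g \o f); split; first split.
- by move=> r u v; rewrite /= lf lg.
- exact: bij_comp.
- by rewrite /= f1 g1.
- by move=> a b; rewrite /= fM gM.
- by move=> h a; rewrite /= fE gE.
Qed.

Lemma lift2_inl (A B Y : modAlg E) (phi : A -> Y) (psi : B -> Y) a :
  is_modAlg Y -> super_hom c phi -> super_hom c psi ->
  lift2 phi psi (a ⊗ alg_one B : smash (R0 c) A B) = phi a.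
Proof.
move=> hY hphi hpsi; rewrite (lift2_pure hY hphi hpsi) (super1 hpsi).
exact: is_alg1r (is_modAlg_alg hY) _.
Qed.

Lemma lift2_inr (A B Y : modAlg E) (phi : A -> Y) (psi : B -> Y) b :
  is_modAlg Y -> super_hom c phi -> super_hom c psi ->
  lift2 phi psi (alg_one A ⊗ b : smash (R0 c) A B) = psi b.
Proof.
move=> hY hphi hpsi; rewrite (lift2_pure hY hphi hpsi) (super1 hphi).
exact: is_alg1l (is_modAlg_alg hY) _.
Qed.

(** Q is the trivial one-dimensional module k, whose endomorphism algebra is k. *)
Lemma smash_End_trivial (X : modAlg E) (y : 'I_n -> X) : is_modAlg X ->
  superfull c X -> inner_by c x y -> (forall i, homog c true (y i)) ->
  exists Q : hmodule E, (0 < \dim {:Q})%N /\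
    modAlg_isog X (smash (R0 c) X (End_modAlg Q)).
Proof.
move=> hX fullX iX oy.
have ss : (\1 \o \1 = \1 :> 'End(k^o))%VF by rewrite comp_lfun1l.
have [a [ba a1 aA ac ax]] := parity_module hk hE ss.
pose Q : hmodule E := HModule ba a1 aA.
have Q0 : (0 < \dim {:Q})%N by exact: (@dim_gt0 k k^o 1 (oner_neq0 k)).
exists Q; split=> //.
have hQ := End_modAlg_is_modAlg Q0.
have hS := smash_is_modAlg hk hE hX hQ.
have isS := is_modAlg_alg hS.
have iQ : inner_by c x (A := End_modAlg Q) (fun=> 0).
  by apply: (inner_by0 c hQ) => i f; exact: End_modAlg_x.
have o0 (i : 'I_n) : homog c (A := End_modAlg Q) true 0.
  by rewrite /homog (bilin0r (is_modAlg_bilin hQ)) scaler0.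
apply: (comparison (T := alg_one _) (T' := alg_one _) hE hX hS fullX
  (inl_super_hom hk hE hX hQ) _ iX (smash_inner_by hk hE hX hQ oy o0 iX iQ)).
- have tb := tpure_bilin X (End_modAlg Q).
  elim/(smash_ind hk hE hX hQ) => [r s t [s' <-] [t' <-]|e e' b q _ _].
    by exists (r *: s' + t'); rewrite /inl_smash (bilinDl tb) (bilinZl tb).
  exists ((q : 'End(k^o)) 1 *: b); rewrite /inl_smash (bilinZl tb) -(bilinZr tb).
  congr (_ ⊗ _); apply/lfunP=> r; rewrite scale_lfunE id_lfunE.
  have er : r = (r : k) *: (1 : k^o) by rewrite -[RHS]/(r * 1) mulr1.
  by rewrite {2}er linearZ; exact: mulrC.
- by rewrite is_alg1l.
- by rewrite is_alg1l.
- by have := homog1 hE hS; rewrite /homog scale1r.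
- move=> i; rewrite is_alg1l // is_alg1r // /inl_smash.
  by rewrite (bilin0r (tpure_bilin _ _)) addr0.
Qed.
End GeneratedMaps.

(** * The doubled module *)

Section DoubledModule.
Variable k : fieldType.
Hypothesis hk : 2%N \notin [pchar k].
Variables (V : vectType k) (U : 'End(V)).
Hypothesis UU : (U \o U = \1)%VF.

(** On V x V graded by dbl_s = (U, -U), the operators dbl_e and dbl_u are odd,
    anticommute and have squares -1 and 1, and they supercommute with the diagonal
    copies of End(V), graded by U. *)
Definition dbl (f : 'End(V)) : 'End((V * V)%type) := mk22 f 0 0 f.
Definition dbl_s := mk22 U 0 0 (- U).
Definition dbl_e := mk22 0 (- U) U 0.
Definition dbl_u := mk22 0 U U 0.

Local Notation mk22_simp := (comp_lfun0l, comp_lfun0r, comp_lfunNl, comp_lfunNr, addr0,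
  add0r, oppr0, opprK).

Lemma dbl_ss : (dbl_s \o dbl_s = \1)%VF.
Proof. by rewrite mk22M !mk22_simp UU mk22_1. Qed.

Lemma dbl_ee : (dbl_e \o dbl_e = (-1) *: \1)%VF.
Proof. by rewrite mk22M !mk22_simp UU -mk22_1 mk22Z !scaler0 scaleN1r. Qed.

Lemma dbl_uu : (dbl_u \o dbl_u = \1)%VF.
Proof. by rewrite mk22M !mk22_simp UU mk22_1. Qed.

Lemma dbl_eu : (dbl_e \o dbl_u = - (dbl_u \o dbl_e))%VF.
Proof. by rewrite !mk22M !mk22_simp UU -[RHS]scaleN1r mk22Z !scaleN1r !mk22_simp. Qed.

Lemma dbl_e_odd : (dbl_s \o dbl_e \o dbl_s = (-1) *: dbl_e)%VF.
Proof.
by rewrite !mk22M !mk22_simp mk22Z !scaleN1r !mk22_simp UU !comp_lfun1l.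
Qed.

Lemma dbl_u_odd : (dbl_s \o dbl_u \o dbl_s = (-1) *: dbl_u)%VF.
Proof.
by rewrite !mk22M !mk22_simp mk22Z !scaleN1r !mk22_simp UU !comp_lfun1l.
Qed.

Lemma dblM f g : dbl (f \o g)%VF = (dbl f \o dbl g)%VF.
Proof. by rewrite mk22M !mk22_simp. Qed.

Lemma dbl_lin : linear dbl.
Proof. by move=> r f g; rewrite mk22P !scaler0 !mk22_simp. Qed.

Lemma dbl_c f : (dbl_s \o dbl f \o dbl_s)%VF = dbl (U \o f \o U)%VF.
Proof. by rewrite !mk22M !mk22_simp. Qed.

Let signed_comm e f : (U \o f \o U = (-1) ^+ e *: f)%VF ->
  (f \o U = (-1) ^+ e *: (U \o f))%VF.
Proof. by move=> fe; rewrite comp_lfunZr -fe !comp_lfunA UU comp_lfun1l. Qed.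

Lemma dbl_e_comm e f : (U \o f \o U = (-1) ^+ e *: f)%VF ->
  (dbl f \o dbl_e = (-1) ^+ e *: (dbl_e \o dbl f))%VF.
Proof. by move=> /signed_comm fU; rewrite !mk22M !mk22_simp mk22Z !scaler0 fU scalerN. Qed.

Lemma dbl_u_comm e f : (U \o f \o U = (-1) ^+ e *: f)%VF ->
  (dbl f \o dbl_u = (-1) ^+ e *: (dbl_u \o dbl f))%VF.
Proof. by move=> /signed_comm fU; rewrite !mk22M !mk22_simp mk22Z !scaler0 fU. Qed.

(** The even product dbl_e dbl_u is the diagonal matrix (-1, 1), from which the
    idempotents (1, 0) and (0, 1) are obtained. Together with the flip U dbl_u
    and the diagonal copies they give all matrices. *)
Lemma dbl_span (T : 'End((V * V)%type) -> Prop) : op_closed T ->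
  (forall f, T (dbl f)) -> T dbl_e -> T dbl_u -> forall F, T F.
Proof.
move=> cT Td Te Tu F; have h2 := two_neq0 hk.
have TZ r f : T f -> T (r *: f) by exact: op_closedZ.
have TD f g : T f -> T g -> T (f + g) by exact: op_closedD.
have TM : forall f g, T f -> T g -> T (f \o g)%VF := cT.2.
have half (f : 'End(V)) : f = 2^-1 *: (f + f).
  by rewrite -mulr2n -scaler_nat scalerA mulVf // scale1r.
have T11 : T (mk22 \1 0 0 0).
  have -> : mk22 \1 0 0 0 = 2^-1 *: (dbl \1 + (-1) *: (dbl_e \o dbl_u)%VF).
    rewrite [(_ \o _)%VF]mk22M !mk22_simp UU mk22Z mk22D mk22Z !scaleN1r !mk22_simp.
    by rewrite -half !subrr !scaler0.
  by apply/TZ/TD => //; apply/TZ/TM.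
have T22 : T (mk22 0 0 0 \1).
  have -> : mk22 0 0 0 \1 = dbl \1 + (-1) *: mk22 \1 0 0 0 :> 'End((V * V)%type).
    by rewrite mk22Z mk22D !scaleN1r !mk22_simp subrr.
  by apply/TD => //; apply/TZ.
have TJ : T (mk22 0 \1 \1 0).
  have -> : mk22 0 \1 \1 0 = (dbl U \o dbl_u)%VF by rewrite mk22M !mk22_simp UU.
  exact: TM.
have [a [b [d [e ->]]]] := mk22_ex F.
have -> : mk22 a b d e = (dbl a \o mk22 \1 0 0 0)%VF
    + (dbl b \o (mk22 \1 0 0 0 \o mk22 0 \1 \1 0))%VF
    + ((dbl d \o (mk22 0 0 0 \1 \o mk22 0 \1 \1 0))%VF + (dbl e \o mk22 0 0 0 \1)%VF).
  by rewrite !mk22M !mk22_simp !comp_lfun1r !mk22D !mk22_simp.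
by apply: (TD); apply: (TD); do ?apply: (TM).
Qed.

End DoubledModule.

(** * Elements implementing the x_i *)

Section CliffordElements.
Variables (k : fieldType) (n : nat) (E : hopfAlg k) (c : E) (x : 'I_n -> E).
Hypothesis hk : 2%N \notin [pchar k].
Hypothesis hE : is_En c x.

Lemma A_omega_superfull (M : 'M[k]_n) (w : 'Hom(tens E E, k^o)) :
  is_special_cocycle c x M w -> superfull c (A_omega w).
Proof.
move=> hw; have [cw lw _ _ _] := hw.
exact: (End_superfull hk hE (A_omega_is_modAlg cw lw) (clif_cc hE hw) (A_omega_c hE hw)).
Qed.

(** The anticommutator of C_inner j with z_i has to be - delta_ij, which forces
    the coefficients -(1/2) L^-1. *)
Definition C_inner (L : 'M[k]_n) (A : falgType k) (z : 'I_n -> A) (j : 'I_n) : A :=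
  - 2^-1 *: \sum_l invmx L j l *: z l.

Lemma C_inner_by alpha (L : 'M[k]_n) (A : falgType k) (aA : E -> A -> A)
    (u : A) (z : 'I_n -> A) : L^T = L -> L \in unitmx -> is_modAlg (modAlg_of aA) ->
  presented (@C_rels k n alpha L) (oapp z u) ->
  aA c u = - u -> (forall i, aA c (z i) = - z i) -> (forall j, aA (x j) u = 0) ->
  (forall i j, aA (x j) (z i) = (i == j)%:R) ->
  inner_by c x (A := modAlg_of aA) (C_inner L z).
Proof.
move=> Ls Lu hA pr su sz xu xz; have h2 := two_neq0 hk.
have [[/= _ uz zz _] _] := pr.
apply: (generated_inner_by hE hA (C_generates pr)) => [[]|i [j|]] //=.
- rewrite xz /C_inner -scalerAl -scalerAr -scalerDr mulr_suml mulr_sumr -big_split /=.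
  transitivity ((\sum_l invmx L i l * L l j) *: (1 : A)).
    have /matrixP/(_ i j) := mulVmx Lu; rewrite !mxE => ->.
    by rewrite eq_sym; case: (i == j); rewrite ?scale1r ?scale0r.
  rewrite scaleNr opprK scaler_sumr scaler_suml; apply: eq_bigr => l _.
  rewrite -scalerAl -scalerAr -scalerDr zz !scalerA; congr (_ *: _).
  by field.
- rewrite xu /C_inner -scalerAl -scalerAr -scalerDr mulr_suml mulr_sumr -big_split /=.
  rewrite big1 ?scaler0 ?oppr0 // => l _.
  by rewrite -scalerAl -scalerAr -scalerDr addrC uz scaler0.
Qed.

Lemma C_inner_odd (L : 'M[k]_n) (A : falgType k) (aA : E -> A -> A) (z : 'I_n -> A) j :
  is_modAlg (modAlg_of aA) -> (forall i, aA c (z i) = - z i) ->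
  homog c (A := modAlg_of aA) true (C_inner L z j).
Proof.
move=> hA sz; have bA := is_modAlg_bilin hA : is_bilinear aA.
rewrite /homog [act _ _](bilinZr bA) expr1 scaleN1r /C_inner -scalerN; congr (_ *: _).
rewrite (bilin_sumr bA) -sumrN; apply: eq_bigr => l _.
by rewrite (bilinZr bA) sz scalerN.
Qed.

Section Transport.
Variables (w : 'Hom(tens E E, k^o)) (L : 'M[k]_n).
Hypotheses (Ls : L^T = L) (Lu : L \in unitmx).
Hypothesis hw : is_special_cocycle c x (invmx (4 *: L)) w.

(** The inverse of the formula that expresses C_inner by the z_i, applied to the
    elements y_i of A^omega. *)
Definition A_omega_z (i : 'I_n) : 'End(E) := -2 *: \sum_j L i j *: clif_y c x w j.

(** This is where the matrix (4L)^-1 comes from: the anticommutators of the Z_i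
    are 4 L (2M) L = 2 L. *)
Lemma A_omega_zz i j : (A_omega_z i \o A_omega_z j)%VF + (A_omega_z j \o A_omega_z i)%VF
  = (2 * L i j) *: \1%VF.
Proof.
have h2 := two_neq0 hk; have h4 : (4 : k) != 0.
  by rewrite (natrM _ 2 2) mulf_neq0.
pose M := invmx (4 *: L); have Mu : 4 *: L \in unitmx.
  by rewrite unitmxZ // unitfE.
have ML : L *m M = 4^-1 *: 1%:M.
  have := mulmxV Mu; rewrite -scalemxAl => e.
  by rewrite -e scalerA mulVf // scale1r.
have Ms : M^T = M by rewrite /M trmx_inv linearZ /= Ls.
have LML : L *m M *m L = 4^-1 *: L by rewrite ML -scalemxAl mul1mx.
have comp_sum (a b : 'I_n -> k) : ((\sum_l a l *: clif_y c x w l) \o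
    (\sum_m b m *: clif_y c x w m))%VF = \sum_l \sum_m (a l * b m) *:
      (clif_y c x w l \o clif_y c x w m)%VF.
  rewrite (big_morph (fun f => (f \o _)%VF) (fun f g => comp_lfunDl f g _) (comp_lfun0l _ _)).
  apply: eq_bigr => l _.
  rewrite (big_morph (fun f => (_ \o f)%VF) (comp_lfunDr _) (comp_lfun0r _ _)).
  by apply: eq_bigr => m _; rewrite -comp_lfunZl -comp_lfunZr scalerA.
rewrite /A_omega_z -!comp_lfunZl -!comp_lfunZr -!scalerDr scalerA !comp_sum.
rewrite [X in _ + X]exchange_big -big_split /=.
under eq_bigr => l _ do rewrite -big_split /=.
transitivity ((4 * \sum_l \sum_m L i l * L j m * (M l m + M m l)) *: (\1%VF : 'End(E))).
  rewrite -[RHS]scalerA; congr (_ *: _); first by ring.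
  rewrite scaler_suml; apply: eq_bigr => l _; rewrite scaler_suml.
  apply: eq_bigr => m _; rewrite [L j m * L i l]mulrC -scalerDr (clif_yyD hE hw) scalerA.
  by [].
congr (_ *: _).
have -> : \sum_l \sum_m L i l * L j m * (M l m + M m l) = 2 * (L *m M *m L) i j.
  rewrite mxE exchange_big mulr_sumr; apply: eq_bigr => m _.
  rewrite !mxE mulr_suml mulr_sumr; apply: eq_bigr => l _.
  have -> : M m l = M l m by rewrite -[in LHS]Ms mxE.
  have -> : L j m = L m j by rewrite -[in LHS]Ls mxE.
  by ring.
by rewrite LML mxE; field.
Qed.

Lemma A_omega_z_inv j : clif_y c x w j = - 2^-1 *: \sum_l invmx L j l *: A_omega_z l.
Proof.
have h2 := two_neq0 hk.
rewrite /A_omega_z; under eq_bigr => l _ do rewrite scalerA mulrC -scalerA.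
rewrite -scaler_sumr scalerA mulrNN mulVf // scale1r.
under eq_bigr => l _ do rewrite scaler_sumr.
rewrite exchange_big (bigD1 j) //= [X in _ + X]big1 ?addr0 => [|m mj].
  under eq_bigr => l _ do rewrite scalerA.
  have /matrixP/(_ j j) := mulVmx Lu; rewrite !mxE eqxx -scaler_suml => ->.
  by rewrite scale1r.
under eq_bigr => l _ do rewrite scalerA.
have /matrixP/(_ j m) := mulVmx Lu; rewrite !mxE -scaler_suml => ->.
by rewrite eq_sym (negPf mj) scale0r.
Qed.

Lemma A_omega_z_odd i : homog c (A := A_omega w) true (A_omega_z i).
Proof.
have [cw lw _ _ _] := hw; have hW := A_omega_is_modAlg cw lw.
have bW := is_modAlg_bilin hW.
rewrite /homog [act _ _](bilinZr bW) expr1 scaleN1r /A_omega_z -scalerN; congr (_ *: _).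
rewrite (bilin_sumr bW) -sumrN; apply: eq_bigr => l _.
by rewrite (bilinZr bW) (clif_y_odd hE hw) expr1 scaleN1r scalerN.
Qed.

End Transport.
End CliffordElements.

(** * The comparison isomorphism *)

Section Comparison.
Variables (k : fieldType) (n : nat) (E : hopfAlg k) (c : E) (x : 'I_n -> E).
Hypothesis hk : 2%N \notin [pchar k].
Hypothesis hE : is_En c x.
Variables (alpha : k) (L : 'M[k]_n).
Hypotheses (alpha0 : alpha != 0) (Ls : L^T = L) (Lu : L \in unitmx).
Variables (C Cm1 Calpha A1 : falgType k).
Variables (actC : E -> C -> C) (actCm1 : E -> Cm1 -> Cm1).
Variables (actCalpha : E -> Calpha -> Calpha) (actA1 : E -> A1 -> A1).
Hypotheses (hC : is_C c x alpha L actC) (hCm1 : is_Ct c x (-1) actCm1).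
Hypotheses (hCalpha : is_Ct c x alpha actCalpha) (hA1 : is_A1 c x L actA1).
Variable w : 'Hom(tens E E, k^o).
Hypothesis hw : is_special_cocycle c x (invmx (4 *: L)) w.
Let R := R0 c.
Let D12 := smash R (modAlg_of actCm1) (modAlg_of actCalpha).
Let D := smash R D12 (modAlg_of actA1).
Let W := A_omega w.
Let X := smash R D W.
Let U : 'End(E) := clif_c c w.
Let UU : (U \o U = \1)%VF := clif_cc hE hw.
Let mC := hC.1.
Let m1 := hCm1.1.
Let ma := hCalpha.1.
Let mA1 := hA1.1.
Let mD12 : is_modAlg D12 := smash_is_modAlg hk hE m1 ma.
Let mD : is_modAlg D := smash_is_modAlg hk hE mD12 mA1.
Let mW : is_modAlg W.
Proof. by have [cw lw _ _ _] := hw; exact: A_omega_is_modAlg. Qed.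
Let mX : is_modAlg X := smash_is_modAlg hk hE mD mW.

Lemma C_full : superfull c (modAlg_of actC).
Proof.
have [_ [u [z [pr su sz _ _]]]] := hC.
exact: (C_superfull hk hE alpha0 Ls Lu mC pr su sz).
Qed.

Lemma D_full : superfull c D.
Proof.
have [_ [y1 [pr1 sy1 _]]] := hCm1; have [_ [ya [pra sya _]]] := hCalpha.
have [_ [u [z [pr su sz _ _]]]] := hA1.
have f1 : superfull c (modAlg_of actCm1).
  by apply: (Ct_superfull hk hE _ m1 pr1 sy1); rewrite oppr_eq0 oner_eq0.
have fa := Ct_superfull hk hE alpha0 ma pra sya.
have fA := C_superfull hk hE (oner_neq0 k) Ls Lu mA1 pr su sz.
exact: (smash_superfull hk hE mD12 mA1 (smash_superfull hk hE m1 ma f1 fa) fA).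
Qed.

Lemma X_full : superfull c X.
Proof. exact: (smash_superfull hk hE mD mW D_full (A_omega_superfull hk hE hw)). Qed.

Lemma D_x0 i (a : D) : act (x i) a = 0.
Proof.
have [_ [y1 [pr1 sy1 xy1]]] := hCm1; have [_ [ya [pra sya xya]]] := hCalpha.
have [_ [u [z [pr su sz xu xz]]]] := hA1.
have x1 := x0_generated hE m1 (Ct_generates pr1) (fun _ => sy1) (fun i _ => xy1 i).
have xa := x0_generated hE ma (Ct_generates pra) (fun _ => sya) (fun i _ => xya i).
apply: (smash_x0 hk hE mD12 mA1 (smash_x0 hk hE m1 ma x1 xa)).
apply: (x0_generated hE mA1 (C_generates pr)) => [[j|]|i' [j|]] /=.
- exact: sz.
- exact: su.
- exact: xz.
- exact: xu.
Qed.

Let yX (i : 'I_n) : X := (0 : D) ⊗ alg_one W + alg_one D ⊗ (clif_y c x w i : W).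

Let homog0 (A : modAlg E) : is_modAlg A -> homog c true (0 : A).
Proof. by move=> hA; rewrite /homog (bilin0r (is_modAlg_bilin hA)) scaler0. Qed.

Lemma X_inner : inner_by c x yX.
Proof.
apply: (smash_inner_by hk hE mD mW) => //.
- by move=> _; exact: homog0.
- by move=> i; exact: (clif_y_odd hE hw i).
- exact: (inner_by0 c mD D_x0).
- exact: (A_omega_inner hE hw).
Qed.

Let yX_odd i : homog c true (yX i).
Proof.
rewrite /yX (bilin0l (tpure_bilin _ _)) add0r.
exact: (homog_tpure hE mD mW (homog1 hE mD) (clif_y_odd hE hw i)).
Qed.

Let double_dim : (0 < \dim {:(E * E)%type})%N.
Proof.
apply: (@dim_gt0 k (E * E)%type (1, 0)); apply/eqP => -[e].
by move/eqP: (oner_neq0 E); rewrite e.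
Qed.

(* A module P on E x E given by the grading dbl_s alone, and the algebra
   Y = C(alpha, L) # End(P). *)
Section Target.
Variables (P : (E -> (E * E)%type -> (E * E)%type)).
Hypotheses (bP : is_bilinear P) (P1 : forall m, P 1 m = m).
Hypothesis PA : forall g h m, P (g * h) m = P g (P h m).
Hypothesis Pc : forall m, P c m = dbl_s U m.
Hypothesis Px : forall i m, P (x i) m = 0.
Let PE : hmodule E := HModule bP P1 PA.
Let B := End_modAlg PE.
Let Y := smash R (modAlg_of actC) B.
Let mB : is_modAlg B := End_modAlg_is_modAlg (P := PE) double_dim.
Let mY : is_modAlg Y := smash_is_modAlg hk hE mC mB.
Let isY := is_modAlg_alg mY.
Let bY := is_alg_bilin isY.

Let Bc (F : B) : act c F = (dbl_s U \o F \o dbl_s U)%VF :> 'End((E * E)%type).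
Proof. exact: (End_modAlg_c hE (P := PE) (s := dbl_s U) F Pc). Qed.

Let inl (a : C) : Y := @inl_smash k E c (modAlg_of actC) B a.
Let inr (F : 'End((E * E)%type)) : Y := @inr_smash k E c (modAlg_of actC) B F.

Let inl_hom : super_hom c (A := modAlg_of actC) inl := inl_super_hom hk hE mC mB.
Let inr_hom : super_hom c (A := B) inr := inr_super_hom hk hE mC mB.

Let inrM (F G : 'End((E * E)%type)) : alg_mul (inr F) (inr G) = inr (F \o G)%VF.
Proof. by rewrite [RHS](superM inr_hom). Qed.
Let inrZ r (F : 'End((E * E)%type)) : inr (r *: F) = r *: inr F.
Proof. exact: (linearZ_LR (lin_of (super_lin inr_hom))). Qed.
Let inlM (a b : C) : alg_mul (inl a) (inl b) = inl (a * b).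
Proof. by rewrite [RHS](superM inl_hom). Qed.
Let inlZ r (a : C) : inl (r *: a) = r *: inl a.
Proof. exact: (linearZ_LR (lin_of (super_lin inl_hom))). Qed.
Let inlD (a b : C) : inl (a + b) = inl a + inl b.
Proof. exact: (linearD (lin_of (super_lin inl_hom))). Qed.
Let inrD (F G : 'End((E * E)%type)) : inr (F + G) = inr F + inr G.
Proof. exact: (linearD (lin_of (super_lin inr_hom))). Qed.

Let inr_inl_odd e (a : C) (F : B) : homog c (A := modAlg_of actC) true a ->
  homog c e F -> alg_mul (inr F) (inl a) = (-1) ^+ e *: alg_mul (inl a) (inr F).
Proof.
move=> ha hF; rewrite [LHS](inr_inl hk mC mB ha hF) andbT.
by rewrite [in RHS]/inl [in RHS]/inr (inl_inr hk hE mC mB).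
Qed.

Let e_odd : homog c (A := B) true (dbl_e U).
Proof. by rewrite /homog [act _ _]Bc (dbl_e_odd UU). Qed.
Let u_odd : homog c (A := B) true (dbl_u U).
Proof. by rewrite /homog [act _ _]Bc (dbl_u_odd UU). Qed.

Let phi4 (f : W) : Y := inr (dbl f).

Let Wc (f : 'End(E)) : @act _ _ W c f = (U \o f \o U)%VF.
Proof. exact: (A_omega_c hE hw). Qed.

Let dbl_homog e (f : W) : homog c e f -> homog c (A := B) e (dbl f).
Proof.
move=> hf; rewrite /homog [act _ _]Bc dbl_c -Wc [act c f]hf.
exact: (linearZ_LR (lin_of (@dbl_lin _ _))).
Qed.

Let phi4_hom : super_hom c phi4.
Proof.
split.
- by move=> r f g; rewrite /phi4 dbl_lin (super_lin inr_hom).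
- by rewrite /phi4 [dbl _]mk22_1; exact: (super1 inr_hom).
- by move=> f g; rewrite /phi4 dblM inrM.
- by move=> f; rewrite /phi4 [act c f]Wc -dbl_c -Bc; exact: (super_c inr_hom).
Qed.

Let phi4_e e (f : W) : homog c e f ->
  alg_mul (phi4 f) (inr (dbl_e U)) = (-1) ^+ e *: alg_mul (inr (dbl_e U)) (phi4 f).
Proof.
move=> hf; rewrite /phi4 !inrM -inrZ; congr inr.
by apply: (dbl_e_comm UU); rewrite -Wc [LHS]hf.
Qed.

Let phi4_u e (f : W) : homog c e f ->
  alg_mul (phi4 f) (inr (dbl_u U)) = (-1) ^+ e *: alg_mul (inr (dbl_u U)) (phi4 f).
Proof.
move=> hf; rewrite /phi4 !inrM -inrZ; congr inr.
by apply: (dbl_u_comm UU); rewrite -Wc [LHS]hf.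
Qed.

Let inr_odd F : homog c (A := B) true F -> homog c true (inr F).
Proof. exact: super_homog inr_hom. Qed.
Let inl_odd a : homog c (A := modAlg_of actC) true a -> homog c true (inl a).
Proof. exact: super_homog inl_hom. Qed.

(** The four generating pieces of X are sent to Y by phi1, .., phi4. Their images
    supercommute, which on generators are the relations among u, z, dbl_e, dbl_u
    and the diagonal operators, so that they combine to a superalgebra map Psi. *)
Lemma X_isog_Y : modAlg_isog X Y.
Proof.
have h2 := two_neq0 hk.
have [_ [u [z [prC su sz xu xz]]]] := hC.
have [_ [y1 [pr1 sy1 _]]] := hCm1; have [_ [ya [pra sya _]]] := hCalpha.
have [_ [u' [z' [prA su' sz' _ _]]]] := hA1.
have [[/= uu uz zz _] _] := prC.
have ou : homog c (A := modAlg_of actC) true u by rewrite /homog expr1 scaleN1r.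
have oz i : homog c (A := modAlg_of actC) true (z i) by rewrite /homog expr1 scaleN1r; exact: sz.
have inl1 : inl 1 = alg_one Y by [].
have inlN a : inl (- a) = - inl a by exact: (linearN (lin_of (super_lin inl_hom))).
have inrN a : inr (- a) = - inr a by exact: (linearN (lin_of (super_lin inr_hom))).
have [phi1 [h1 phi1y]] : exists phi1, super_hom c (A := modAlg_of actCm1) phi1
    /\ phi1 y1 = inr (dbl_e U).
  apply: (Ct_lift hE m1 mY pr1 sy1); first exact: inr_odd.
  by rewrite inrM (dbl_ee UU) inrZ.
have [phi2 [h2' phi2y]] : exists phi2, super_hom c (A := modAlg_of actCalpha) phi2
    /\ phi2 ya = inl u.
  apply: (Ct_lift hE ma mY pra sya); first exact: inl_odd.
  by rewrite inlM -expr2 uu inlZ.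
have [phi3 [h3 phi3u phi3z]] : exists phi3, [/\ super_hom c (A := modAlg_of actA1) phi3,
    phi3 u' = inr (dbl_u U) & forall i, phi3 (z' i) = inl (z i)].
  apply: (C_lift hk hE (yz := fun i => inl (z i)) mA1 mY prA su' sz').
  - exact: inr_odd.
  - by move=> i; exact: inl_odd.
  - by rewrite inrM (dbl_uu UU) scale1r.
  - move=> i; rewrite (inr_inl_odd (oz i) u_odd) expr1 scaleN1r addNr //.
  - by move=> i j; rewrite !inlM -inlD zz inlZ.
have gen1 := Ct_generates pr1; have gena := Ct_generates pra.
have genA := C_generates prA.
have sgA (i : option 'I_n) : actA1 c (oapp z' u' i) = - oapp z' u' i by case: i.
have inr_inl_odd' a (F : B) : homog c (A := modAlg_of actC) true a ->
    homog c true F -> alg_mul (inr F) (inl a) = - alg_mul (inl a) (inr F).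
  by move=> ha hF; rewrite (inr_inl_odd ha hF) expr1 scaleN1r.
have s12 : supercomm c phi1 phi2.
  apply: (generated_supercomm2 hE m1 ma mY h1 h2' gen1 gena) => // _ _.
  by rewrite [phi1 _]phi1y [phi2 _]phi2y; exact: inr_inl_odd'.
have s13 : supercomm c phi1 phi3.
  apply: (generated_supercomm2 hE m1 mA1 mY h1 h3 gen1 genA) => // _ [i|].
    by rewrite [phi1 _]phi1y [phi3 _]phi3z; exact: inr_inl_odd'.
  by rewrite [phi1 _]phi1y [phi3 _]phi3u !inrM (dbl_eu UU) inrN.
have s23 : supercomm c phi2 phi3.
  apply: (generated_supercomm2 hE ma mA1 mY h2' h3 gena genA) => // _ [i|].
    rewrite [phi2 _]phi2y [phi3 _]phi3z !inlM -inlN; congr inl; apply/eqP.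
    by rewrite -addr_eq0 uz.
  by rewrite [phi2 _]phi2y [phi3 _]phi3u [in RHS]inr_inl_odd' ?opprK.
have s14 : supercomm c phi1 phi4.
  move=> e f a hf; apply: (generated_supercomm hE m1 mY h1 gen1) => // _.
  by rewrite [phi1 _]phi1y; exact: phi4_e.
have s24 : supercomm c phi2 phi4.
  move=> e f a hf; apply: (generated_supercomm hE ma mY h2' gena) => // _.
  by rewrite [phi2 _]phi2y; apply: inr_inl_odd => //; exact: dbl_homog.
have s34 : supercomm c phi3 phi4.
  move=> e f a hf; apply: (generated_supercomm hE mA1 mY h3 genA) => // -[i|].
    by rewrite [phi3 _]phi3z; apply: inr_inl_odd => //; exact: dbl_homog.
  by rewrite [phi3 _]phi3u; exact: phi4_u.
pose phi12 : D12 -> Y := lift2 phi1 phi2.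
have h12 : super_hom c phi12 := lift2_super_hom hk hE m1 ma mY h1 h2' s12.
have s123 : supercomm c phi12 phi3 := lift2_supercomm hk hE m1 ma mY h1 h2' s13 s23.
have s124 : supercomm c phi12 phi4 := lift2_supercomm hk hE m1 ma mY h1 h2' s14 s24.
pose phiD : D -> Y := lift2 phi12 phi3.
have hD : super_hom c phiD := lift2_super_hom hk hE mD12 mA1 mY h12 h3 s123.
have sD4 : supercomm c phiD phi4 := lift2_supercomm hk hE mD12 mA1 mY h12 h3 s124 s34.
pose Psi : X -> Y := lift2 phiD phi4.
have hPsi : super_hom c Psi := lift2_super_hom hk hE mD mW mY hD phi4_hom sD4.
have phi4Z r f : phi4 (r *: f) = r *: phi4 f by exact: (linearZ_LR (lin_of (super_lin phi4_hom))).
have phi4D f g : phi4 (f + g) = phi4 f + phi4 g by exact: (linearD (lin_of (super_lin phi4_hom))).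
have phi4_sum (F : 'I_n -> W) : phi4 (\sum_l F l) = \sum_l phi4 (F l).
  exact: (linear_sum (lin_of (super_lin phi4_hom))).
have inl_sum (F : 'I_n -> C) : inl (\sum_l F l) = \sum_l inl (F l).
  exact: (linear_sum (lin_of (super_lin inl_hom))).
(* Psi is onto: its image is a subalgebra containing both factors of Y. *)
pose rg (y : Y) := exists s, Psi s = y.
have rgM y y' : rg y -> rg y' -> rg (alg_mul y y').
  by move=> [s <-] [t <-]; exists (alg_mul s t); rewrite (superM hPsi).
have rgL r y y' : rg y -> rg y' -> rg (r *: y + y').
  by move=> [s <-] [t <-]; exists (r *: s + t); rewrite (super_lin hPsi).
have rgD d : rg (phiD d) by exists (d ⊗ alg_one W); exact: (lift2_inl d mY hD phi4_hom).
have rgW f : rg (phi4 f) by exists (alg_one D ⊗ f); exact: (lift2_inr f mY hD phi4_hom).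
have rg12 d : rg (phi12 d) by rewrite -(lift2_inl d mY h12 h3); exact: rgD.
have rg3 a : rg (phi3 a) by rewrite -(lift2_inr a mY h12 h3); exact: rgD.
have rg1 a : rg (phi1 a) by rewrite -(lift2_inl a mY h1 h2'); exact: rg12.
have rg2 a : rg (phi2 a) by rewrite -(lift2_inr a mY h1 h2'); exact: rg12.
have rgr F : rg (inr F).
  apply: (dbl_span hk UU (T := fun F => rg (inr F))).
  - split=> [r f g rf rg'|f g rf rg']; first by rewrite inrD inrZ; exact: rgL.
    by rewrite -inrM; exact: rgM.
  - exact: rgW.
  - by rewrite -phi1y; exact: rg1.
  - by rewrite -phi3u; exact: rg3.
have rgl a : rg (inl a).
  move: a; apply: (C_generates prC) => [|r a b ra rb|[i|] a ra].
  - by rewrite inl1 -(super1 hPsi); exists (alg_one X).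
  - by rewrite inlD inlZ; exact: rgL.
  - by rewrite -inlM; apply: rgM => //; rewrite -phi3z; exact: rg3.
  - by rewrite -inlM; apply: rgM => //; rewrite -phi2y; exact: rg2.
have Psi_surj y : rg y.
  move: y; apply: (smash_ind hk hE mC mB) => [r s t|e e' a F _ _]; first exact: rgL.
  by rewrite -(inl_inr hk hE mC mB); exact: rgM (rgl a) (rgr F).
have oyC j := C_inner_odd L j mC sz.
have iC := C_inner_by hk hE Ls Lu mC prC su sz xu xz.
have xB i (F : B) : act (x i) F = 0 by exact: (End_modAlg_x hE (P := PE) F i Px).
have iY := smash_inner_by hk hE mC mB oyC (fun _ => homog0 mB) iC (inner_by0 c mB xB).
have [T [T' [TT' T'T cT TZ]]] : exists T T' : Y, [/\ alg_mul T T' = alg_one Y,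
    alg_mul T' T = alg_one Y, act c T = T & forall i,
    alg_mul T (phi4 (A_omega_z c x w L i)) = alg_mul (inl (z i)) T].
  apply: (quarter_turn_modAlg hk hE (L := L)) => // [i|i|i j|i j|i j].
  - exact: inl_odd.
  - exact: super_homog phi4_hom (A_omega_z_odd hE hw i).
  - by rewrite !inlM -inlD zz inlZ.
  - rewrite -!(superM phi4_hom) -phi4D -(super1 phi4_hom) -phi4Z; congr phi4.
    exact: (A_omega_zz hk hE Ls Lu hw).
  - rewrite (inr_inl_odd (oz i) (dbl_homog (A_omega_z_odd hE hw j))).
    by rewrite expr1 scaleN1r subrr.
(* The families implementing the x_i are -(1/2) L^-1 times the families Z and z
   that T intertwines. *)
apply: (comparison hE mX mY X_full hPsi Psi_surj X_inner iY TT' T'T cT) => i.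
have -> : Psi (yX i) = phi4 (clif_y c x w i).
  have -> : yX i = alg_one D ⊗ (clif_y c x w i : W).
    by rewrite /yX (bilin0l (tpure_bilin _ _)) add0r.
  exact: (lift2_inr _ mY hD phi4_hom).
have -> : C_inner L z i ⊗ alg_one B + alg_one (modAlg_of actC) ⊗ (0 : B)
    = inl (C_inner L z i) by rewrite (bilin0r (tpure_bilin _ _)) addr0.
rewrite (A_omega_z_inv c x hk w Lu) /C_inner phi4Z inlZ phi4_sum inl_sum.
rewrite (bilinZr bY) (bilinZl bY) (bilin_sumr bY) (bilin_suml bY); congr (_ *: _).
apply: eq_bigr => l _.
by rewrite phi4Z inlZ (bilinZr bY) (bilinZl bY) TZ.
Qed.

End Target.

Lemma C_brauer_X : BM_eq R (modAlg_of actC) X.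
Proof.
split; first exact: (superfull_azumaya hk hE mC C_full).
  exact: (superfull_azumaya hk hE mX X_full).
have [P [bP P1 PA Pc Px]] := parity_module hk hE (dbl_ss UU).
have [Q [Q0 XQ]] := smash_End_trivial hk hE mX X_full X_inner yX_odd.
exists (HModule bP P1 PA), Q; split=> //.
exact: modAlg_isog_trans (modAlg_isog_sym (X_isog_Y bP P1 PA Pc Px)) XQ.
Qed.

End Comparison.

Theorem proposition3p4 (k : fieldType) (n : nat)
    (hk : 2%N \notin [pchar k]) (hn : (0 < n)%N)
    (E : hopfAlg k) (c : E) (x : 'I_n -> E) (hE : is_En c x)
    (alpha : k) (halpha : alpha != 0)
    (L : 'M[k]_n) (hLsym : L^T = L) (hLinv : L \in unitmx)
    (C Cm1 Calpha A1 : falgType k)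
    (actC : E -> C -> C) (hC : is_C c x alpha L actC)
    (actCm1 : E -> Cm1 -> Cm1) (hCm1 : is_Ct c x (-1) actCm1)
    (actCalpha : E -> Calpha -> Calpha) (hCalpha : is_Ct c x alpha actCalpha)
    (actA1 : E -> A1 -> A1) (hA1 : is_A1 c x L actA1)
    (omega : 'Hom(tens E E, k^o))
    (homega : is_special_cocycle c x (invmx (4 *: L)) omega) :
  let R := R0 c in
  let D := smash R (smash R (modAlg_of actCm1) (modAlg_of actCalpha))
                   (modAlg_of actA1) in
  [/\ azumaya R D, azumaya R (A_omega omega)
    & BM_eq R (modAlg_of actC) (smash R D (A_omega omega))].
Proof.
have [cw lw _ _ _] := homega.
split.
- apply: (superfull_azumaya hk hE).
    apply: (smash_is_modAlg hk hE _ hA1.1).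
    exact: (smash_is_modAlg hk hE hCm1.1 hCalpha.1).
  exact: (D_full hk hE halpha hLsym hLinv hCm1 hCalpha hA1).
- exact: (superfull_azumaya hk hE (A_omega_is_modAlg cw lw) (A_omega_superfull hk hE homega)).
- exact: (C_brauer_X hk hE halpha hLsym hLinv hC hCm1 hCalpha hA1 homega).
Qed.
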